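(* Let $\mu$ be a Borel probability measure on $\mathbb{R}^d$ which has a logarithmic gradient, let $c>0$, and let $v=(v_i)_{i=1}^d:\mathbb{R}^d\to\mathbb{R}^d$ be a function such that, for some function $K$ on $\mathbb{R}^d$ taking values in the $d\times d$ real matrices, with $i$-th row denoted $K_i$, the $\mu$-divergence $\delta_\mu(K_i)$ exists and $$v_i=\delta_\mu(K_i),\qquad i=1,\dots,d.$$ I. The following two statements are equivalent. (A1) $\widehat Z^{v}(\mu)\subset \widehat Z(\gamma_c)$. (B1) For any smooth function $f:\mathbb{R}^d\to[0,1]$ with compact support, $$\left\|\mathbf{E}_\mu (K\nabla f)\right\|\le c\, I(\mathbf{E}_\mu f).$$ If, in addition, $K:\mathbb{R}^d\to\mathbb{R}^{d\times d}$ is Lipschitz, then (A1) and (B1) are equivalent to the following. (C1) For any $h\in\mathbb{R}^d$ and any Borel set $A\subset\mathbb{R}^d$, $$\Phi\big(\Phi^{-1}(\mu(A))-c\|h\|\big)\le \mu\Big(\big[\Psi^{K,h}_1\big]^{-1}(A)\Big)\le \Phi\big(\Phi^{-1}(\mu(A))+c\|h\|\big).$$ II. If $\widehat Z^{v}(\mu)\subset \widehat Z(\gamma_c)$ (equivalently, if $\left\|\mathbf{E}_\mu (K\nabla f)\right\|\le c\, I(\mathbf{E}_\mu f)$ for any smooth function $f:\mathbb{R}^d\to[0,1]$ with compact support), then for any smooth function $f:\mathbb{R}^d\to[0,\infty)$ with compact support, $$\left\|\mathbf{E}_\mu (K\nabla f)\right\|^2\le 2c^2\,\mathbf{Ent}_\mu(f)\,\mathbf{E}_\mu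 f.$$
   Context: $\|\cdot\|$ is the Euclidean norm on $\mathbb{R}^d$; elements of $\mathbb{R}^d$ are column vectors. For a measurable (possibly vector-valued) $f$, $\mathbf{E}_\mu f=\int f\,d\mu$ (component-wise). For $f\ge 0$, $\mathbf{Ent}_\mu(f)=\mathbf{E}_\mu(f\log f)-(\mathbf{E}_\mu f)\log(\mathbf{E}_\mu f)$, with $0\log 0=0$. Weighted lift zonoid: for a Borel probability measure $\mu$ on $\mathbb{R}^d$ and measurable $v:\mathbb{R}^d\to\mathbb{R}^d$ with $\int\|v\|\,d\mu<\infty$, $$\widehat Z^v(\mu)=\Big\{\Big(\int g\,d\mu,\ \int g\,v\,d\mu\Big)\in\mathbb{R}^{d+1}:\ g:\mathbb{R}^d\to[0,1]\text{ Borel measurable}\Big\}.$$ The (usual) lift zonoid $\widehat Z(\mu)$ is the case $v(x)=x$. $\gamma_c$ is the centered Gaussian measure on $\mathbb{R}^d$ with covariance matrix $c^2 I_{\mathbb{R}^d}$ ($I_{\mathbb{R}^d}$ the identity matrix). $\phi(x)=\frac{1}{\sqrt{2\pi}}e^{-x^2/2}$, $\Phi(x)=\int_{-\infty}^x\phi(y)\,dy$, with the usual conventions $\Phi^{-1}(0)=-\infty$, $\Phi^{-1}(1)=+\infty$, $\Phi(-\infty)=0$, $\Phi(+\infty)=1$. The Gaussian isoperimetric function is $I(p)=\phi(\Phi^{-1}(p))$ for $p\in(0,1)$, $I(0)=I(1)=0$. Logarithmic gradient: $\mu$ has logarithmic gradient $v_\mu:\mathbb{R}^d\to\mathbb{R}^d$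 if $v_\mu$ is $\mu$-integrable and $\mathbf{E}_\mu\nabla f=-\mathbf{E}_\mu(v_\mu f)$ for every smooth compactly supported $f:\mathbb{R}^d\to\mathbb{R}$. (Equivalently, $\mu$ has a Lebesgue density $p_\mu\in W_{1,1}(\mathbb{R}^d)$, and then $[v_\mu]_i=\partial_{x_i}p_\mu/p_\mu$.) $\mu$-divergence: for $g:\mathbb{R}^d\to\mathbb{R}^d$, the $\mu$-divergence, if it exists, is the function $\delta_\mu(g)\in L_1(\mathbb{R}^d,\mu)$ such that $\mathbf{E}_\mu(\nabla f,g)_{\mathbb{R}^d}=\mathbf{E}_\mu\big(f\,\delta_\mu(g)\big)$ for every smooth compactly supported $f:\mathbb{R}^d\to\mathbb{R}$. Flow: when $K$ is Lipschitz and $h\in\mathbb{R}^d$, $\{\Psi^{K,h}_t(x),\ t\in\mathbb{R},\ x\in\mathbb{R}^d\}$ denotes the flow of solutions of the Cauchy problem $\frac{d}{dt}\Psi_t(x)=(K^*h)(\Psi_t(x))$, $\Psi_0(x)=x$, where $K^*$ is the transposed matrix. *)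

(* Defs.v *)
From HB Require Import structures.
From mathcomp Require Import all_boot all_order all_algebra.
From mathcomp Require Import all_classical all_reals all_analysis.
From mathcomp Require Import measurable_realfun.

Set Implicit Arguments.
Unset Strict Implicit.
Unset Printing Implicit Defensive.

Import Order.TTheory GRing.Theory Num.Theory.
Import numFieldNormedType.Exports.

Local Open Scope classical_set_scope.
Local Open Scope ring_scope.

(* [R^d] is ['cV[R]_d].  The norm that the
   library puts on ['cV[R]_d] is the sup norm; it is only used through the
   topology, derivatives and the Lipschitz property.  The Euclidean norm is
   [enorm]. *)

(* ['cV[R]_d] with its Borel sigma-algebra, generated by the open sets. *)
Notation borel R d := (g_sigma_algebraType (@open 'cV[R]_d)).

Section euclidean.
Context {R : realType} {d : nat}.

Definition dotp (x y : 'cV[R]_d) : R := \sum_i x i 0 * y i 0.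

Definition enorm (x : 'cV[R]_d) : R := Num.sqrt (dotp x x).

Definition partial (i : 'I_d) (f : 'cV[R]_d -> R) : 'cV[R]_d -> R :=
  fun x => 'D_(delta_mx i 0) f x.

Definition gradient (f : 'cV[R]_d -> R) (x : 'cV[R]_d) : 'cV[R]_d :=
  \col_i partial i f x.

Fixpoint Ck (k : nat) (f : 'cV[R]_d -> R) : Prop :=
  if k is k'.+1 then
    (forall (i : 'I_d) x, derivable f x (delta_mx i 0)) /\
    (forall i : 'I_d, Ck k' (partial i f))
  else continuous f.

Definition smooth (f : 'cV[R]_d -> R) : Prop := forall k, Ck k f.

Definition compactly_supported (f : 'cV[R]_d -> R) : Prop :=
  compact (closure [set x | f x != 0]).

Definition test_function (f : 'cV[R]_d -> R) : Prop :=
  smooth f /\ compactly_supported f.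

End euclidean.

Section expectation.
Context {R : realType} {d : nat} (mu : probability (borel R d) R).
Implicit Types (f : 'cV[R]_d -> R) (g v : 'cV[R]_d -> 'cV[R]_d).

Definition mean f : R := \int[mu]_x f x.

Definition vmean g : 'cV[R]_d := \col_i mean (fun x => g x i 0).

(* [ln 0 = 0] in the library, and anyway [0 * ln 0 = 0]. *)
Definition Ent f : R := mean (fun x => f x * ln (f x)) - mean f * ln (mean f).

(* [R^(d+1)] is represented as [R * R^d]. *)
Definition lift_zonoid v : set (R * 'cV[R]_d) :=
  [set (mean g, vmean (fun x => g x *: v x)) | g in
    [set g : borel R d -> R |
      measurable_fun setT g /\ forall x, 0 <= g x <= 1]].

Definition is_log_gradient v : Prop :=
  (forall i, mu.-integrable setT (fun x => (v x i 0)%:E)) /\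
  forall f, test_function f ->
    vmean (gradient f) = - vmean (fun x => f x *: v x).

(* The library integral is total, with junk values on non-integrable functions:
   the integrability of [(grad f, g)] is what makes the left-hand side of the
   defining identity meaningful. *)
Definition is_divergence g (delta : 'cV[R]_d -> R) : Prop :=
  mu.-integrable setT (fun x => (delta x)%:E) /\
  forall f, test_function f ->
    mu.-integrable setT (fun x => (dotp (gradient f x) (g x))%:E) /\
    mean (fun x => dotp (gradient f x) (g x)) = mean (fun x => f x * delta x).

End expectation.

Section gaussian_one_dim.
Context {R : realType}.

Definition phi (x : R) : R := normal_pdf 0 1 x.

Definition Phi (x : \bar R) : R :=
  match x with
  | y%:E => \int[lebesgue_measure]_(z in `]-oo, y]) phi z
  | +oo%E => 1
  | -oo%E => 0
  end.

(* For [0 < p < 1], the unique real [y] with [Phi y = p]. *)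
Definition Phi_inv_real (p : R) : R := xget 0 [set y : R | Phi y%:E = p].

(* Only meant for [0 <= p <= 1]. *)
Definition Phi_inv (p : R) : \bar R :=
  if p <= 0 then -oo%E else if 1 <= p then +oo%E else (Phi_inv_real p)%:E.

Definition isop (p : R) : R := if 0 < p < 1 then phi (Phi_inv_real p) else 0.

End gaussian_one_dim.

Section gaussian_measure.
Context {R : realType}.

Lemma measurable_coord_col n (i : 'I_n) :
  measurable_fun setT (fun x : borel R n => x i 0).
Proof.
apply: (measurability _ (RGenOpens.measurableE R)) => _ [_ [a [b ->]] <-].
rewrite setTI; apply: sub_sigma_algebra => /=.
apply: open_comp; last exact: interval_open.
by move=> x _; exact: coord_continuous.
Qed.

Lemma measurable_fun_colP d (T : measurableType d) n (f : T -> borel R n) :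
  (forall i, measurable_fun setT (fun x => f x i 0)) -> measurable_fun setT f.
Proof.
move=> mf; apply: (@measurability _ _ _ (borel R n) _ _ (@open 'cV[R]_n)) => //.
move=> _ [U oU <-]; rewrite setTI.
pose box (q : {ffun 'I_n -> rat} * rat) : set 'cV[R]_n :=
  [set x | forall i, `|ratr (q.1 i) - x i 0| < ratr q.2].
have -> : f @^-1` U = \bigcup_q (if `[< box q `<=` U >] then f @^-1` box q
                                 else set0).
  apply/seteqP; split => [t /= Ut|t [q _]]; last first.
    by case: ifPn => // /asboolP + ?; exact.
  have /nbhs_ballP[e /= e0 eU] : nbhs (f t) U by apply: open_nbhs_nbhs; split.
  have [r re] : exists r : rat, ratr r \in `]0, e / 2[.
    by apply: rat_in_itvoo; rewrite divr_gt0.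
  move: re; rewrite in_itv/= => /andP[r0 re].
  have /choice[q qP] : forall i, exists q : rat,
      `|ratr q - f t i 0| < ratr r :> R.
    move=> i; have : f t i 0 < f t i 0 + ratr r by rewrite ltrDl.
    move=> /rat_in_itvoo[q]; rewrite in_itv/= => /andP[q1 q2]; exists q.
    by rewrite ger0_norm ?subr_ge0 ?ltW// ltrBlDl.
  exists ([ffun i => q i], r) => //.
  rewrite ifT; first by move=> i /=; rewrite ffunE.
  apply/asboolP => y yq; apply: eU; split => // i j.
  rewrite ord1 /ball/=; have := yq i; rewrite ffunE => yq1.
  rewrite (splitr e) (le_lt_trans (ler_distD (ratr (q i)) _ _))//.
  apply: ltrD; first by rewrite distrC (lt_trans (qP i)).
  exact: lt_trans yq1 _.
apply: countable_bigcupT_measurable => // q; case: ifPn => // _.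
have -> : f @^-1` box q = \bigcap_(i in [set: 'I_n])
    ((fun x => f x i 0) @^-1` ball (ratr (q.1 i) : R) (ratr q.2)).
  by apply/seteqP; split => t /= h i; [move=> _; exact: h | exact: (h i)].
apply: fin_bigcap_measurable => // i _.
rewrite -[X in measurable X]setTI; apply: mf => //.
exact: measurable_ball.
Qed.

Definition cons_col n (p : measurableTypeR R * borel R n) : borel R n.+1 :=
  col_mx p.1%:M p.2.

Lemma measurable_cons_col n : measurable_fun setT (@cons_col n).
Proof.
apply: measurable_fun_colP => i.
have [j ->|j ->] := split_ordP (i : 'I_(1 + n)).
  rewrite (_ : (fun _ => _) = fst) //; apply/funext => p.
  by have := col_mxEu p.1%:M p.2 j 0; rewrite ord1 [X in _ = X]mxE.
rewrite (_ : (fun _ => _) = (fun x : borel R n => x j 0) \o snd).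
  by apply: measurableT_comp => //; exact: measurable_coord_col.
by apply/funext => p; exact: (col_mxEd p.1%:M p.2 j 0).
Qed.

HB.instance Definition _ n := isMeasurableFun.Build _ _ _ _ (@cons_col n)
  (@measurable_cons_col n).

(* The law of [d] independent [N(0, c^2)] coordinates, i.e. the centered
   Gaussian measure with covariance matrix [c^2 I]; the second parameter of
   [normal_prob] is the standard deviation. *)
Fixpoint gaussian (c : R) (d : nat) : probability (borel R d) R :=
  if d is d'.+1 then
    distribution (normal_prob 0 c \x gaussian c d')%E (@cons_col d')
  else \d_(0 : borel R 0).

End gaussian_measure.

Section flow.
Context {R : realType} {d : nat}.
Variables (K : 'cV[R]_d -> 'M[R]_d) (h : 'cV[R]_d).

Definition is_flow (Psi : R -> 'cV[R]_d -> 'cV[R]_d) : Prop :=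
  forall x, Psi 0 x = x /\
    forall t : R, is_derive t 1 (fun s => Psi s x) ((K (Psi t x))^T *m h).

(* For Lipschitz [K] there is exactly one function satisfying [is_flow]; the
   default value is irrelevant. *)
Definition flow : R -> 'cV[R]_d -> 'cV[R]_d :=
  @xget (R -> 'cV[R]_d -> 'cV[R]_d) (fun _ x => x) is_flow.

End flow.

(* Main.v *)
From HB Require Import structures.
Require Import Defs.
From mathcomp Require Import all_boot all_order all_algebra.
From mathcomp Require Import all_classical all_reals all_analysis.
From mathcomp Require Import measurable_realfun ring lra zify.

Import Order.TTheory GRing.Theory Num.Theory.
Import numFieldNormedType.Exports.

Set Implicit Arguments.
Unset Strict Implicit.
Unset Printing Implicit Defensive.

Local Open Scope classical_set_scope.
Local Open Scope ring_scope.

(* The lift zonoid of [gamma_c] is the set of [(p, y)] with [0 <= p <= 1] and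
   [|y| <= c I(p)]: in a unit direction [gamma_c] is a one-dimensional Gaussian,
   for which the bathtub principle says that half-lines are extremal.  Dually,
   with [sl z = E (N - z)^+] for a standard normal [N], [y <= c I(p)] holds iff
   [y <= c (sl z + z p)] for all [z].  Hence (A1) means [|E(g v)| <= c I(E g)]
   for all Borel [g] with values in [[0,1]]; since [E(K grad f) = E(f v)], (B1)
   is the same inequality for test functions, which are dense.

   Optimizing over [g] turns (A1) into [E (<u,v> - a)^+ <= E (c N - a)^+] for
   unit vectors [u]; integrating against [e^a da] gives
   [E exp(k <u,v>) <= exp(k^2 c^2 / 2)], and Gibbs' variational principle yields
   the entropy inequality.

   For the flow [Psi] of [V = K^T h] and a test function [f], put
   [u(t) = E f(Psi_t)].  Then [u'(t) = E (f(Psi_t) <h,v>)]; as [f o Psi_t] is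
   merely Lipschitz, this needs the divergence identity beyond test functions.
   Under (A1), [|u'| <= c |h| I(u)], i.e. [Phi^-1 o u] is [c |h|]-Lipschitz,
   which is (C1) for functions instead of sets.  Conversely, [p |-> Phi(Phi^-1 p + r)]
   lies below its tangent lines; summing (C1) for [t h] along such a line over
   the level sets of [f] and differentiating at [t = 0] gives back (B1). *)

(** * One-dimensional calculus and the standard normal law *)

Section real_derivatives.
Context {R : realType}.

(** The bound [y <= c * isop p] is nonlinear in [p] and degenerate at 0 and 1. Its dual form, a
    family of bounds affine in [p], makes both sides linear in [g], so it passes to L1 limits
    without any continuity of [isop] at the end points.

    In the flow part the obstacle is that [V] is only Lipschitz, so [f o Psi_t] need not be
    differentiable in every direction. It is differentiable along [V] thanks to the group law:
    [Psi_t (y + s V(x))] is close to [Psi_t (Psi_s y) = Psi_(t+s) y], and [f] has a time derivative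
    along trajectories. The direction stays frozen at [V x] while the base point [y] moves near [x];
    this uniformity is what survives an average over translates and so feeds the mollification.

    For the way back from (C1), the direction [h] is the vector [E(f v)] itself, so that the
    derivative of [E f(Psi_t)] at 0 is the square of its norm. Only the upper half of (C1) carries
    content: the lower half is the upper one for the complement. *)

Lemma is_derive_epsP (V W : normedModType R) (f : V -> W) (x v : V) (l : W) :
  is_derive x v f l <->
  forall e : R, 0 < e -> exists2 d : R, 0 < d &
    forall s : R, `|s| < d -> `|f (x + s *: v) - f x - s *: l| <= e * `|s|.
Proof.
split.
  move=> [df lE] e e0; set l0 := l; have /cvgrPdist_le/(_ _ e0)[d /= d0 H] : h^-1 *: ((f \o shift x) (h *: v) - f x) @[h --> 0^'] --> l0.
    by rewrite /l0 -lE.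
  exists d => // s sd.
  have [->|s0] := eqVneq s 0.
    by rewrite !scale0r addr0 subrr subr0 !normr0 mulr0.
  have := H s; rewrite /= sub0r normrN => /(_ sd s0) Hs.
  have -> : f (x + s *: v) - f x - s *: l0 =
      s *: (s^-1 *: (f (s *: v + x) - f x) - l0).
    by rewrite scalerBr scalerA divff// scale1r [s *: v + x]addrC.
  rewrite normrZ mulrC ler_wpM2r// distrC; exact: Hs.
move=> H.
have cf : h^-1 *: ((f \o shift x) (h *: v) - f x) @[h --> 0^'] --> l.
  apply/cvgrPdist_le => /= e e0; have [d d0 Hd] := H _ e0.
  exists d => // s; rewrite /ball_/= sub0r normrN => sd s0.
  have -> : l - s^-1 *: (f (s *: v + x) - f x) =
      - (s^-1 *: (f (x + s *: v) - f x - s *: l)).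
    rewrite [s *: v + x]addrC [in RHS]scalerBr scalerA mulVf// scale1r.
    by rewrite opprB.
  rewrite normrN normrZ normfV ler_pdivrMl ?normr_gt0// mulrC.
  exact: Hd.
by split; [apply/cvg_ex; exists l|exact: cvg_lim].
Qed.

Lemma lipschitz_fun_continuous (V W : normedModType R) (f : V -> W) (L : R) : 0 <= L ->
  (forall x y, `|f x - f y| <= L * `|x - y|) -> continuous f.
Proof.
move=> L0 fL x S /nbhs_ballP[i /= i0 iS]; apply/nbhs_ballP.
exists (i / (L + 1)) => /=; first by rewrite divr_gt0// ltr_wpDl.
move=> y; rewrite -ball_normE /= => xy; apply: iS; rewrite -ball_normE /=.
apply: le_lt_trans (fL x y) _; move: xy; rewrite ltr_pdivlMr ?ltr_wpDl// => xy.
by apply: le_lt_trans xy; rewrite mulrDr mulr1 mulrC lerDl.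
Qed.

Lemma is_derive_shift_arg (f : R -> R) (x r l : R) : is_derive (x + r) 1 f l ->
  is_derive x 1 (fun t => f (t + r)) l.
Proof.
move=> /is_derive_epsP H; apply/is_derive_epsP => e /H[b b0 Hb].
by exists b => // s /Hb; rewrite (_ : x + r + _ = x + s *: 1 + r)// addrAC.
Qed.

Lemma is_derive_continuous (f : R -> R) (x l : R) :
  is_derive x 1 f l -> {for x, continuous f}.
Proof.
by move=> [df _]; apply/differentiable_continuous/derivable1_diffP.
Qed.

Lemma cvg_cst_eq (T : Type) (F : set_system T) {FF : ProperFilter F} (a l : R) :
  (fun=> a) @ F --> l -> a = l.
Proof. by move=> al; exact: (cvg_unique (@Rhausdorff R) (cvg_cst a) al). Qed.

Lemma is_derive_MVT (f df : R -> R) (a b : R) : a <= b ->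
  (forall x, a <= x <= b -> is_derive x 1 f (df x)) ->
  exists2 c, a <= c <= b & f b - f a = df c * (b - a).
Proof.
move=> ab fd; have [||c cab E] := @MVT_segment R f df a b ab.
- by move=> x; rewrite in_itv/= => /andP[/ltW ax /ltW xb]; apply: fd; rewrite ax.
- apply: derivable_within_continuous => x; rewrite in_itv/= => xab.
  by have [] := fd _ xab.
- by exists c => //; rewrite in_itv/= in cab.
Qed.

Lemma is_derive_ndecr (f df : R -> R) (a b : R) : a <= b ->
  (forall x, a <= x <= b -> is_derive x 1 f (df x)) ->
  (forall x, a <= x <= b -> 0 <= df x) -> f a <= f b.
Proof.
move=> ab fd df0; have [c cab E] := is_derive_MVT ab fd.
by rewrite -subr_ge0 E mulr_ge0 ?subr_ge0 ?df0.
Qed.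

Lemma is_derive_nincr (f df : R -> R) (a b : R) : a <= b ->
  (forall x, a <= x <= b -> is_derive x 1 f (df x)) ->
  (forall x, a <= x <= b -> df x <= 0) -> f b <= f a.
Proof.
move=> ab fd df0; have [c cab E] := is_derive_MVT ab fd.
by rewrite -subr_le0 E mulr_le0_ge0 ?subr_ge0 ?df0.
Qed.

Lemma is_derive_incr (f df : R -> R) (a b : R) : a < b ->
  (forall x, a <= x <= b -> is_derive x 1 f (df x)) ->
  (forall x, a <= x <= b -> 0 < df x) -> f a < f b.
Proof.
move=> ab fd df0; have [c cab E] := is_derive_MVT (ltW ab) fd.
by rewrite -subr_gt0 E mulr_gt0 ?subr_gt0 ?df0.
Qed.

End real_derivatives.

Section measures_on_the_line.
Context {R : realType}.
Notation leb := (@lebesgue_measure R).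

Lemma eq_probability_rays (P Q : probability (measurableTypeR R) R) :
  (forall t : R, P `]-oo, t]%classic = Q `]-oo, t]%classic) ->
  forall A, measurable A -> P A = Q A.
Proof.
move=> PQ A mA.
have PQO (t : R) : P `]t, +oo[%classic = Q `]t, +oo[%classic.
  by rewrite -setCitvl !probability_setC// PQ.
refine (@measure_unique _ R (measurableTypeR R) (@RGenOInfty.G R)
  (fun n => `](- n%:R), +oo[%classic) _ _ _ _ P Q _ _ A mA).
- exact: (RGenOInfty.measurableE R).
- move=> _ _ [x ->] [y ->]; exists (Num.max x y).
  by apply/seteqP; split => z /=; rewrite !in_itv/= !andbT gt_max => /andP.
- by move=> n; exists (- n%:R).
- apply/seteqP; split => // x _; exists (Num.bound `|x|) => //=.
  rewrite in_itv/= andbT ltrNl (le_lt_trans (ler_norm _))// normrN.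
  by rewrite archi_boundP.
- by move=> _ [x ->]; exact: PQO.
- by move=> k; rewrite (le_lt_trans (probability_le1 _ _))// ltry.
Qed.

Lemma eq_measure_ge0_integral d (T : measurableType d)
    (m1 m2 : {measure set T -> \bar R}) (f : T -> \bar R) :
  (forall A, measurable A -> m1 A = m2 A) ->
  (forall x, 0 <= f x)%E -> measurable_fun setT f ->
  (\int[m1]_x f x = \int[m2]_x f x)%E.
Proof.
by move=> E f0 mf; apply: eq_measure_integral => A mA _; exact: E.
Qed.

Lemma is_derive_integral_rays (f : R -> R) (y : R) :
  leb.-integrable setT (EFin \o f) -> {for y, continuous f} ->
  is_derive y 1 (fun t => \int[leb]_(z in `]-oo, t]) f z) (f y).
Proof.
move=> intf cf.
have [] := @continuous_FTC1 R f (-oo%O) y (y + 1) _ _ _ cf.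
- by rewrite ltrDl.
- by apply: integrableS intf.
- by rewrite ltNyr.
by move=> df E; apply: DeriveDef; [exact: df|rewrite -derive1E].
Qed.

End measures_on_the_line.

Section normal_laws.
Context {R : realType}.
Notation leb := (@lebesgue_measure R).
Import HBNNSimple.

(** Change of density for simple functions, where it reduces to the definition of the measure on
    preimages; monotone convergence then extends it. *)
Let ge0_integral_normal_prob_nnsfun (m s : R) (f : {nnsfun measurableTypeR R >-> R}) :
  (\int[normal_prob m s]_x (f x)%:E =
   \int[leb]_x ((f x)%:E * (normal_pdf m s x)%:E))%E.
Proof.
under [LHS]eq_integral do rewrite fimfunE -fsumEFin//.
rewrite [LHS]ge0_integral_fsum//; last 2 first.
  - by move=> r; exact/measurable_EFinP/measurableT_comp.
  - by move=> n x _; rewrite EFinM nnfun_muleindic_ge0.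
under [RHS]eq_integral.
  move=> x xD; rewrite fimfunE -fsumEFin// muleC ge0_mule_fsumr; last first.
    by move=> r; rewrite EFinM nnfun_muleindic_ge0.
  over.
have mpdf : measurable_fun setT (fun x => (normal_pdf m s x)%:E).
  by apply/measurable_EFinP; exact: measurable_normal_pdf.
rewrite [RHS]ge0_integral_fsum//; last 2 first.
  - move=> r; apply: emeasurable_funM => //.
    by apply/measurable_EFinP; exact/measurableT_comp.
  - move=> n x _; rewrite mule_ge0//; first by rewrite lee_fin normal_pdf_ge0.
    by rewrite EFinM nnfun_muleindic_ge0.
apply: eq_fsbigr => r _; rewrite integralZl_indic_nnsfun// integral_indic// setIT.
have [r0|r0] := ltP r 0.
  by rewrite preimage_nnfun0// measure0 mule0 integral0_eq// => x _;
    rewrite indic0 mulr0 mule0.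
under [RHS]eq_integral do rewrite EFinM muleCA.
rewrite ge0_integralZl//; last 2 first.
  - by apply: emeasurable_funM => //; apply/measurable_EFinP.
  - by move=> x _; rewrite mule_ge0 ?lee_fin ?normal_pdf_ge0.
congr (_ * _)%E.
rewrite /normal_prob [LHS]integral_mkcond/=; apply: eq_integral => x _.
by rewrite patchE indicE; case: ifPn; rewrite ?mule1 ?mule0.
Qed.

Lemma ge0_integral_normal_prob (m s : R) (f : measurableTypeR R -> \bar R) :
  measurable_fun setT f -> (forall x, 0 <= f x)%E ->
  (\int[normal_prob m s]_x f x = \int[leb]_x (f x * (normal_pdf m s x)%:E))%E.
Proof.
move=> mf f0; pose f_ := nnsfun_approx measurableT mf.
transitivity (lim (\int[normal_prob m s]_x (f_ n x)%:E @[n --> \oo])%E).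
  rewrite -monotone_convergence//=.
  - apply: eq_integral => ? /[!inE] xD; apply/esym/cvg_lim => //=.
    exact: cvg_nnsfun_approx.
  - by move=> n; exact/measurable_EFinP/measurable_funTS.
  - by move=> n ? _; rewrite lee_fin.
  - by move=> ? _ ? ? mn; rewrite lee_fin; exact/lefP/nd_nnsfun_approx.
have mpdf : measurable_fun setT (fun x => (normal_pdf m s x)%:E).
  by apply/measurable_EFinP; exact: measurable_normal_pdf.
transitivity (lim (\int[leb]_x ((f_ n x)%:E * (normal_pdf m s x)%:E)
    @[n --> \oo])%E).
  by congr (lim _); apply/funext => A; under eq_fun do
    rewrite ge0_integral_normal_prob_nnsfun.
rewrite -monotone_convergence//=.
- apply: eq_integral => x /[!inE] xD; apply/cvg_lim => //=.
  apply: cvgeZr => //; exact: cvg_nnsfun_approx.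
- by move=> n; apply: emeasurable_funM => //; exact/measurable_EFinP/measurable_funTS.
- by move=> n x _; rewrite mule_ge0 ?lee_fin ?normal_pdf_ge0.
- move=> x _ a b ab; rewrite lee_wpmul2r ?lee_fin ?normal_pdf_ge0//.
  exact/lefP/nd_nnsfun_approx.
Qed.

Lemma is_derive_normal_cdf (m s t : R) : s != 0 ->
  is_derive t 1 (fun t => fine (normal_prob m s `]-oo, t])) (normal_pdf m s t).
Proof.
move=> s0; apply: is_derive_integral_rays; first exact: integrable_normal_pdf.
exact: continuous_normal_pdf.
Qed.

(** The identity seen as a random variable, so that the limits of distribution functions apply to a
    bare law on the line. *)
Let id_rv : measurableTypeR R -> R := idfun.

#[local] HB.instance Definition _ :=
  @isMeasurableFun.Build _ _ _ _ id_rv (@measurable_id _ _ setT).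

Lemma probability_rays_cvgNy (P : probability (measurableTypeR R) R) :
  fine (P `]-oo, t]%classic) @[t --> -oo] --> (0 : R).
Proof.
have := @cvg_cdfNy0 _ _ _ P (id_rv : {RV P >-> R}).
by move/fine_cvg; apply: cvg_trans.
Qed.

Lemma probability_rays_cvgy (P : probability (measurableTypeR R) R) :
  fine (P `]-oo, t]%classic) @[t --> +oo] --> (1 : R).
Proof.
have := @cvg_cdfy1 _ _ _ P (id_rv : {RV P >-> R}).
by move/fine_cvg; apply: cvg_trans.
Qed.

End normal_laws.

Section standard_normal.
Context {R : realType}.
Notation leb := (@lebesgue_measure R).
Implicit Types x y z t p m s u : R.

Lemma phiE x : phi x = normal_peak 1 * expR (- (x ^+ 2 / 2)).
Proof.
rewrite /phi normal_pdfE ?oner_eq0// /normal_fun subr0 expr1n.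
by rewrite mulNr mulr2n.
Qed.

Lemma phi_gt0 x : 0 < phi x.
Proof. by rewrite phiE mulr_gt0 ?expR_gt0 ?normal_peak_gt0 ?oner_eq0. Qed.

Lemma phi_continuous : continuous (@phi R).
Proof. by apply: continuous_normal_pdf; rewrite oner_eq0. Qed.

Lemma is_derive_phi x : is_derive x 1 phi (- x * phi x).
Proof.
have -> : phi = (fun x : R => normal_peak 1 * expR (- (x ^+ 2 / 2))).
  by apply/funext => y; exact: phiE.
apply: is_derive_eq; rewrite /GRing.scale /=; by field.
Qed.

Lemma is_derive_Phi y : is_derive y 1 (fun t => Phi t%:E) (phi y).
Proof. by apply: (@is_derive_normal_cdf _ 0 1); rewrite oner_eq0. Qed.

Lemma Phi_continuous : continuous (fun t : R => Phi t%:E).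
Proof. by move=> y; apply: is_derive_continuous; exact: is_derive_Phi. Qed.

Lemma cvgy_Phi : Phi t%:E @[t --> +oo] --> (1 : R).
Proof. exact: (probability_rays_cvgy (normal_prob 0 1)). Qed.

Lemma cvgNy_Phi : Phi t%:E @[t --> -oo] --> (0 : R).
Proof. exact: (probability_rays_cvgNy (normal_prob 0 1)). Qed.

Lemma ltr_Phi : {mono (fun t : R => Phi t%:E) : x y / x < y}.
Proof.
apply: leW_mono; apply: le_mono => x y xy.
apply: (@is_derive_incr _ (fun t : R => Phi t%:E) phi x y xy) => t _.
  exact: is_derive_Phi.
exact: phi_gt0.
Qed.

Lemma ler_Phi : {mono (fun t : R => Phi t%:E) : x y / x <= y}.
Proof. by move=> x y; rewrite !leNgt ltr_Phi. Qed.

Lemma Phi_gt0 y : 0 < Phi y%:E.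
Proof.
apply: (@le_lt_trans _ _ (Phi (y - 1)%:E)); last by rewrite ltr_Phi gtrBl.
by rewrite /= Rintegral_ge0// => x _; rewrite ltW ?phi_gt0.
Qed.

(** The sum [Phi (-t) + Phi t] has derivative zero because [phi] is even; its constant value is read
    off at infinity. *)
Lemma PhiN y : Phi (- y)%:E = 1 - Phi y%:E.
Proof.
have D t : is_derive t 1 (fun t => Phi (- t)%:E + Phi t%:E) 0.
  have -> : 0 = phi (- t) * (-1) + phi t.
    by rewrite !phiE sqrrN mulrN1 addNr.
  apply: is_deriveD; last exact: is_derive_Phi.
  apply: (@is_derive1_comp _ (fun t => Phi t%:E) (@GRing.opp R)).
    exact: is_derive_Phi.
have E t : Phi (- t)%:E + Phi t%:E = Phi (- y)%:E + Phi y%:E.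
  exact: (is_derive_0_is_cst t y D).
have : Phi (- t)%:E + Phi t%:E @[t --> +oo] --> (0 + 1 : R).
  apply: cvgD; last exact: cvgy_Phi.
  exact: (proj1 (cvgNy_compNP (fun t : R => Phi t%:E) _) cvgNy_Phi).
under eq_fun do rewrite E.
by move=> /cvg_cst_eq; rewrite add0r => <-; rewrite addrK.
Qed.

Lemma Phi_lt1 y : Phi y%:E < 1.
Proof. by rewrite -subr_gt0 -PhiN Phi_gt0. Qed.

Lemma Phi_surjective p : 0 < p < 1 -> exists y : R, Phi y%:E = p.
Proof.
move=> /andP[p0 p1].
have [a pa] : exists a : R, Phi a%:E < p.
  have /cvgrPdist_lt/(_ _ p0)[M [_ HM]] := cvgNy_Phi.
  exists (M - 1); have := HM (M - 1); rewrite gtrBl sub0r normrN => /(_ ltr01).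
  by rewrite ger0_norm// ltW// Phi_gt0.
have [b pb] : exists b : R, p < Phi b%:E.
  have p10 : 0 < 1 - p by rewrite subr_gt0.
  have /cvgrPdist_lt/(_ _ p10)[M [_ HM]] := cvgy_Phi.
  exists (M + 1); have := HM (M + 1); rewrite ltrDl => /(_ ltr01).
  by rewrite gtr0_norm ?subr_gt0 ?Phi_lt1// ltrD2l ltrN2.
have ab : a <= b by rewrite ltW// -ltr_Phi (lt_trans pa pb).
have [||c _ <-] := @IVT _ (fun t : R => Phi t%:E) a b p ab.
- by apply: continuous_subspaceT; exact: Phi_continuous.
- by rewrite ge_min le_max (ltW pa) (ltW pb) orbT.
- by exists c.
Qed.

Lemma Phi_inv_realK p : 0 < p < 1 -> Phi (Phi_inv_real p)%:E = p.
Proof.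
by move=> p01; exact: (xgetPex 0 (Phi_surjective p01)).
Qed.

Lemma Phi_inj : injective (fun t : R => Phi t%:E).
Proof. by apply: inc_inj; exact: ler_Phi. Qed.

Lemma PhiK y : Phi_inv_real (Phi y%:E) = y.
Proof. by apply: Phi_inj; rewrite Phi_inv_realK// Phi_gt0 Phi_lt1. Qed.

Lemma normal_pdf_phi m s x : 0 < s -> normal_pdf m s x = phi ((x - m) / s) / s.
Proof.
move=> s0; have sN0 : s != 0 by rewrite gt_eqF.
rewrite phiE normal_pdfE// /normal_fun /normal_peak expr1n mul1r.
rewrite -mulrnAr sqrtrM ?sqr_ge0// sqrtr_sqr gtr0_norm// invfM.
have -> : - (x - m) ^+ 2 / (s ^+ 2 *+ 2) = - (((x - m) / s) ^+ 2 / 2).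
  by rewrite -mulr_natr; field; rewrite sN0.
by ring.
Qed.

Lemma cvgy_phi : phi t @[t --> +oo] --> (0 : R).
Proof.
have C : normal_peak 1 * expR (- t) @[t --> +oo] --> (0 : R).
  by rewrite -[X in _ --> X](mulr0 (normal_peak 1)); apply: cvgMr; exact: cvgr_expR.
apply: (squeeze_cvgr _ (cvg_cst 0) C).
exists 2; split => // t t2; rewrite ltW ?phi_gt0//= phiE.
rewrite ler_wpM2l ?normal_peak_ge0// ler_expR lerN2 expr2 -mulrA.
by rewrite ler_peMr ?ler_pdivlMr ?mul1r ?ltW// (lt_trans _ t2).
Qed.

(** Both sides have the same derivative in [t] and vanish at minus infinity, which spares a change
    of variables in the integral. *)
Lemma normal_cdfE m s t : 0 < s ->
  fine (normal_prob m s `]-oo, t]) = Phi ((t - m) / s)%:E.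
Proof.
move=> s0; have sN0 : s != 0 by rewrite gt_eqF.
pose F u := fine (normal_prob m s `]-oo, u]) - Phi ((u - m) / s)%:E.
have D u : is_derive u 1 F 0.
  have -> : 0 = normal_pdf m s u - phi ((u - m) / s) * s^-1.
    by rewrite normal_pdf_phi// subrr.
  apply: is_deriveB; first exact: is_derive_normal_cdf.
  apply: (@is_derive1_comp _ (fun t => Phi t%:E) (fun u => (u - m) / s)).
    exact: is_derive_Phi.
  by apply: is_derive_eq; rewrite /GRing.scale /=; ring.
have E u : F u = F t by exact: is_derive_0_is_cst.
have : F u @[u --> -oo] --> (0 - 0 : R).
  apply: cvgB; first exact: probability_rays_cvgNy.
  apply: (cvg_comp (fun u => (u - m) / s) (fun u : R => Phi u%:E)); last exact: cvgNy_Phi.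
  apply: gt0_cvgMlNy; first by rewrite invr_gt0.
  exact: cvg_addrr_Ny.
under eq_fun do rewrite E.
by move=> /cvg_cst_eq; rewrite subrr => /eqP; rewrite subr_eq0 => /eqP.
Qed.

End standard_normal.

(** * Affine images and sums of normal variables *)

Section gaussian_projections.
Context {R : realType}.
Notation leb := (@lebesgue_measure R).
Implicit Types x y z t p m s u : R.

(** A law on the line is determined by its distribution function, so an image law need only be
    identified on rays. *)
Lemma ge0_integral_law d (T : measurableType d) (P : probability T R)
    (Q : probability (measurableTypeR R) R) (X : T -> measurableTypeR R)
    (f : measurableTypeR R -> \bar R) :
  measurable_fun setT X -> (forall t, Q `]-oo, t]%classic = P (X @^-1` `]-oo, t]%classic)) ->
  measurable_fun setT f -> (forall x, 0 <= f x)%E ->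
  (\int[Q]_x f x = \int[P]_w f (X w))%E.
Proof.
move=> mX QP mf f0.
pose Xm := isMeasurableFun.Build _ _ _ _ X mX.
pose X' : {mfun T >-> measurableTypeR R} := HB.pack X Xm.
transitivity (\int[distribution P X']_x f x)%E; last exact: ge0_integral_distribution.
apply: eq_measure_ge0_integral => //.
exact: eq_probability_rays.
Qed.

Lemma ge0_integral_normal_affine m s (f : measurableTypeR R -> \bar R) : 0 < s ->
  measurable_fun setT f -> (forall x, 0 <= f x)%E ->
  (\int[normal_prob m s]_x f x = \int[normal_prob 0 1]_z f (m + s * z)%R)%E.
Proof.
move=> s0 mf f0.
have mX : measurable_fun setT (fun z : measurableTypeR R => m + s * z : measurableTypeR R).
  by apply: measurable_funD => //; exact: measurable_funM.
refine (ge0_integral_law mX _ mf f0) => t.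
rewrite -[LHS]fineK ?fin_num_measure// normal_cdfE//.
rewrite -[RHS]fineK; last first.
  by apply: fin_num_measure; rewrite -[X in measurable X]setTI; apply: mX.
rewrite /Phi /Rintegral /normal_prob; congr (fine (integral _ _ _))%:E.
by apply/seteqP; split => z /=; rewrite !in_itv/= ler_pdivlMr// lerBrDl mulrC.
Qed.

(** Completing the square: the joint density of [z] and [x = a z + b y] is factored first as the law
    of [z] times that of [x] given [z], then as the law of [x] times that of [z] given [x]. *)
Lemma normal_pdfM a b x z (s := Num.sqrt (a ^+ 2 + b ^+ 2)) : 0 < b ->
  normal_pdf (a * z) b x * normal_pdf 0 1 z =
  normal_pdf 0 s x * normal_pdf (a * x / s ^+ 2) (b / s) z.
Proof.
move=> b0; have s2 : s ^+ 2 = a ^+ 2 + b ^+ 2.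
  by rewrite sqr_sqrtr// addr_ge0 ?sqr_ge0.
have s0 : 0 < s by rewrite sqrtr_gt0 ltr_wpDl ?sqr_ge0 ?exprn_gt0.
rewrite !normal_pdf_phi ?divr_gt0// !phiE !subr0 !divr1.
have -> : normal_peak 1 * expR (- (((x - a * z) / b) ^+ 2 / 2)) / b *
    (normal_peak 1 * expR (- (z ^+ 2 / 2))) =
    normal_peak 1 ^+ 2 / b * expR (- (((x - a * z) / b) ^+ 2 / 2) - z ^+ 2 / 2).
  by rewrite expRD; ring.
have -> : normal_peak 1 * expR (- ((x / s) ^+ 2 / 2)) / s *
    (normal_peak 1 * expR (- (((z - a * x / s ^+ 2) / (b / s)) ^+ 2 / 2)) / (b / s)) =
    normal_peak 1 ^+ 2 / b * expR (- ((x / s) ^+ 2 / 2) -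
      ((z - a * x / s ^+ 2) / (b / s)) ^+ 2 / 2).
  by rewrite expRD; field; rewrite !gt_eqF.
congr (_ * expR _).
have -> : (x / s) ^+ 2 = x ^+ 2 / s ^+ 2 by rewrite expr_div_n.
have -> : ((z - a * x / s ^+ 2) / (b / s)) ^+ 2 = (z - a * x / s ^+ 2) ^+ 2 * s ^+ 2 / b ^+ 2.
  by rewrite !expr_div_n invf_div mulrA.
rewrite s2; field; rewrite -s2 !gt_eqF// exprn_gt0//.
Qed.

Let measurable_conv_pdf a b (f : measurableTypeR R -> \bar R) : 0 < b ->
  measurable_fun setT f ->
  measurable_fun setT (fun zx : measurableTypeR R * measurableTypeR R =>
    (f zx.2 * (normal_pdf (a * zx.1) b zx.2)%:E)%E).
Proof.
move=> b0 mf; apply: emeasurable_funM; first exact: measurableT_comp.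
apply/measurable_EFinP.
under eq_fun do rewrite normal_pdf_phi//.
apply: measurable_funM => //; apply: measurableT_comp; first exact: measurable_normal_pdf.
apply: measurable_funM => //; apply: measurable_funB => //.
exact: measurable_funM.
Qed.

(** After Tonelli and [normal_pdfM], the variable [z] only occurs in its conditional density given
    [x], which integrates to 1. The condition on [b] keeps the inner law nondegenerate, hence with a
    density. *)
Lemma ge0_integral_normal_conv a b (f : measurableTypeR R -> \bar R) : 0 < b ->
  measurable_fun setT f -> (forall x, 0 <= f x)%E ->
  (\int[normal_prob 0 1]_z \int[normal_prob 0 1]_y f (a * z + b * y)%R =
   \int[normal_prob 0 1]_z f (Num.sqrt (a ^+ 2 + b ^+ 2) * z)%R)%E.
Proof.
move=> b0 mf f0; set s := Num.sqrt _.
have s0 : 0 < s by rewrite sqrtr_gt0 ltr_wpDl ?sqr_ge0 ?exprn_gt0.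
under eq_integral do rewrite -ge0_integral_normal_affine// ge0_integral_normal_prob//.
have m1 := measurable_conv_pdf a b0 mf.
have g0 z x : (0 <= f x * (normal_pdf (a * z) b x)%:E)%E.
  by rewrite mule_ge0// lee_fin normal_pdf_ge0.
rewrite [LHS]ge0_integral_normal_prob//; last 2 first.
- exact: (measurable_fun_fubini_tonelli_F _ m1).
- by move=> z; apply: integral_ge0.
have mpdf : measurable_fun setT (fun x : R => (normal_pdf 0 1 x)%:E).
  by apply/measurable_EFinP; exact: measurable_normal_pdf.
transitivity (\int[leb]_z \int[leb]_x
    (f x * (normal_pdf (a * z) b x)%:E * (normal_pdf 0 1 z)%:E))%E.
  apply: eq_integral => z _; rewrite ge0_integralZr//.
  - apply: emeasurable_funM => //; apply/measurable_EFinP; exact: measurable_normal_pdf.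
  - by rewrite lee_fin normal_pdf_ge0.
rewrite (fubini_tonelli (fun zx : measurableTypeR R * measurableTypeR R =>
  (f zx.2 * (normal_pdf (a * zx.1) b zx.2)%:E * (normal_pdf 0 1 zx.1)%:E)%E))//=; last 2 first.
- apply: emeasurable_funM => //; apply: measurableT_comp => //.
  by apply: measurableT_comp => //; exact: measurable_normal_pdf.
- by move=> zx; rewrite mule_ge0// lee_fin normal_pdf_ge0.
under eq_integral => x _.
  under eq_integral do rewrite -muleA -EFinM normal_pdfM// EFinM muleA.
  rewrite ge0_integralZl//; last 3 first.
  - by apply/measurable_EFinP; exact: measurable_normal_pdf.
  - by move=> z _; rewrite lee_fin normal_pdf_ge0.
  - by rewrite mule_ge0// lee_fin normal_pdf_ge0.
  rewrite integral_normal_pdf mule1; over.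
transitivity (\int[normal_prob 0 s]_x f x)%E.
  by apply/esym; exact: ge0_integral_normal_prob.
rewrite (ge0_integral_normal_affine _ s0 mf f0).
by under eq_integral do rewrite add0r.
Qed.

Lemma stop_loss z :
  (\int[normal_prob 0 1]_x (Num.max (x - z) 0)%:E = (phi z - z * (1 - Phi z%:E))%:E)%E.
Proof.
have mmax : measurable_fun setT (fun x : measurableTypeR R => (Num.max (x - z) 0)%:E).
  by apply/measurable_EFinP; apply: measurable_maxr => //; exact: measurable_funB.
rewrite ge0_integral_normal_prob//; last first.
  by move=> x; rewrite lee_fin le_max lexx orbT.
transitivity (\int[leb]_(x in `[z, +oo[) ((x - z) * phi x)%:E)%E.
  rewrite [RHS]integral_mkcond; apply: eq_integral => x _.
  rewrite patchE mem_setE in_itv/= andbT -EFinM /Order.max/=.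
  rewrite subr_lt0 ltNge; case: (z <= x) => //=.
  by rewrite mul0r.
(* An antiderivative of [(x - z) * phi x], because the derivative of [phi] is [- x * phi x]. *)
pose F x := - phi x - z * Phi x%:E.
have D x : is_derive x 1 F ((x - z) * phi x).
  have -> : (x - z) * phi x = - (- x * phi x) - z * phi x by ring.
  apply: is_deriveB.
    by apply: is_deriveN; exact: is_derive_phi.
  by apply: is_deriveZ; exact: is_derive_Phi.
have cF x : {for x, continuous F} by apply: is_derive_continuous; exact: D.
rewrite (@ge0_continuous_FTC2y _ _ F z (- z)).
- by congr (_%:E); rewrite /F; ring.
- by move=> x zx; rewrite mulr_ge0 ?subr_ge0// ltW ?phi_gt0.
- apply: continuous_subspaceT => x; apply: cvgM; last exact: phi_continuous.
  by apply: cvgB; [exact: cvg_id|exact: cvg_cst].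
- have -> : - z = - 0 - z * 1 by rewrite oppr0 sub0r mulr1.
  apply: cvgB; first by apply: cvgN; exact: cvgy_phi.
  by apply: cvgMr; exact: cvgy_Phi.
- by move=> x _; have [] := D x.
- exact: cvg_at_right_filter (cF z).
- by move=> x _; rewrite derive1E; have [_] := D x.
Qed.

End gaussian_projections.

(** * The zonoid of the Gaussian measure *)

Section euclidean_space.
Context {R : realType} {d : nat}.
Implicit Types (x y u : 'cV[R]_d) (a : R).

Lemma dotpC x y : dotp x y = dotp y x.
Proof. by apply: eq_bigr => i _; rewrite mulrC. Qed.

Lemma dotpDr x y u : dotp x (y + u) = dotp x y + dotp x u.
Proof. by rewrite -big_split; apply: eq_bigr => i _; rewrite mxE mulrDr. Qed.

Lemma dotpZr a x y : dotp x (a *: y) = a * dotp x y.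
Proof. by rewrite /dotp mulr_sumr; apply: eq_bigr => i _; rewrite mxE mulrCA. Qed.

Lemma dotpZl a x y : dotp (a *: x) y = a * dotp x y.
Proof. by rewrite dotpC dotpZr dotpC. Qed.

Lemma dotpNr x y : dotp x (- y) = - dotp x y.
Proof. by rewrite -scaleN1r dotpZr mulN1r. Qed.

Lemma dotpNl x y : dotp (- x) y = - dotp x y.
Proof. by rewrite dotpC dotpNr dotpC. Qed.

Lemma dotpBr x y u : dotp x (y - u) = dotp x y - dotp x u.
Proof. by rewrite dotpDr dotpNr. Qed.

Lemma dotpBl x y u : dotp (x - y) u = dotp x u - dotp y u.
Proof. by rewrite dotpC dotpBr !(dotpC u). Qed.

Lemma dotp0r x : dotp x 0 = 0.
Proof. by rewrite -(scale0r 0) dotpZr mul0r. Qed.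

Lemma dotp0l x : dotp 0 x = 0.
Proof. by rewrite dotpC dotp0r. Qed.

Lemma dotp_delta x i : dotp (delta_mx i 0) x = x i 0.
Proof.
rewrite /dotp (bigD1 i)//= big1 ?addr0 => [|j ji]; rewrite mxE eqxx ?mul1r//=.
by rewrite (negbTE ji) mul0r.
Qed.

Lemma dotpxx_ge0 x : 0 <= dotp x x.
Proof. by apply: sumr_ge0 => i _; rewrite -expr2 sqr_ge0. Qed.

Lemma enorm_sqr x : enorm x ^+ 2 = dotp x x.
Proof. by rewrite sqr_sqrtr// dotpxx_ge0. Qed.

Lemma enorm_ge0 x : 0 <= enorm x.
Proof. exact: sqrtr_ge0. Qed.

Lemma dotpxx_eq0 x : (dotp x x == 0) = (x == 0).
Proof.
apply/idP/eqP => [|->]; last by rewrite dotp0r.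
rewrite psumr_eq0 => [/allP x0|i _]; last by rewrite -expr2 sqr_ge0.
apply/colP => i; rewrite mxE; apply/eqP.
by have := x0 i; rewrite mem_index_enum /= -expr2 sqrf_eq0 => /(_ isT).
Qed.

Lemma enorm_eq0 x : (enorm x == 0) = (x == 0).
Proof. by rewrite -dotpxx_eq0 -enorm_sqr sqrf_eq0. Qed.

Lemma enorm0 : enorm (0 : 'cV[R]_d) = 0.
Proof. by apply/eqP; rewrite enorm_eq0. Qed.

Lemma enorm_gt0 x : (0 < enorm x) = (x != 0).
Proof. by rewrite lt0r enorm_eq0 enorm_ge0 andbT. Qed.

Lemma enormZ a x : enorm (a *: x) = `|a| * enorm x.
Proof.
by rewrite /enorm dotpZr dotpZl mulrA -expr2 sqrtrM ?sqr_ge0// sqrtr_sqr.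
Qed.

Lemma enormN x : enorm (- x) = enorm x.
Proof. by rewrite -scaleN1r enormZ normrN1 mul1r. Qed.

Lemma dotp_le x y : dotp x y <= enorm x * enorm y.
Proof.
have [->|y0] := eqVneq y 0; first by rewrite dotp0r enorm0 mulr0.
have [->|x0] := eqVneq x 0; first by rewrite dotp0l enorm0 mul0r.
have a0 : 0 < enorm x by rewrite enorm_gt0.
have b0 : 0 < enorm y by rewrite enorm_gt0.
(* This vector is zero exactly in the equality case of Cauchy-Schwarz; its squared norm expands to
   the inequality times a positive factor. *)
have := dotpxx_ge0 (enorm y *: x - enorm x *: y).
rewrite dotpBr !dotpBl !dotpZl !dotpZr -!enorm_sqr (dotpC y x).
set A := enorm x in a0 *; set B := enorm y in b0 *; set D := dotp x y => H.
have : 0 <= (2 * A * B) * (A * B - D).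
  have -> : 2 * A * B * (A * B - D) = B * (B * A ^+ 2) - A * (B * D) - (B * (A * D) - A * (A * B ^+ 2)).
    by ring.
  by [].
by rewrite pmulr_rge0 ?subr_ge0// !mulr_gt0.
Qed.

Lemma unit_direction x : x != 0 ->
  exists u, enorm u = 1 /\ x = enorm x *: u.
Proof.
move=> x0; have n0 : enorm x != 0 by rewrite enorm_eq0.
exists ((enorm x)^-1 *: x); rewrite enormZ normfV ger0_norm ?enorm_ge0//.
by rewrite mulVf// scalerA divff// scale1r.
Qed.

Lemma measurable_dotp u : measurable_fun setT (fun x : borel R d => dotp u x).
Proof.
apply: measurable_sum => i; apply: measurable_funM => //.
exact: measurable_coord_col.
Qed.

End euclidean_space.

Lemma unit_interval_dist {R : realType} (a b : R) :
  0 <= a <= 1 -> 0 <= b <= 1 -> `|a - b| <= 1.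
Proof. by move=> a01 b01; rewrite ler_norml; lra. Qed.

Lemma indic_unit (R : realType) (T : Type) (A : set T) x : 0 <= (\1_A x : R) <= 1.
Proof. by rewrite indicE; case: (_ \in _); rewrite lexx ler01. Qed.

Section integrals.
Context d (T : measurableType d) {R : realType}.
Variable mu : {finite_measure set T -> \bar R}.
Implicit Types (f g w : T -> R).

Lemma integrable_dominated f g : measurable_fun setT f ->
  mu.-integrable setT (EFin \o g) -> (forall x, `|f x| <= g x) ->
  mu.-integrable setT (EFin \o f).
Proof.
move=> mf ig fg; apply: (le_integrable measurableT) ig.
  exact/measurable_EFinP.
by move=> x _ /=; rewrite lee_fin (le_trans (fg x))// ler_norm.
Qed.

Lemma integrable_rscale (k : R) f : mu.-integrable setT (EFin \o f) ->
  mu.-integrable setT (EFin \o (fun x => k * f x)).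
Proof. exact: (integrableZl measurableT). Qed.

Lemma integrable_radd f g : mu.-integrable setT (EFin \o f) ->
  mu.-integrable setT (EFin \o g) ->
  mu.-integrable setT (EFin \o (fun x => f x + g x)).
Proof. exact: (integrableD measurableT). Qed.

Lemma integrable_rsub f g : mu.-integrable setT (EFin \o f) ->
  mu.-integrable setT (EFin \o g) ->
  mu.-integrable setT (EFin \o (fun x => f x - g x)).
Proof. exact: (integrableB measurableT). Qed.

Lemma integrable_cst_fin (k : R) : mu.-integrable setT (EFin \o cst k).
Proof. exact: finite_measure_integrable_cst. Qed.

Lemma integrable_bounded f (M : R) : measurable_fun setT f ->
  (forall x, `|f x| <= M) -> mu.-integrable setT (EFin \o f).
Proof.
move=> mf fM; apply: (integrable_dominated mf (integrable_cst_fin M)) => x.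
exact: fM.
Qed.

Lemma integrable_prod f w (M : R) : measurable_fun setT f ->
  (forall x, `|f x| <= M) -> mu.-integrable setT (EFin \o w) ->
  mu.-integrable setT (EFin \o (fun x => f x * w x)).
Proof.
move=> mf fM iw.
have mw : measurable_fun setT w by apply/measurable_EFinP; case/integrableP: iw.
apply: (@integrable_dominated _ (fun x => `|M| * `|w x|)).
- exact: measurable_funM.
- rewrite (_ : _ \o _ = (fun x => `|M|%:E * (`|w x|)%:E)%E)//.
  by apply: integrableZl => //; exact: integrable_norm.
- move=> x; rewrite normrM ler_wpM2r//.
  by rewrite (le_trans (fM x))// ler_norm.
Qed.

Lemma Rintegral_sum (I : Type) (s : seq I) (h : I -> T -> R) :
  (forall i, mu.-integrable setT (EFin \o h i)) ->
  mu.-integrable setT (EFin \o (fun x => \sum_(i <- s) h i x)) /\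
  \int[mu]_x (\sum_(i <- s) h i x) = \sum_(i <- s) \int[mu]_x h i x.
Proof.
move=> ih; elim: s => [|i s [IH1 IH2]].
  split.
    under [X in _.-integrable _ (_ \o X)]eq_fun do rewrite big_nil.
    exact: integrable_cst_fin.
  by under eq_Rintegral do rewrite big_nil; rewrite Rintegral_cst// mul0r big_nil.
split.
  under [X in _.-integrable _ (_ \o X)]eq_fun do rewrite big_cons.
  rewrite (_ : _ \o _ = (fun x => (h i x)%:E + (\sum_(j <- s) h j x)%:E)%E)//.
  exact: (integrableD measurableT (ih i) IH1).
by under eq_Rintegral do rewrite big_cons; rewrite RintegralD// IH2 big_cons.
Qed.

Lemma ge0_Rintegral_fin f : measurable_fun setT f -> (forall x, 0 <= f x) ->
  forall r : R, (\int[mu]_x (f x)%:E = r%:E)%E ->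
  mu.-integrable setT (EFin \o f) /\ \int[mu]_x f x = r.
Proof.
move=> mf f0 r E; split; last by rewrite /Rintegral E.
apply/integrableP; split; first exact/measurable_EFinP.
by under eq_integral do rewrite /= ger0_norm//; rewrite E ltry.
Qed.

End integrals.

Section means.
Context {R : realType} {d : nat} (mu : probability (borel R d) R).

Lemma dotp_vmean u (g : 'cV[R]_d -> 'cV[R]_d) :
  (forall i, mu.-integrable setT (fun x => (g x i 0)%:E)) ->
  mu.-integrable setT (fun x => (dotp u (g x))%:E) /\
  dotp u (vmean mu g) = mean mu (fun x => dotp u (g x)).
Proof.
move=> ig.
have [|I E] := @Rintegral_sum _ _ _ mu _ (index_enum 'I_d) (fun i x => u i 0 * g x i 0).
  by move=> i; apply: integrable_rscale; exact: ig.
split; first exact: I.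
rewrite /mean E; apply: eq_bigr => i _.
by rewrite mxE; apply/esym; apply: RintegralZl => //; exact: ig.
Qed.

End means.

Section gaussian_measure_projections.
Context {R : realType}.
Implicit Types (c a z p : R).

(** Symmetry of the standard normal law. It serves the case where a linear form depends on a single
    coordinate, with a coefficient of arbitrary sign. *)
Lemma ge0_integral_normal_abs a (f : measurableTypeR R -> \bar R) :
  measurable_fun setT f -> (forall x, 0 <= f x)%E ->
  (\int[normal_prob 0 1]_z f (a * z)%R = \int[normal_prob 0 1]_z f (`|a| * z)%R)%E.
Proof.
move=> mf f0; have [a0|a0] := leP 0 a; first by rewrite ger0_norm.
rewrite ltr0_norm//.
pose g (x : R) := f (- a * x)%R.
have mg : measurable_fun setT g.
  by apply: measurableT_comp => //; exact: measurable_funM.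
have mN : measurable_fun setT (fun z : measurableTypeR R => - z : measurableTypeR R).
  exact: oppr_measurable.
have := @ge0_integral_law R _ _ (normal_prob 0 1) (normal_prob 0 1) _ g mN _ mg.
rewrite /g => ->//; first by under [RHS]eq_integral do rewrite mulrNN.
move=> t; set P := normal_prob 0 1.
have mO : measurable (`]-oo, (- t)[ : set (measurableTypeR R)) by [].
rewrite [RHS](_ : _ = P (~` (`]-oo, (- t)[ : set (measurableTypeR R)))); last first.
  congr (P _); apply/seteqP; split => z /=; rewrite !in_itv/=.
    by rewrite lerNl => tz; rewrite ltNge tz.
  by move/negP; rewrite -leNgt lerNl.
rewrite [RHS](probability_setC (normal_prob 0 1) mO).
(* Reflection turns closed rays into complements of open ones; the end point has mass zero. *)
rewrite [X in (1 - X)%E](_ : _ = normal_prob 0 1 `]-oo, (- t)%R]%classic); last first.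
  apply: (@integral_itv_bndo_bndc R (-oo%O) (- t) (fun x => (normal_pdf 0 1 x)%:E)).
  by apply/measurable_EFinP/measurable_funTS; exact: measurable_normal_pdf.
rewrite /P -[LHS]fineK ?fin_num_measure//.
rewrite -[X in (1 - X)%E]fineK ?fin_num_measure//.
by rewrite -EFinB !normal_cdfE// !subr0 !divr1 PhiN; congr (_%:E); ring.
Qed.

Lemma ge0_integral_distribution_prod d1 d2 d3 (T1 : measurableType d1)
    (T2 : measurableType d2) (T3 : measurableType d3)
    (P1 : probability T1 R) (P2 : probability T2 R)
    (X : {mfun (T1 * T2)%type >-> T3}) (F : T3 -> \bar R) :
  measurable_fun setT F -> (forall x, 0 <= F x)%E ->
  measurable_fun setT (fun x => \int[P2]_y F (X (x, y)))%E /\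
  (\int[distribution (P1 \x P2)%E X]_z F z = \int[P1]_x \int[P2]_y F (X (x, y)))%E.
Proof.
move=> mF F0.
have mFX : measurable_fun setT (F \o X) by exact: measurableT_comp.
have FX0 x : (0 <= (F \o X) x)%E by exact: F0.
split; first exact: (measurable_fun_fubini_tonelli_F (F \o X) mFX FX0).
rewrite ge0_integral_distribution//.
exact: (fubini_tonelli1 (F \o X) mFX FX0).
Qed.

Lemma dotp_cons_col n (u : 'cV[R]_n.+1) (p : measurableTypeR R * borel R n) :
  dotp u (cons_col p) = u 0 0 * p.1 + dotp (\col_i u (lift 0 i) 0) p.2.
Proof.
rewrite /dotp big_ord_recl; congr (_ * _ + _).
  have -> : ord0 = lshift n (0 : 'I_1) :> 'I_(1 + n) by apply/val_inj.
  by rewrite /cons_col (col_mxEu p.1%:M p.2) mxE.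
apply: eq_bigr => i _; rewrite mxE; congr (_ * _).
have -> : lift ord0 i = rshift 1 i :> 'I_(1 + n) by apply/val_inj.
by rewrite /cons_col (col_mxEd p.1%:M p.2).
Qed.

Lemma enorm_cons_col n (u : 'cV[R]_n.+1) :
  enorm u ^+ 2 = u 0 0 ^+ 2 + enorm (\col_i u (lift 0 i) 0) ^+ 2.
Proof.
rewrite !enorm_sqr /dotp big_ord_recl -expr2; congr (_ + _).
by apply: eq_bigr => i _; rewrite mxE.
Qed.

(** The Gaussian measure is defined coordinate by coordinate, so its rotation invariance has to be
    recovered: by induction on the dimension, the first coordinate is split off by Tonelli and added
    back by [ge0_integral_normal_conv]. *)
Lemma ge0_integral_gaussian_dotp c n (u : 'cV[R]_n) (f : measurableTypeR R -> \bar R) :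
  0 < c -> measurable_fun setT f -> (forall x, 0 <= f x)%E ->
  (\int[gaussian c n]_x f (dotp u x) =
   \int[normal_prob 0 1]_z f (c * enorm u * z)%R)%E.
Proof.
move=> c0; elim: n => [|n IH] in u f *; move=> mf f0.
  have -> : enorm u = 0 by rewrite /enorm /dotp big_ord0 sqrtr0.
  under eq_integral do rewrite /dotp big_ord0.
  under [RHS]eq_integral do rewrite mulr0 mul0r.
  rewrite !integral_cst//=; congr (_ * _)%E.
  by rewrite -[LHS]/((\d_ _ setT)%E) diracT [RHS]probability_setT.
pose u' := \col_i u (lift 0 i) 0 : 'cV[R]_n.
have mfd : measurable_fun setT (fun x : borel R n.+1 => f (dotp u x)).
  by apply: measurableT_comp => //; exact: measurable_dotp.
have [mF EF] := ge0_integral_distribution_prod (normal_prob 0 c) (gaussian c n)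
  (@cons_col R n) mfd (fun x => f0 (dotp u x)).
have E x : (\int[gaussian c n]_y f (dotp u (cons_col (x, y))))%E =
    (\int[normal_prob 0 1]_z f (u 0 0 * x + c * enorm u' * z)%R)%E.
  under eq_integral do rewrite dotp_cons_col/=.
  have mfx : measurable_fun setT (fun t : measurableTypeR R => f (u 0 0 * x + t)%R).
    by apply: measurableT_comp => //; exact: measurable_funD.
  exact: (IH u' _ mfx (fun t => f0 _)).
transitivity (\int[normal_prob 0 c]_x \int[gaussian c n]_y f (dotp u (cons_col (x, y))))%E.
  exact: EF.
rewrite (ge0_integral_normal_affine 0 c0 mF); last first.
  by move=> x; apply: integral_ge0.
under eq_integral do rewrite add0r E.
have cu : c * enorm u = Num.sqrt ((u 0 0 * c) ^+ 2 + (c * enorm u') ^+ 2).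
  rewrite -[LHS]ger0_norm ?mulr_ge0 ?enorm_ge0 ?(ltW c0)// -sqrtr_sqr.
  by rewrite !exprMn enorm_cons_col mulrDr [_ * c ^+ 2]mulrC.
(* If the remaining coordinates of [u] vanish, the second summand is degenerate and the convolution
   formula does not apply. *)
have [u'0|u'0] := eqVneq (enorm u') 0.
  have -> : c * enorm u = `|u 0 0 * c|.
    by rewrite cu u'0 mulr0 expr0n/= addr0 sqrtr_sqr.
  transitivity (\int[normal_prob 0 1]_z f (u 0 0 * c * z)%R)%E; last first.
    exact: ge0_integral_normal_abs.
  apply: eq_integral => z _; rewrite u'0 mulr0.
  under eq_integral do rewrite mul0r addr0 mulrA.
  by rewrite integral_cst// [X in (_ * X)%E]probability_setT mule1.
have cu'0 : 0 < c * enorm u' by rewrite mulr_gt0// lt0r u'0 enorm_ge0.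
rewrite cu; transitivity (\int[normal_prob 0 1]_z \int[normal_prob 0 1]_y
    f (u 0 0 * c * z + c * enorm u' * y)%R)%E; last first.
  exact: ge0_integral_normal_conv.
by apply: eq_integral => z _; apply: eq_integral => y _; rewrite mulrA.
Qed.

End gaussian_measure_projections.

(** * The isoperimetric function as an infimum of affine functions *)

Section isoperimetric_function.
Context {R : realType}.
Implicit Types (y z p q c : R).

(* The stop-loss transform E (N - z)^+ of the standard normal law; the
   isoperimetric function is its Legendre-type transform, see [le_isopP]. *)
Definition normal_stop_loss z : R := phi z - z * (1 - Phi z%:E).
Local Notation sl := normal_stop_loss.

Lemma phiN z : phi (- z) = phi z.
Proof. by rewrite !phiE sqrrN. Qed.

(** Put-call parity for a symmetric law: a number is the difference of its positive and negative
    parts. *)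
Lemma normal_stop_lossN z : sl (- z) = sl z + z.
Proof. by rewrite /sl PhiN phiN; ring. Qed.

Lemma normal_stop_loss_ge0 z : 0 <= sl z.
Proof.
rewrite -lee_fin -stop_loss; apply: integral_ge0 => x _.
by rewrite lee_fin le_max lexx orbT.
Qed.

Lemma is_derive_normal_stop_loss z : is_derive z 1 sl (Phi z%:E - 1).
Proof.
have Dphi := is_derive_phi z; have DPhi := is_derive_Phi z.
by apply: is_derive_eq; rewrite /GRing.scale /=; ring.
Qed.

Lemma normal_stop_loss_small (e : R) : 0 < e -> exists z, sl z <= e.
Proof.
move=> e0; have /cvgrPdist_le/(_ _ e0)[M [_ HM]] := @cvgy_phi R.
pose z := Num.max M 0 + 1; exists z.
have Mz : M < z by rewrite (@le_lt_trans _ _ (Num.max M 0)) ?le_max ?lexx// ltrDl.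
have z0 : 0 <= z by rewrite addr_ge0// le_max lexx orbT.
have := HM _ Mz; rewrite sub0r normrN (ger0_norm (ltW (phi_gt0 z))).
by apply: le_trans; rewrite /sl gerBl mulr_ge0// subr_ge0 (ltW (Phi_lt1 z)).
Qed.

Lemma isop01 : isop 0 = 0 :> R /\ isop 1 = 0 :> R.
Proof. by rewrite /isop !ltxx ltr01. Qed.

Lemma isop_ge0 p : 0 <= isop p.
Proof. by rewrite /isop; case: ifP => // _; rewrite (ltW (phi_gt0 _)). Qed.

Lemma isop_stop_loss p : 0 < p < 1 ->
  isop p = sl (- Phi_inv_real p) + (- Phi_inv_real p) * p.
Proof.
move=> p01; rewrite /isop p01 /sl phiN PhiN Phi_inv_realK//; ring.
Qed.

(** The map [z |-> sl z + z * p] has derivative [Phi z - (1 - p)], which is increasing and changes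
    sign at [z = - Phi_inv_real p]; there it takes the value [isop p]. At [p = 0] and [p = 1] the
    claim is that [sl] is nonnegative. *)
Lemma isop_le_stop_loss p z : 0 <= p <= 1 -> isop p <= sl z + z * p.
Proof.
move=> /andP[]; rewrite le_eqVlt => /predU1P[<- _|p0].
  by rewrite (proj1 isop01) mulr0 addr0 normal_stop_loss_ge0.
rewrite le_eqVlt => /predU1P[->|p1].
  by rewrite (proj2 isop01) mulr1 -normal_stop_lossN normal_stop_loss_ge0.
have p01 : 0 < p < 1 by rewrite p0.
rewrite isop_stop_loss//; set y := Phi_inv_real p.
pose f z := sl z + z * p.
have Df (t : R) : is_derive t 1 f (Phi t%:E - 1 + p).
  have Ds := is_derive_normal_stop_loss t.
  by apply: is_derive_eq; rewrite /GRing.scale /=; ring.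
have Py : Phi (- y)%:E = 1 - p by rewrite PhiN /y Phi_inv_realK.
rewrite -/(f z) -/(f (- y)).
have [yz|zy] := leP (- y) z.
  apply: (is_derive_ndecr yz (fun t _ => Df t)) => t /andP[yt _].
  have : Phi (- y)%:E <= Phi t%:E by rewrite ler_Phi.
  by rewrite Py; lra.
apply: (is_derive_nincr (ltW zy) (fun t _ => Df t)) => t /andP[_ yt].
have : Phi t%:E <= Phi (- y)%:E by rewrite ler_Phi.
by rewrite Py; lra.
Qed.

(** For [0 < p < 1] the infimum over [z] is attained at [- Phi_inv_real p]. At the ends it is only
    approached, for [z] going to plus infinity when [p = 0] and to minus infinity when [p = 1],
    which explains the epsilons. *)
Lemma le_isopP c p y : 0 < c -> 0 <= p <= 1 ->
  (y <= c * isop p) <-> (forall z, y <= c * (sl z + z * p)).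
Proof.
move=> c0 p01; split=> [yp z|H].
  by rewrite (le_trans yp)// ler_pM2l// isop_le_stop_loss.
case/andP: p01; rewrite le_eqVlt => /predU1P[p0 _|p0].
  rewrite -p0 (proj1 isop01) mulr0; apply/ler_addgt0Pr => e e0.
  have [|z sz] := @normal_stop_loss_small (e / c); first by rewrite divr_gt0.
  have := H z; rewrite -p0 mulr0 addr0 add0r => /le_trans; apply.
  by rewrite -ler_pdivlMl// mulrC.
rewrite le_eqVlt => /predU1P[p1|p1].
  rewrite p1 (proj2 isop01) mulr0; apply/ler_addgt0Pr => e e0.
  have [|z sz] := @normal_stop_loss_small (e / c); first by rewrite divr_gt0.
  have := H (- z); rewrite p1 normal_stop_lossN mulr1 addrK add0r => /le_trans; apply.
  by rewrite -ler_pdivlMl// mulrC.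
by rewrite isop_stop_loss ?p0//; exact: H.
Qed.

End isoperimetric_function.

Section bathtub.
Context d (T : measurableType d) {R : realType} (P : probability T R).
Implicit Types (g W : T -> R) (c : R).

Lemma mean_unit_interval g : measurable_fun setT g -> (forall x, 0 <= g x <= 1) ->
  P.-integrable setT (EFin \o g) /\ 0 <= \int[P]_x g x <= 1.
Proof.
move=> mg g01.
have ig : P.-integrable setT (EFin \o g).
  apply: (@integrable_bounded _ _ _ P g 1 mg) => x.
  by have /andP[g0 g1] := g01 x; rewrite ger0_norm.
split=> //; rewrite Rintegral_ge0/=; last by move=> x _; have /andP[] := g01 x.
have -> : 1 = \int[P]_x (1 : R).
  by rewrite Rintegral_cst// [X in fine X]probability_setT mul1r.
apply: le_Rintegral => //; first exact: integrable_cst_fin.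
by move=> x _; have /andP[] := g01 x.
Qed.

Lemma integrable_pos W (a : R) : P.-integrable setT (EFin \o W) ->
  P.-integrable setT (EFin \o (fun x => Num.max (W x - a) 0)).
Proof.
move=> iW; have mW : measurable_fun setT W by apply/measurable_EFinP; case/integrableP: iW.
apply: (@integrable_dominated _ _ _ P _ (fun x => `|W x| + `|a|)).
- by apply: measurable_maxr => //; exact: measurable_funB.
- by apply: integrable_radd; [exact: integrable_norm|exact: integrable_cst_fin].
- move=> x; rewrite ger0_norm ?le_max ?lexx ?orbT// ge_max addr_ge0// andbT.
  by rewrite (le_trans (ler_norm _))// ler_normB.
Qed.

(** Pointwise, [g * (W - c z)] is at most the positive part of [W - c z], for any [g] between 0 and
    1. Integrating and taking the infimum over [z] produces [isop]. *)
Lemma bathtub c W g : 0 < c -> P.-integrable setT (EFin \o W) ->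
  (forall z, \int[P]_x (Num.max (W x - c * z) 0) <= c * normal_stop_loss z) ->
  measurable_fun setT g -> (forall x, 0 <= g x <= 1) ->
  \int[P]_x (g x * W x) <= c * isop (\int[P]_x g x).
Proof.
move=> c0 iW H mg g01; have [ig p01] := mean_unit_interval mg g01.
have igW : P.-integrable setT (EFin \o (fun x => g x * W x)).
  apply: (integrable_prod mg (M := 1) _ iW) => x.
  by have /andP[g0 g1] := g01 x; rewrite ger0_norm.
apply/le_isopP => // z; rewrite mulrDr.
apply: le_trans (lerD (H z) (lexx _)); rewrite -lerBlDr.
have -> : \int[P]_x (g x * W x) - c * (z * \int[P]_x g x) =
    \int[P]_x (g x * W x - c * z * g x).
  by rewrite mulrA RintegralB// ?RintegralZl//; exact: integrable_rscale.
apply: le_Rintegral => //.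
- by apply: integrable_rsub => //; exact: integrable_rscale.
- exact: integrable_pos.
move=> x _; have /andP[g0 g1] := g01 x.
rewrite le_max; have [WZ|WZ] := leP 0 (W x - c * z).
  by apply/orP; left; nra.
by apply/orP; right; nra.
Qed.

End bathtub.

Section gaussian_zonoid.
Context {R : realType} {d : nat} (c : R).
Hypothesis c0 : 0 < c.
Local Notation G := (gaussian c d).
Local Notation sl := normal_stop_loss.
Implicit Types (u : 'cV[R]_d) (z p : R).

Lemma ge0_integral_gaussian_unit u (f : measurableTypeR R -> \bar R) : enorm u = 1 ->
  measurable_fun setT f -> (forall x, 0 <= f x)%E ->
  (\int[G]_x f (dotp u x) = \int[normal_prob 0 1]_z f (c * z)%R)%E.
Proof. by move=> u1 mf f0; have := ge0_integral_gaussian_dotp u c0 mf f0; rewrite u1 mulr1. Qed.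

Lemma gaussian_stop_loss u z : enorm u = 1 ->
  G.-integrable setT (EFin \o (fun x => Num.max (dotp u x - c * z) 0)) /\
  \int[G]_x (Num.max (dotp u x - c * z) 0) = c * sl z.
Proof.
move=> u1; apply: ge0_Rintegral_fin.
- apply: measurable_maxr => //; apply: measurable_funB => //; exact: measurable_dotp.
- by move=> x; rewrite le_max lexx orbT.
have m1 (a b : R) : measurable_fun setT (fun t : measurableTypeR R => (Num.max (a * t - b) 0)%:E).
  have mM : measurable_fun setT (fun t : measurableTypeR R => a * t).
    exact: measurable_funM.
  by apply/measurable_EFinP; apply: measurable_maxr => //; apply: measurable_funB.
have := @ge0_integral_gaussian_unit u (fun t => (Num.max (t - c * z) 0)%:E) u1 _ _.
move=> ->.
- rewrite EFinM -stop_loss -ge0_integralZl//.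
  + apply: eq_integral => t _; rewrite -EFinM -mulrBr; congr (_%:E).
    by rewrite maxr_pMr ?ltW// mulr0.
  + by have := m1 1 z; under eq_fun do rewrite mul1r.
  + by move=> x _; rewrite lee_fin le_max lexx orbT.
  + by rewrite lee_fin ltW.
- by have := m1 1 (c * z); under eq_fun do rewrite mul1r.
- by move=> x; rewrite lee_fin le_max lexx orbT.
Qed.

(** A number is the difference of the positive parts of itself and of its opposite; by symmetry the
    two have equal, finite integrals. *)
Lemma gaussian_integrable_unit u : enorm u = 1 ->
  G.-integrable setT (EFin \o (fun x => dotp u x)) /\ \int[G]_x dotp u x = 0.
Proof.
move=> u1; have nu1 : enorm (- u) = 1 by rewrite enormN.
have [i1 E1] := gaussian_stop_loss 0 u1.
have [i2 E2] := gaussian_stop_loss 0 nu1.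
have E : (fun x : borel R d => dotp u x) = (fun x =>
    Num.max (dotp u x - c * 0) 0 - Num.max (dotp (- u) x - c * 0) 0).
  apply/funext => x; rewrite !mulr0 !subr0 dotpNl.
  have [u0|u0] := leP 0 (dotp u x).
    by rewrite (max_idPr _) ?subr0// oppr_le0.
  by rewrite (max_idPl _) ?sub0r ?opprK// oppr_ge0 ltW.
rewrite E; split; first exact: integrable_rsub.
by rewrite RintegralB// E1 E2 subrr.
Qed.

Lemma gaussian_integrable_coord (i : 'I_d) :
  G.-integrable setT (EFin \o (fun x => x i 0)) /\ \int[G]_x x i 0 = 0.
Proof.
have := @gaussian_integrable_unit (delta_mx i 0).
under [X in _.-integrable _ (_ \o X)]eq_fun do rewrite dotp_delta.
under eq_Rintegral do rewrite dotp_delta.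
by apply; rewrite /enorm dotp_delta mxE !eqxx sqrtr1.
Qed.

Lemma gaussian_halfspace u z : enorm u = 1 ->
  \int[G]_x (\1_[set x | c * z <= dotp u x] x) = 1 - Phi z%:E.
Proof.
move=> u1; rewrite /Rintegral.
have := @ge0_integral_gaussian_unit u (fun t => (\1_(`[c * z, +oo[) t)%:E) u1 _ _.
have -> : (fun x : borel R d => (\1_(`[c * z, +oo[) (dotp u x))%:E) =
    (fun x => (\1_[set x | c * z <= dotp u x] x)%:E : \bar R).
  by apply/funext => x; rewrite !indicE !mem_setE in_itv/= andbT.
move=> -> //; last by apply/measurable_EFinP; exact: measurable_indic.
have -> : (fun t => (\1_(`[c * z, +oo[) (c * t))%:E) = (fun t : R => (\1_(`[z, +oo[) t)%:E : \bar R).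
  by apply/funext => t; rewrite !indicE !mem_setE !in_itv/= !andbT ler_pM2l.
rewrite integral_indic// setIT -setCitvl [X in fine X](probability_setC (normal_prob 0 1))//.
rewrite [X in (1 - X)%E](_ : _ = normal_prob 0 1 `]-oo, z]%classic); last first.
  apply: (@integral_itv_bndo_bndc R (-oo%O) z (fun x => (normal_pdf 0 1 x)%:E)).
  by apply/measurable_EFinP/measurable_funTS; exact: measurable_normal_pdf.
by rewrite -[X in (1 - X)%E]fineK ?fin_num_measure.
Qed.

Lemma gaussian_zonoidP p (y : 'cV[R]_d) :
  lift_zonoid G id (p, y) <-> 0 <= p <= 1 /\ enorm y <= c * isop p.
Proof.
have ub (g : borel R d -> R) u : enorm u = 1 -> measurable_fun setT g ->
    (forall x, 0 <= g x <= 1) ->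
    dotp u (vmean G (fun x => g x *: x)) <= c * isop (mean G g).
  move=> u1 mg g01; have [iu _] := gaussian_integrable_unit u1.
  have ig i : G.-integrable setT (fun x => ((g x *: x) i 0)%:E).
    under eq_fun do rewrite mxE.
    apply: (integrable_prod mg (M := 1) _ (proj1 (gaussian_integrable_coord i))) => x.
    by have /andP[g0 g1] := g01 x; rewrite ger0_norm.
  rewrite (proj2 (dotp_vmean u ig)) /mean.
  under eq_Rintegral do rewrite dotpZr.
  apply: bathtub => // z.
  by rewrite (proj2 (gaussian_stop_loss z u1)).
split=> [[g [mg g01] [<- <-]]|[p01 yp]].
  split; first by have [] := mean_unit_interval G mg g01.
  set Y := vmean _ _; have [->|Y0] := eqVneq Y 0.
    by rewrite enorm0 mulr_ge0 ?isop_ge0// ltW.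
  have [u [u1 Yu]] := unit_direction Y0.
  have -> : enorm Y = dotp u Y by rewrite {2}Yu dotpZr -enorm_sqr u1 expr1n mulr1.
  exact: ub.
(* Constant functions realize the points [(p, 0)], since the Gaussian measure is centered. *)
have cst_mean (q : R) : mean G (cst q) = q.
  by rewrite /mean Rintegral_cst// [X in fine X]probability_setT mulr1.
have cst_vmean (q : R) : vmean G (fun x => cst q x *: x) = 0.
  apply/colP => i; rewrite !mxE /mean.
  under eq_Rintegral do rewrite mxE.
  have [ii E] := gaussian_integrable_coord i.
  by rewrite RintegralZl// E mulr0.
have [y0|y0] := eqVneq y 0.
  by exists (cst p); [split => //|rewrite cst_mean cst_vmean y0].
have M0 : 0 < isop p.
  by rewrite -(pmulr_rgt0 _ c0) (lt_le_trans _ yp)// enorm_gt0.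
have p01' : 0 < p < 1 by move: M0; rewrite /isop; case: ifP => //; rewrite ltxx.
have [u [u1 yu]] := unit_direction y0.
(* With this threshold the half-space in the direction [u] has mass [p], and it attains the dual
   infimum. *)
pose z := - Phi_inv_real p.
pose h (x : borel R d) : R := \1_[set x | c * z <= dotp u x] x.
have mh : measurable_fun setT h.
  apply: measurable_indic; rewrite -[X in measurable X]setTI.
  exact: (measurable_fun_ler _ (measurable_dotp u)).
have h01 x : 0 <= h x <= 1 by rewrite /h indicE; case: (_ \in _); rewrite ?lexx ler01.
have Eh : mean G h = p.
  by rewrite /mean gaussian_halfspace// /z PhiN Phi_inv_realK//; ring.
have ih i : G.-integrable setT (fun x => ((h x *: x) i 0)%:E).
  under eq_fun do rewrite mxE.
  apply: (integrable_prod mh (M := 1) _ (proj1 (gaussian_integrable_coord i))) => x.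
  by have /andP[g0 g1] := h01 x; rewrite ger0_norm.
pose Y := vmean G (fun x => h x *: x).
have ihG : G.-integrable setT (EFin \o h) by have [] := mean_unit_interval G mh h01.
have uY : dotp u Y = c * isop p.
  have [iu ->] := dotp_vmean u ih.
  have [iS Es] := gaussian_stop_loss z u1.
  rewrite isop_stop_loss// mulrDr -/z -Es.
  have -> : c * (z * p) = \int[G]_x (c * z * h x).
    by rewrite RintegralZl// -/(mean G h) Eh mulrA.
  rewrite -RintegralD//; last exact: integrable_rscale.
  apply: eq_Rintegral => x _; rewrite dotpZr /h indicE.
  have [le|lt] := leP (c * z) (dotp u x).
    by rewrite mem_set// mul1r (max_idPl _) ?subr_ge0//=; ring.
  rewrite memNset/= ?mul0r ?mulr0 ?addr0; last by apply/negP; rewrite -ltNge.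
  by rewrite (max_idPr _)// subr_le0 ltW.
(* The component of [Y] along [u] already equals the maximal norm, so the rest of [Y] vanishes. *)
have Yu : Y = (c * isop p) *: u.
  apply/eqP; rewrite -subr_eq0 -dotpxx_eq0 eq_le dotpxx_ge0 andbT.
  rewrite dotpBr !dotpBl !dotpZl !dotpZr (dotpC Y u) uY -!enorm_sqr u1.
  have YM : enorm Y <= c * isop p.
    have [->|Y0] := eqVneq Y 0; first by rewrite enorm0 mulr_ge0 ?isop_ge0// ltW.
    have [u' [u'1 Yu']] := unit_direction Y0.
    have -> : enorm Y = dotp u' Y by rewrite {2}Yu' dotpZr -enorm_sqr u'1 expr1n mulr1.
    have -> : c * isop p = c * isop (mean G h) by rewrite Eh.
    exact: ub.
  by have := enorm_ge0 Y; nra.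
(* Mixing the half-space with the constant [p] in the proportion [t] keeps the mean and scales the
   vector by [t], which reaches every shorter vector. *)
pose t := enorm y / (c * isop p).
have cM : 0 < c * isop p by rewrite mulr_gt0.
have t01 : 0 <= t <= 1.
  apply/andP; split; first by rewrite divr_ge0 ?enorm_ge0// ltW.
  by rewrite ler_pdivrMr// mul1r.
exists (fun x => t * h x + (1 - t) * p).
  split.
    by apply: measurable_funD => //; apply: measurable_funM.
  move=> x; have := h01 x; move: t01 p01 => /andP[? ?] /andP[? ?] /andP[? ?].
  by apply/andP; split; nra.
congr (_, _).
  rewrite /mean RintegralD//; [|exact: integrable_rscale|exact: integrable_cst_fin].
  rewrite RintegralZl// -/(mean G h) Eh Rintegral_cst// [X in fine X]probability_setT.
  by rewrite /=; ring.
rewrite yu; transitivity (t *: Y); last first.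
  by rewrite Yu scalerA /t divfK// gt_eqF.
apply/colP => i; rewrite !mxE /mean.
have [ii Ei] := gaussian_integrable_coord i.
under eq_Rintegral do rewrite mxE mulrDl -mulrA.
rewrite RintegralD//; last 2 first.
- by have := ih i; under eq_fun do rewrite mxE; exact: integrable_rscale.
- exact: integrable_rscale.
rewrite RintegralZl//; last by have := ih i; under eq_fun do rewrite mxE.
rewrite RintegralZl// Ei mulr0 addr0 /mean; congr (_ * _).
by apply: eq_Rintegral => x _; rewrite mxE.
Qed.

End gaussian_zonoid.

(** * Test functions *)

Section flat_functions.
Context {R : realType}.
Implicit Types (p : {poly R}) (t y : R).

(* The functions [p(1/t) exp(-1/t)] extended by [0] to [t <= 0] are closed
   under differentiation, which makes all of them smooth at once. *)
Definition flat p t : R := if 0 < t then p.[t^-1] * expR (- t^-1) else 0.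

(** With [y = 1/t] one has [d/dt = - y^2 d/dy], and differentiating [p(y) exp(-y)] in [y] replaces
    [p] by [p' - p]. *)
Definition flat_step p : {poly R} := 'X^2 * (p - p^`()).

(** The extra factor [y ^+ m] stores the powers of ['X] peeled off the polynomial, so the induction
    must keep [m] arbitrary. Constant terms are handled by the exponential series. *)
Lemma horner_expRN_bounded p m : exists C, 0 <= C /\
  forall y, 0 < y -> `|p.[y]| * y ^+ m * expR (- y) <= C.
Proof.
elim/poly_ind: p m => [|p a IH] m.
  by exists 0; split => // y y0; rewrite horner0 normr0 !mul0r.
have [C [C0 HC]] := IH m.+1.
exists (C + `|a| * m.+1`!%:R); split; first by rewrite addr_ge0// mulr_ge0.
move=> y y0; rewrite hornerMXaddC.
have e0 : 0 <= y ^+ m * expR (- y) by rewrite mulr_ge0 ?exprn_ge0 ?expR_ge0// ltW.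
rewrite -mulrA (le_trans (ler_wpM2r e0 (ler_normD _ _)))// mulrDl; apply: lerD.
  apply: le_trans (HC _ y0); rewrite normrM (gtr0_norm y0) exprS !mulrA//.
rewrite ler_wpM2l// expRN ler_pdivrMr ?expR_gt0//.
have m0 : 0 < m`!%:R :> R by rewrite ltr0n fact_gt0.
apply: (@le_trans _ _ (m`!%:R * expR y)); last first.
  by rewrite ler_pM2r ?expR_gt0// ler_nat factS leq_pmull.
rewrite -ler_pdivrMl// mulrC.
case: m m0 {e0 HC IH} => [_|m m0].
  by rewrite expr0 fact0 divr1 -expR0 ler_expR ltW.
by rewrite (le_trans _ (expR_ge1Dxn m (ltW y0)))// lerDr.
Qed.

(** Quadratic smallness gives every [flat p] the derivative 0 at the origin, the only point where
    the two branches meet. *)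
Lemma flat_le_sqr p : exists C, 0 <= C /\ forall t, `|flat p t| <= C * t ^+ 2.
Proof.
have [C [C0 HC]] := horner_expRN_bounded p 2.
exists C; split => // t; rewrite /flat; case: ifPn => t0; last first.
  by rewrite normr0 mulr_ge0// sqr_ge0.
have i0 : 0 < t^-1 by rewrite invr_gt0.
have := HC _ i0; rewrite normrM (ger0_norm (expR_ge0 _)) => H.
rewrite -ler_pdivrMr ?exprn_gt0//; apply: le_trans H.
by rewrite exprVn mulrAC.
Qed.

Lemma is_derive_flat p t : is_derive t 1 (flat p) (flat (flat_step p) t).
Proof.
have [t0|t0|->] := ltgtP t 0.
- have -> : flat (flat_step p) t = 0 by rewrite /flat ltNge (ltW t0).
  apply: near_eq_is_derive (is_derive_cst 0 t 1); near=> s.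
  rewrite /flat ltNge (_ : s <= 0)//.
  by apply/ltW; near: s; exact: lt_nbhsl.
- rewrite [X in is_derive _ _ _ X]/flat t0 /flat_step.
  have tN0 : t != 0 by rewrite gt_eqF.
  have Dv : is_derive t 1 (fun s : R => s^-1) (- (t ^- 2)).
    by apply: is_derive_eq; first exact: is_deriveV; rewrite /GRing.scale /= mulr1.
  have Dp : is_derive t 1 (fun s => p.[s^-1]) (p^`().[t^-1] * - (t ^- 2)).
    apply: (@is_derive1_comp _ (fun s => p.[s]) (fun s : R => s^-1)).
    exact: is_derive_poly.
  have De : is_derive t 1 (fun s : R => expR (- s^-1)) (expR (- t^-1) * t ^- 2).
    apply: (@is_derive1_comp _ expR (fun s : R => - s^-1)).
    by apply: is_derive_eq; rewrite opprK.
  have D : is_derive t 1 (fun s => p.[s^-1] * expR (- s^-1))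
      (('X^2 * (p - p^`())).[t^-1] * expR (- t^-1)).
    apply: is_derive_eq; rewrite /GRing.scale /= hornerM hornerXn hornerD hornerN exprVn.
    by ring.
  apply: near_eq_is_derive D; near=> s; rewrite /flat (_ : 0 < s)//.
  by near: s; exact: lt_nbhsr.
- have z0 q : flat q 0 = 0 by rewrite /flat ltxx.
  rewrite z0.
  apply/is_derive_epsP => e e0; have [C [C0 HC]] := flat_le_sqr p.
  exists (e / (C + 1)); first by rewrite divr_gt0// ltr_wpDl.
  move=> s se; rewrite add0r [s *: 1]mulr1 z0 subr0 scaler0 subr0.
  apply: le_trans (HC s) _; rewrite -normr_id -real_normK ?num_real// expr2 mulrA.
  rewrite normr_id ler_wpM2r// (le_trans (ler_wpM2l C0 (ltW se)))//.
  rewrite mulrCA ler_piMr// ?(ltW e0)// ler_pdivrMr ?ltr_wpDl// mul1r lerDl//.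
Unshelve. all: end_near. Qed.

Lemma flat_le0 p t : t <= 0 -> flat p t = 0.
Proof. by move=> t0; rewrite /flat ltNge t0. Qed.

Lemma flat1_unit t : 0 <= flat 1 t <= 1.
Proof.
rewrite /flat; case: ifPn => t0; last by rewrite lexx ler01.
by rewrite hornerC mul1r expR_ge0 expR_le1 oppr_le0 invr_ge0 ltW.
Qed.

Lemma flat1_homo : {homo flat 1 : t y / t <= y}.
Proof.
move=> t y ty; rewrite {1}/flat; case: ifPn => t0; last first.
  by have /andP[] := flat1_unit y.
rewrite /flat (lt_le_trans t0 ty) !hornerC !mul1r ler_expR lerN2.
by rewrite lef_pV2 ?posrE// (lt_le_trans t0 ty).
Qed.

(** Smooth approximation of the indicator of the open half-line; all smooth approximations of Borel
    sets below start from it. *)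
Lemma cvg_flat1 t : (fun n : nat => flat 1 (n%:R * t)) @ \oo --> ((0 < t)%R%:R : R).
Proof.
have [t0|t0] := ltP 0 t; last first.
  rewrite (_ : (fun _ => _) = cst 0); first exact: cvg_cst.
  by apply/funext => n; rewrite /flat ltNge mulr_ge0_le0.
have C0 : (n%:R * t)^-1 @[n --> \oo] --> (0 : R).
  apply/cvgrPdist_le => e e0; near=> n.
  have n0 : (e * t)^-1 <= n%:R by near: n; exact: nbhs_infty_ger.
  have et : 0 < e * t by rewrite mulr_gt0.
  have nt : e^-1 <= n%:R * t by rewrite -ler_pdivrMr// -invfM.
  have nt0 : 0 < n%:R * t by rewrite (lt_le_trans _ nt)// invr_gt0.
  rewrite sub0r normrN ger0_norm ?invr_ge0 ?(ltW nt0)//.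
  by rewrite -[e]invrK lef_pV2 ?posrE ?invr_gt0.
have C : expR (- (n%:R * t)^-1) @[n --> \oo] --> expR (- (0 : R)).
  by apply: (cvg_comp _ expR); [exact: cvgN C0|exact: continuous_expR].
rewrite oppr0 expR0 in C.
apply: cvg_trans C; apply: near_eq_cvg; near=> n.
rewrite /flat mulr_gt0// ?hornerC ?mul1r// ltr0n; near: n; exists 1%N => //.
Unshelve. all: end_near. Qed.

End flat_functions.

Section column_vectors.
Context {R : realType} {d : nat}.
Implicit Types (x y h : 'cV[R]_d).

Lemma norm_coord_le x i : `|x i 0| <= `|x|.
Proof.
rewrite [leRHS]mx_normrE.
exact: (le_bigmax _ (fun ij : 'I_d * 'I_1 => `|x ij.1 ij.2|) (i, 0)).
Qed.

Lemma norm_cV_le x (M : R) : 0 <= M -> (forall i, `|x i 0| <= M) -> `|x| <= M.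
Proof.
move=> M0 xM; rewrite [leLHS]mx_normrE; apply/bigmax_leP; split => // -[i j] _ /=.
by rewrite ord1.
Qed.

Lemma norm_scale_delta (i : 'I_d) (a : R) : `|a *: delta_mx i 0 : 'cV[R]_d| <= `|a|.
Proof.
apply: norm_cV_le => // j; rewrite !mxE eqxx andbT.
by case: (_ == _); rewrite ?mulr1// mulr0 normr0.
Qed.

Lemma cV_sum_delta x : x = \sum_i x i 0 *: delta_mx i 0.
Proof.
apply/colP => i; rewrite summxE (bigD1 i)//= big1 ?addr0 => [|j ji].
  by rewrite !mxE !eqxx mulr1.
by rewrite !mxE eq_sym (negbTE ji) mulr0.
Qed.

Lemma sum_norm_coord_le x : \sum_i `|x i 0| <= d%:R * `|x|.
Proof.
apply: (@le_trans _ _ (\sum_(i < d) `|x|)).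
  by apply: ler_sum => i _; exact: norm_coord_le.
by rewrite sumr_const card_ord mulr_natl.
Qed.

Lemma bounded_compact_closure (A : set 'cV[R]_d) (M : R) :
  (forall x, A x -> `|x| <= M) -> compact (closure A).
Proof.
(* A box of row vectors is compact as a product of segments; transposition is continuous and carries
   it to columns. *)
move=> AM; pose B := [set v : 'rV[R]_d | forall i, `[- M, M]%classic (v ord0 i)].
have cB : compact B.
  by apply: (rV_compact (A := fun=> `[- M, M]%classic)) => i; exact: segment_compact.
have ctr : continuous (fun v : 'rV[R]_d => v^T : 'cV[R]_d).
  move=> v s /= /(nbhs_ballP (v^T)) [e e0 es]; apply/nbhs_ballP.
  exists e => //= w [_ vw]; apply: es; split => // i j; rewrite !mxE; exact: vw.
have cB' : compact ((fun v : 'rV[R]_d => v^T : 'cV[R]_d) @` B).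
  by apply: continuous_compact => //; exact: continuous_subspaceT.
apply: (subclosed_compact (@closed_closure _ A) cB').
rewrite [X in _ `<=` X](closure_id _).1; last first.
  by apply: compact_closed => //; exact: norm_hausdorff.
apply: closure_subset => x Ax; exists x^T; last by rewrite trmxK.
move=> i /=; rewrite in_itv/= mxE -ler_norml.
exact: le_trans (norm_coord_le x i) (AM _ Ax).
Qed.

End column_vectors.

Section smooth_functions.
Context {R : realType} {d : nat}.
Implicit Types (f g : 'cV[R]_d -> R) (x y h : 'cV[R]_d) (i j : 'I_d).
Local Notation e_ i := (delta_mx i 0 : 'cV[R]_d).

(** Yields all orders of differentiability at once from a class stable under partial derivatives,
    instead of an induction for each construction. *)
Lemma smooth_coind (P : ('cV[R]_d -> R) -> Prop) :
  (forall f, P f -> continuous f) ->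
  (forall f, P f -> forall i x, derivable f x (e_ i)) ->
  (forall f, P f -> forall i, P (partial i f)) ->
  forall f, P f -> smooth f.
Proof.
move=> H1 H2 H3 f Pf k; elim: k f Pf => [|k IH] f Pf /=; first exact: H1.
by split=> [i x|i]; [exact: H2|exact/IH/H3].
Qed.

Lemma smooth_continuous f : smooth f -> continuous f.
Proof. by move=> /(_ 0). Qed.

Lemma smooth_derivable f i x : smooth f -> derivable f x (e_ i).
Proof. by move=> /(_ 1%N) [+ _]; apply. Qed.

Lemma smooth_is_derive f i x : smooth f -> is_derive x (e_ i) f (partial i f x).
Proof. by move=> sf; apply: DeriveDef => //; exact: smooth_derivable. Qed.

Lemma smooth_partial f i : smooth f -> smooth (partial i f).
Proof. by move=> sf k; have [_] := sf k.+1; apply. Qed.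

Lemma partial_is_derive f (df : 'cV[R]_d -> R) i :
  (forall x, is_derive x (e_ i) f (df x)) -> partial i f = df.
Proof. by move=> D; apply/funext => x; have [_] := D x. Qed.

Lemma CkD k f g : Ck k f -> Ck k g -> Ck k (fun x => f x + g x).
Proof.
elim: k f g => [|k IH] f g /=; first by move=> cf cg x; exact: continuousD (cf x) (cg x).
move=> [df Cf] [dg Cg]; split=> [i x|i]; first exact: derivableD.
rewrite (_ : partial i _ = fun x => partial i f x + partial i g x); first exact: IH.
apply/funext => x; exact: deriveD.
Qed.

Lemma smoothD f g : smooth f -> smooth g -> smooth (fun x => f x + g x).
Proof. by move=> sf sg k; exact: CkD. Qed.

Lemma smoothM f g : smooth f -> smooth g -> smooth (fun x => f x * g x).
Proof.
move=> sf sg k; elim: k f g sf sg => [|k IH] f g sf sg /=.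
  by move=> x; exact: continuousM (@smooth_continuous f sf x) (@smooth_continuous g sg x).
split=> [i x|i]; first by apply: derivableM; exact: smooth_derivable.
rewrite (_ : partial i _ = fun x => f x * partial i g x + g x * partial i f x).
  by apply: CkD; apply: IH => //; exact: smooth_partial.
apply: partial_is_derive => x; apply: is_deriveM; exact: smooth_is_derive.
Qed.

Lemma smooth_cst (a : R) : smooth (fun _ : 'cV[R]_d => a).
Proof.
apply: (@smooth_coind (fun f => exists a, f = cst a)); last by exists a.
- by move=> _ [b ->]; exact: cst_continuous.
- by move=> _ [b ->] i x; exact: derivable_cst.
- move=> _ [b ->] i; exists 0; apply: partial_is_derive => x; exact: is_derive_cst.
Qed.

Lemma smoothZ (a : R) f : smooth f -> smooth (fun x => a * f x).
Proof. by move=> sf; apply: smoothM => //; exact: smooth_cst. Qed.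

Lemma smoothB f g : smooth f -> smooth g -> smooth (fun x => f x - g x).
Proof.
move=> sf sg; rewrite (_ : (fun _ => _) = fun x => f x + -1 * g x).
  by apply: smoothD => //; exact: smoothZ.
by apply/funext => x; rewrite mulN1r.
Qed.

Lemma smooth_sum (I : Type) (s : seq I) (F : I -> 'cV[R]_d -> R) :
  (forall k, smooth (F k)) -> smooth (fun x => \sum_(k <- s) F k x).
Proof.
move=> sF; elim: s => [|k s IH].
  by under eq_fun do rewrite big_nil; exact: smooth_cst.
by under eq_fun do rewrite big_cons; exact: smoothD.
Qed.

Lemma smooth_prod (I : Type) (s : seq I) (F : I -> 'cV[R]_d -> R) :
  (forall k, smooth (F k)) -> smooth (fun x => \prod_(k <- s) F k x).
Proof.
move=> sF; elim: s => [|k s IH].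
  by under eq_fun do rewrite big_nil; exact: smooth_cst.
by under eq_fun do rewrite big_cons; exact: smoothM.
Qed.

Lemma is_derive_coord (s : R -> R) (s' : R) i j x : is_derive (x i 0) 1 s s' ->
  is_derive x (e_ j) (fun x => s (x i 0)) ((i == j)%:R * s').
Proof.
move=> D; apply/is_derive_epsP => e e0.
have /is_derive_epsP/(_ _ e0)[r r0 Hr] := D.
exists r => // t tr; rewrite !mxE eqxx andbT.
have [_|_] := eqVneq i j; last first.
  by rewrite mulr0 addr0 subrr mul0r scaler0 subrr normr0 mulr_ge0// ltW.
by rewrite mul1r mulr1; have := Hr _ tr; rewrite [t *: 1]mulr1.
Qed.

(** [s_] lists the successive derivatives of one profile. The stable class consists of their scalar
    multiples, as a partial derivative brings in a Kronecker symbol. *)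
Lemma smooth_coord (s_ : nat -> R -> R) i :
  (forall n (t : R), is_derive t 1 (s_ n) (s_ n.+1 t)) ->
  smooth (fun x => s_ 0%N (x i 0)).
Proof.
move=> Ds.
apply: (@smooth_coind (fun f => exists a n, f = fun x => a * s_ n (x i 0))).
- move=> _ [a [n ->]] x.
  apply: (@continuousM _ _ (cst a) (fun x => s_ n (x i 0))); first exact: cst_continuous.
  apply: (cvg_comp (fun x : 'cV[R]_d => x i 0) (s_ n)); first exact: coord_continuous.
  exact: is_derive_continuous.
- move=> _ [a [n ->]] j x; apply: derivableM; first exact: derivable_cst.
  by have [] := is_derive_coord j (Ds n (x i 0)).
- move=> _ [a [n ->]] j; exists ((i == j)%:R * a), n.+1; apply: partial_is_derive => x.
  rewrite mulrAC mulrC; apply: is_deriveZ; exact: is_derive_coord.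
- by exists 1, 0%N; apply/funext => x; rewrite mul1r.
Qed.

Lemma smooth_flat (p : {poly R}) (k b : R) i : smooth (fun x => flat p (k * x i 0 - b)).
Proof.
pose s_ n t := k ^+ n * flat (iter n (@flat_step R) p) (k * t - b).
rewrite (_ : (fun _ => _) = fun x => s_ 0%N (x i 0)); last first.
  by apply/funext => x; rewrite /s_ expr0 mul1r.
apply: smooth_coord => n t; rewrite /s_ exprSr -mulrA.
apply: is_deriveZ; rewrite mulrC.
apply: (@is_derive1_comp _ _ (fun t => k * t - b)); first exact: is_derive_flat.
by apply: is_derive_eq; rewrite /GRing.scale /=; ring.
Qed.

(** Coordinates are changed one at a time and the mean value theorem is applied on each leg. [G] is
    a frozen reference gradient, and the sum of the [|h i 0|] is the budget that keeps the whole
    path within distance [rho] of [x0]. *)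
Lemma partial_increment f G (B rho : R) x0 :
  (forall i x, derivable f x (e_ i)) -> 0 <= B ->
  (forall i z, `|z - x0| <= rho -> `|partial i f z - G i| <= B) ->
  forall y h, `|y - x0| + \sum_i `|h i 0| <= rho ->
  `|f (y + h) - f y - \sum_i h i 0 * G i| <= B * \sum_i `|h i 0|.
Proof.
move=> df B0 HB y h.
(* Partial sums over a list of coordinates make the induction possible; the base point moves with
   each leg. *)
suff key (s : seq 'I_d) : `|y - x0| + \sum_(i <- s) `|h i 0| <= rho ->
    `|f (y + \sum_(i <- s) h i 0 *: e_ i) - f y - \sum_(i <- s) h i 0 * G i| <=
    B * \sum_(i <- s) `|h i 0|.
  by move=> /key; rewrite -cV_sum_delta.
elim: s y => [|i s IH] y.
  by rewrite !big_nil => _; rewrite addr0 subrr subrr normr0 mulr0.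
rewrite !big_cons => ys.
set a := h i 0; set S := \sum_(_ <- s) _ *: _.
set T := \sum_(_ <- s) _ * _; set N := \sum_(_ <- s) _ in ys *.
have N0 : 0 <= N by apply: sumr_ge0.
have st (t : R) : 0 <= t <= 1 -> `|y + (t * a) *: e_ i - x0| <= `|y - x0| + `|a|.
  move=> /andP[t0 t1]; rewrite addrAC (le_trans (ler_normD _ _))// lerD2l.
  rewrite (le_trans (norm_scale_delta _ _))// normrM (ger0_norm t0).
  by rewrite ler_piMl.
have step : `|f (y + a *: e_ i) - f y - a * G i| <= B * `|a|.
  have D (t : R) : is_derive t 1 (fun t => f (y + (t * a) *: e_ i))
      (partial i f (y + (t * a) *: e_ i) * a).
    apply: (@is_derive1_comp _ (fun r => f (y + r *: e_ i)) (fun t => t * a)).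
      apply/is_derive_epsP => e e0.
      have /is_derive_epsP/(_ _ e0)[r r0 Hr] := derivableP (df i (y + (t * a) *: e_ i)).
      exists r => // q qr; have := Hr _ qr.
      by rewrite [q *: 1]mulr1 scalerDl addrA.
    by apply: is_derive_eq; rewrite /GRing.scale /=; ring.
  have [t t01] := is_derive_MVT ler01 (fun t _ => D t).
  rewrite mul1r mul0r scale0r addr0 subr0 mulr1 => ->.
  rewrite [_ * a]mulrC -mulrBr normrM mulrC ler_wpM2r// HB//.
  by rewrite (le_trans (st _ t01))// (le_trans _ ys)// lerD2l lerDl.
have rest : `|f (y + a *: e_ i + S) - f (y + a *: e_ i) - T| <= B * N.
  apply: IH; rewrite (le_trans _ ys)// addrA lerD2r.
  by have := st 1; rewrite mul1r; apply; rewrite lexx ler01.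
rewrite mulrDr (_ : f (y + (a *: e_ i + S)) - f y - (a * G i + T) =
  (f (y + a *: e_ i) - f y - a * G i) + (f (y + a *: e_ i + S) - f (y + a *: e_ i) - T)).
  by rewrite (le_trans (ler_normD _ _))// lerD.
rewrite addrA; ring.
Qed.

End smooth_functions.

Section test_functions.
Context {R : realType} {d : nat}.
Implicit Types (f g : 'cV[R]_d -> R) (x y h : 'cV[R]_d) (i j : 'I_d).
Local Notation e_ i := (delta_mx i 0 : 'cV[R]_d).

Lemma test_functionP f : test_function f <->
  smooth f /\ exists M : R, 0 <= M /\ forall x, M < `|x| -> f x = 0.
Proof.
split=> [[sf cf]|[sf [M [M0 HM]]]]; split=> //.
  have [M0 [_ HM]] := compact_bounded cf.
  exists (Num.max M0 0 + 1); split; first by rewrite addr_ge0// le_max lexx orbT.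
  move=> x; apply: contraTeq => fx; rewrite -leNgt.
  apply: HM; first by rewrite (@le_lt_trans _ _ (Num.max M0 0)) ?le_max ?lexx// ltrDl.
  exact: subset_closure.
apply: (@bounded_compact_closure _ _ _ M) => x /= fx; rewrite leNgt.
by apply: contra_neqN fx; exact: HM.
Qed.

Lemma partial_eq0_outside f (M : R) i : (forall x, M < `|x| -> f x = 0) ->
  forall x, M < `|x| -> partial i f x = 0.
Proof.
move=> HM x Mx; have [_] : is_derive x (e_ i) f 0; last by [].
apply: near_eq_is_derive (is_derive_cst 0 x (e_ i)); near=> y.
apply/esym/HM; near: y; apply: (@cvgr_gt _ _ (nbhs x) _ (fun y => `|y|) `|x|) => //.
exact: norm_continuous.
Unshelve. all: end_near. Qed.

Lemma test_function_partial f i : test_function f -> test_function (partial i f).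
Proof.
move=> /test_functionP [sf [M [M0 HM]]]; apply/test_functionP; split.
  exact: smooth_partial.
by exists M; split => //; exact: partial_eq0_outside.
Qed.

Lemma continuous_supp_bounded f (M : R) : continuous f ->
  (forall x, M < `|x| -> f x = 0) ->
  exists B, 0 <= B /\ forall x, `|f x| <= B.
Proof.
move=> cf HM.
have cK : compact (closure [set x : 'cV[R]_d | `|x| <= M]).
  exact: (@bounded_compact_closure _ _ _ M).
have /compact_bounded [B0 [_ HB]] : compact (f @` closure [set x | `|x| <= M]).
  by apply: continuous_compact => //; exact: continuous_subspaceT.
exists (Num.max B0 0 + 1); split; first by rewrite addr_ge0// le_max lexx orbT.
move=> x; have [xM|xM] := leP `|x| M; last first.
  by rewrite HM// normr0 addr_ge0// le_max lexx orbT.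
apply: HB; first by rewrite (@le_lt_trans _ _ (Num.max B0 0)) ?le_max ?lexx// ltrDl.
by exists x => //; exact: subset_closure.
Qed.

Lemma test_function_bounded f : test_function f ->
  exists B, 0 <= B /\ forall x, `|f x| <= B.
Proof.
move=> /test_functionP [sf [M [_ HM]]].
by apply: continuous_supp_bounded HM; exact: smooth_continuous.
Qed.

Lemma test_function_gradient_bounded f : test_function f ->
  exists B, 0 <= B /\ forall i x, `|partial i f x| <= B.
Proof.
move=> tf; have /choice [B HB] i := test_function_bounded (test_function_partial i tf).
exists (\sum_i B i); split; first by apply: sumr_ge0 => i _; have [] := HB i.
move=> i x; rewrite (bigD1 i)//= ler_wpDr//.
  by apply: sumr_ge0 => j _; have [] := HB j.
by have [_] := HB i; apply.
Qed.

Lemma test_function_lipschitz f : test_function f ->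
  exists C, 0 <= C /\ forall x y, `|f x - f y| <= C * `|x - y|.
Proof.
move=> tf; have [B [B0 HB]] := test_function_gradient_bounded tf.
have [sf _] := tf.
exists (B * d%:R); split; first by rewrite mulr_ge0.
move=> x y.
have D i z : derivable f z (e_ i) by exact: smooth_derivable.
have HB0 i z : `|z - 0| <= `|y - 0| + \sum_i `|(x - y) i 0| ->
    `|partial i f z - 0| <= B by move=> _; rewrite subr0; exact: HB.
have := partial_increment D B0 HB0 (lexx _).
rewrite [y + _]addrC subrK big1 ?subr0; last by move=> i _; rewrite mulr0.
move=> H; apply: le_trans H _.
by rewrite -mulrA ler_wpM2l// sum_norm_coord_le.
Qed.

Lemma smooth_strict_differentiable f x (e : R) : smooth f -> 0 < e ->
  exists2 r : R, 0 < r & forall y h, `|y - x| <= r -> `|h| <= r ->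
    `|f (y + h) - f y - dotp (gradient f x) h| <= e * `|h|.
Proof.
move=> sf e0; pose e' := e / (d%:R + 1).
have d1 : 0 < d%:R + 1 :> R by rewrite ltr_wpDl.
have e'0 : 0 < e' by rewrite divr_gt0.
have /choice [r Hr] i : exists r : R, 0 < r /\
    forall z, `|z - x| <= r -> `|partial i f z - partial i f x| <= e'.
  have /cvgrPdist_le/(_ _ e'0) := @smooth_continuous _ _ _ (smooth_partial i sf) x.
  move=> /nbhs_ballP[r /= r0 Hr]; exists (r / 2); split; first by rewrite divr_gt0.
  move=> z zx; rewrite distrC; apply: Hr; rewrite -ball_normE /ball_/= distrC.
  by rewrite (le_lt_trans zx)// ltr_pdivrMr// ltr_pMr// ltrDl.
pose r0 := \big[Order.min/(1 : R)]_i r i.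
have r00 : 0 < r0.
  by rewrite /r0; apply/bigmin_gtP; split => // i _; have [] := Hr i.
(* The path of coordinate steps has length at most [d] times the sup norm of [h], so it stays within
   [(d + 1)] times this radius. *)
exists (r0 / (d%:R + 1)); first by rewrite divr_gt0.
move=> y h yx hr.
have D i z : derivable f z (e_ i) by exact: smooth_derivable.
have HG i z : `|z - x| <= r0 -> `|partial i f z - partial i f x| <= e'.
  move=> zx; have [_] := Hr i; apply; rewrite (le_trans zx)//.
  exact: bigmin_le_cond.
have := partial_increment D (ltW e'0) HG (y := y) (h := h).
have -> : dotp (gradient f x) h = \sum_i h i 0 * partial i f x.
  by apply: eq_bigr => i _; rewrite mxE mulrC.
move=> H; apply: le_trans (H _) _.
- have -> : r0 = r0 / (d%:R + 1) + d%:R * (r0 / (d%:R + 1)).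
    by field; rewrite gt_eqF.
  by rewrite lerD// (le_trans (sum_norm_coord_le h))// ler_wpM2l.
- rewrite (le_trans (ler_wpM2l (ltW e'0) (sum_norm_coord_le h)))//.
  rewrite mulrA ler_wpM2r// /e' -mulrA [_ * d%:R]mulrC mulrA.
  by rewrite ler_pdivrMr// ler_pM2l// lerDl.
Qed.

Lemma continuous_borel_measurable f : continuous f ->
  measurable_fun setT (f : borel R d -> R).
Proof.
move=> cf; apply: (measurability _ (RGenOpens.measurableE R)) => _ [_ [a [b ->]] <-].
rewrite setTI; apply: sub_sigma_algebra => /=.
apply: open_comp; last exact: interval_open.
by move=> x _; exact: cf.
Qed.

Lemma test_function_measurable f : test_function f ->
  measurable_fun setT (f : borel R d -> R).
Proof. by move=> [sf _]; apply: continuous_borel_measurable; exact: smooth_continuous. Qed.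

(** A smooth version of the cube of half-side [r], with faces sharpened by [k]. It serves as a
    mollifier for [k = 1] and as a cutoff for [k = r = n]. The double signs match the form
    [k * x i 0 - b] of [smooth_flat]. *)
Definition bump (k r : R) x : R :=
  \prod_i (flat 1 (- k * x i 0 - - (k * r)) * flat 1 (k * x i 0 - - (k * r))).

Lemma smooth_bump (k r : R) : smooth (bump k r).
Proof. by apply: smooth_prod => i; apply: smoothM; exact: smooth_flat. Qed.

Lemma bump_unit (k r : R) x : 0 <= bump k r x <= 1.
Proof.
rewrite /bump; elim/big_ind : _ => [|a b|i _].
- by rewrite lexx ler01.
- by move=> /andP[? ?] /andP[? ?]; apply/andP; split; nra.
- set a := flat _ _; set b := flat _ _.
  have /andP[? ?] : 0 <= a <= 1 by exact: flat1_unit.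
  have /andP[? ?] : 0 <= b <= 1 by exact: flat1_unit.
  by apply/andP; split; nra.
Qed.

Lemma bump_supp (k r : R) : 0 <= k -> 0 <= r -> forall x, r < `|x| -> bump k r x = 0.
Proof.
move=> k0 r0 x rx; have [i ix] : exists i, r < `|x i 0|.
  apply: contrapT => /forallNP H; move: rx; rewrite ltNge => /negP; apply.
  by apply: norm_cV_le => // i; rewrite leNgt; apply/negP; exact: H.
rewrite /bump (bigD1 i)//= !opprK; move: ix.
rewrite ltNge ler_norml negb_and -!ltNge => /orP[ix|ix].
  rewrite [X in _ * X * _]flat_le0 ?mulr0 ?mul0r// -mulrDr mulr_ge0_le0//.
  by rewrite -lerBrDr sub0r ltW.
rewrite [X in X * _ * _]flat_le0 ?mul0r// mulNr addrC -mulrBr mulr_ge0_le0//.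
by rewrite subr_le0 ltW.
Qed.

End test_functions.

Section dominated_convergence_real.
Context d (T : measurableType d) {R : realType} (mu : {measure set T -> \bar R}).

Lemma Rdominated_cvg (h : nat -> T -> R) (g G : T -> R) :
  (forall n, measurable_fun setT (h n)) -> measurable_fun setT g ->
  (forall x, h n x @[n --> \oo] --> g x) ->
  mu.-integrable setT (EFin \o G) -> (forall n x, `|h n x| <= G x) ->
  \int[mu]_x h n x @[n --> \oo] --> \int[mu]_x g x.
Proof.
move=> mh mg hg iG hG.
have [|||| ig _ C] := @dominated_convergence _ _ _ mu setT measurableT
  (fun n x => (h n x)%:E) (EFin \o g) (EFin \o G) _ _ _ iG.
- by move=> n; apply/measurable_EFinP.
- exact/measurable_EFinP.
- apply: aeW => x _; apply: cvg_EFin; first exact: nearW.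
  exact: hg.
- by apply: aeW => x n _; rewrite lee_fin.
apply: fine_cvg; rewrite fineK//.
exact: integrable_fin_num.
Qed.

End dominated_convergence_real.

Section layers.
Context {R : realType}.

Lemma measurable_superlevel d (T : measurableType d) (g : T -> R) (a : R) :
  measurable_fun setT g -> measurable [set x | a < g x].
Proof.
by move=> mg; rewrite -[X in measurable X]setTI; exact: (measurable_fun_ltr (measurable_cst _) mg).
Qed.

Lemma indic_superlevel (T : Type) (g : T -> R) (a : R) x :
  \1_[set x | a < g x] x = (a < g x)%R%:R :> R.
Proof. by rewrite indicE; congr (_ %:R); congr nat_of_bool; apply/idP/idP; rewrite inE. Qed.

Lemma count_layers (N : nat) (t : R) : 0 <= t <= N%:R ->
  t <= \sum_(k < N) (k%:R < t)%R%:R <= t + 1.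
Proof.
elim: N => [|N IH]; first by rewrite big_ord0 => /andP[t0 t1]; apply/andP; split; lra.
move=> /andP[t0 tN]; have [tN'|Nt] := leP t N%:R.
  rewrite big_ord_recr/= ltNge tN' /= addr0; apply: IH; exact/andP.
rewrite (eq_bigr (fun=> 1)); last first.
  by move=> k _; rewrite (le_lt_trans _ Nt)// ler_nat -ltnS.
rewrite sumr_const card_ord tN/= -natr1 lerD2r ltW//.
Qed.

(** The layer-cake formula at resolution [1/(n+1)]: a number in the unit interval is approximated
    from above, with an error of at most one level. It reduces statements on functions to statements
    on their superlevel sets. *)
Lemma unit_layers (n : nat) (y : R) : 0 <= y <= 1 ->
  y <= n.+1%:R^-1 * \sum_(k < n.+1) (k%:R / n.+1%:R < y)%R%:R <= y + n.+1%:R^-1.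
Proof.
move=> /andP[y0 y1]; have n0 : 0 < n.+1%:R :> R by [].
have := @count_layers n.+1 (n.+1%:R * y).
rewrite mulr_ge0//= ler_piMr// => /(_ isT).
under eq_bigr do rewrite -ltr_pdivrMl// mulrC.
by rewrite ler_pdivlMl// ler_pdivrMl// mulrDr divff ?gt_eqF.
Qed.

End layers.

(** * Density of test functions in a weighted L1 space *)

Section smooth_density.
Context {R : realType} {d : nat}.
Variable nu : {finite_measure set (borel R d) -> \bar R}.
Variable w : borel R d -> R.
Hypothesis w0 : forall x, 0 <= w x.
Hypothesis iw : nu.-integrable setT (EFin \o w).
Implicit Types (f g : 'cV[R]_d -> R) (A : set (borel R d)).

Definition unit_valued f := forall x, 0 <= f x <= 1.

Let unit_fun f := measurable_fun setT (f : borel R d -> R) /\ unit_valued f.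

Let dist f g := \int[nu]_x (`|f x - g x| * w x).

Let mw : measurable_fun setT w.
Proof. by apply/measurable_EFinP; case/integrableP: iw. Qed.

Let unit_dist f g x : unit_valued f -> unit_valued g -> `|f x - g x| <= 1.
Proof.
by move=> f01 g01; exact: unit_interval_dist.
Qed.

Let measurable_dist f g : unit_fun f -> unit_fun g ->
  measurable_fun setT (fun x : borel R d => `|f x - g x| * w x).
Proof.
move=> [mf _] [mg _]; apply: measurable_funM => //.
by apply: measurableT_comp => //; exact: measurable_funB.
Qed.

Let integrable_dist f g : unit_fun f -> unit_fun g ->
  nu.-integrable setT (EFin \o (fun x => `|f x - g x| * w x)).
Proof.
move=> [mf f01] [mg g01]; apply: (@integrable_prod _ _ _ nu _ _ 1) => //.
- by apply: measurableT_comp => //; exact: measurable_funB.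
- by move=> x; rewrite normr_id; exact: unit_dist.
Qed.

Let dist_cvg (h : nat -> 'cV[R]_d -> R) g :
  (forall n, unit_fun (h n)) -> unit_fun g ->
  (forall x, h n x @[n --> \oo] --> g x) ->
  dist (h n) g @[n --> \oo] --> (0 : R).
Proof.
move=> uh ug hg.
have -> : 0 = \int[nu]_x (cst 0 x) :> R by rewrite Rintegral_cst// mul0r.
apply: (@Rdominated_cvg _ _ _ nu _ _ w) => //.
- by move=> n; exact: measurable_dist.
- move=> x; rewrite -[X in _ --> X](mul0r (w x)); apply: cvgM; last exact: cvg_cst.
  rewrite -[X in _ --> X](@normr0 _ R); apply: cvg_norm.
  by rewrite -[X in _ --> X](subrr (g x)); apply: cvgB; [exact: hg|exact: cvg_cst].
- move=> n x; rewrite normrM normr_id (ger0_norm (w0 x)) ler_piMl//.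
  by apply: unit_dist; [have [] := uh n|have [] := ug].
Qed.

Let dist_triangle f g h : unit_fun f -> unit_fun g -> unit_fun h ->
  dist f h <= dist f g + dist g h.
Proof.
move=> uf ug uh; rewrite /dist -RintegralD//; try exact: integrable_dist.
apply: le_Rintegral => //; first exact: integrable_dist.
  by apply: integrable_radd; exact: integrable_dist.
by move=> x _; rewrite -mulrDl ler_wpM2r// ler_distD.
Qed.

Let dist_le f g (a : R) f' g' : unit_fun f -> unit_fun g -> unit_fun f' -> unit_fun g' ->
  (forall x, `|f x - g x| <= `|f' x - g' x|) -> dist f g <= dist f' g'.
Proof.
move=> uf ug uf' ug' H; apply: le_Rintegral => //; try exact: integrable_dist.
by move=> x _; rewrite ler_wpM2r.
Qed.

Let smooth_unit_fun f : smooth f -> unit_valued f -> unit_fun f.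
Proof.
move=> sf f01; split => //; apply: continuous_borel_measurable.
exact: smooth_continuous.
Qed.

(** The approximants are kept between 0 and 1, so that the class is stable under products and
    complements as well as under pointwise limits. *)
Let approx f := unit_fun f /\ forall e : R, 0 < e ->
  exists g, [/\ smooth g, unit_valued g & dist g f <= e].

Let approx_smooth f : smooth f -> unit_valued f -> approx f.
Proof.
move=> sf f01; split; first exact: smooth_unit_fun.
move=> e e0; exists f; split => //; rewrite /dist.
under eq_Rintegral do rewrite subrr normr0 mul0r.
by rewrite Rintegral_cst// mul0r ltW.
Qed.

Let approx_lim (h : nat -> 'cV[R]_d -> R) f : (forall n, approx (h n)) ->
  unit_fun f -> (forall x, h n x @[n --> \oo] --> f x) -> approx f.
Proof.
move=> ah uf hf; split => // e e0.
have e20 : 0 < e / 2 by rewrite divr_gt0.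
have uh n : unit_fun (h n) by have [] := ah n.
have /cvgrPdist_le/(_ _ e20)[n _ /(_ n (leqnn n))] := dist_cvg uh uf hf.
rewrite sub0r normrN ger0_norm; last first.
  by apply: Rintegral_ge0 => x _; rewrite mulr_ge0.
move=> hn; have [g [sg g01 gh]] := (ah n).2 _ e20.
exists g; split => //; rewrite (splitr e).
apply: le_trans (dist_triangle (smooth_unit_fun sg g01) (uh n) uf) _.
exact: lerD.
Qed.

Let approxC f : approx f -> approx (fun x => 1 - f x).
Proof.
move=> [[mf f01] af]; have u : unit_fun (fun x => 1 - f x).
  by split; [exact: measurable_funB|move=> x; have := f01 x; lra].
split => // e /af[g [sg g01 ge]].
exists (fun x => 1 - g x); split.
- by apply: smoothB => //; exact: smooth_cst.
- by move=> x; have := g01 x; lra.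
- apply: le_trans ge; apply: dist_le => //.
  + apply: smooth_unit_fun; first by apply: smoothB => //; exact: smooth_cst.
    by move=> x; have := g01 x; lra.
  + exact: smooth_unit_fun.
  + by move=> x; rewrite opprB addrCA addrAC subrr add0r distrC.
Qed.

Let approxM f g : approx f -> approx g -> approx (fun x => f x * g x).
Proof.
move=> [uf af] [ug ag].
have unitM f' g' : unit_valued f' -> unit_valued g' -> unit_valued (fun x => f' x * g' x).
  by move=> H1 H2 x; have := H1 x; have := H2 x => /andP[? ?] /andP[? ?];
    apply/andP; split; nra.
have u : unit_fun (fun x => f x * g x).
  split; first by apply: measurable_funM; [exact: uf.1|exact: ug.1].
  by apply: unitM; [exact: uf.2|exact: ug.2].
split => // e e0; have e20 : 0 < e / 2 by rewrite divr_gt0.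
have [f' [sf f'01 fe]] := af _ e20; have [g' [sg g'01 ge]] := ag _ e20.
have u' : unit_fun (fun x => f' x * g' x).
  by apply: smooth_unit_fun; [exact: smoothM|exact: unitM].
exists (fun x => f' x * g' x); split; [exact: smoothM|exact: unitM|].
have uf' := smooth_unit_fun sf f'01; have ug' := smooth_unit_fun sg g'01.
rewrite (splitr e); apply: le_trans (lerD fe ge).
rewrite /dist -RintegralD//; try exact: integrable_dist.
apply: le_Rintegral => //; first exact: integrable_dist.
  by apply: integrable_radd; exact: integrable_dist.
move=> x _; rewrite -mulrDl ler_wpM2r//.
have -> : f' x * g' x - f x * g x = (f' x - f x) * g' x + f x * (g' x - g x) by ring.
rewrite (le_trans (ler_normD _ _))// !normrM lerD//.
  by rewrite ler_piMr//; have /andP[g0 g1] := g'01 x; rewrite ger0_norm.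
by rewrite ler_piMl//; have /andP[f0 f1] := uf.2 x; rewrite ger0_norm.
Qed.

(** Good-sets argument: the sets with an approximable indicator form a sigma-algebra containing the
    coordinate half-spaces, hence all Borel sets. *)
Let borel_approx A : measurable A -> approx (\1_A).
Proof.
pose F : set (set 'cV[R]_d) := [set A | approx (\1_A)].
have u1 B : measurable (B : set (borel R d)) -> unit_fun (\1_B).
  move=> mB; split; first exact: measurable_indic.
  by move=> x; exact: indic_unit.
have mF B : F B -> measurable (B : set (borel R d)).
  move=> [[mB _] _]; have := mB measurableT [set 1] (measurable_set1 _).
  rewrite setTI (_ : _ @^-1` _ = B)//; apply/seteqP; split => x /=; rewrite indicE.
    by case: (boolP (x \in B)) => [/set_mem//|_ /eqP]; rewrite eq_sym oner_eq0.
  by move=> Bx; rewrite mem_set.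
have F0 : F set0.
  rewrite /F/= indic0; apply: approx_smooth; first exact: smooth_cst.
  by move=> x; rewrite lexx ler01.
have FC B : F B -> F (~` B).
  move=> /approxC; rewrite /F /= (_ : (fun x => 1 - _) = \1_(~` B))//.
  apply/funext => x; rewrite !indicE in_setC.
  by case: (x \in B); rewrite ?subrr ?subr0.
have FI B C : F B -> F C -> F (B `&` C).
  by move=> FB FC'; rewrite /F/= indicI; exact: approxM.
have FU B C : F B -> F C -> F (B `|` C).
  by move=> FB FC'; rewrite -[B]setCK -[C]setCK -setCI; apply/FC/FI; exact: FC.
have sF : sigma_algebra setT F.
  split => //; first by move=> B FB; rewrite setTD; exact: FC.
  (* Increasing finite unions, so that the indicators converge pointwise and [approx_lim]
     applies. *)
  move=> B FB; pose U n := \big[setU/set0]_(k < n) B k.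
  have FUn n : F (U n).
    by rewrite /U; elim/big_ind : _ => // *; exact: FU.
  apply: (@approx_lim (fun n => \1_(U n))) => //.
    by apply: u1; apply: bigcupT_measurable => k; apply: mF; exact: FB.
  move=> x; have [[k _ Bk]|nB] := pselect ((\bigcup_i B i) x).
    rewrite indicE mem_set; last by exists k.
    apply: cvg_near_cst; exists k.+1 => // n /= kn.
    by rewrite indicE mem_set// /U -bigcup_mkord; exists k.
  rewrite indicE memNset//.
  apply: cvg_near_cst; exists 0%N => // n _.
  rewrite indicE memNset// /U -bigcup_mkord => -[k _ Bk].
  by apply: nB; exists k.
move=> mA.
have coordF i (a : R) : F [set x : 'cV[R]_d | a < x i 0].
  have m1 := measurable_superlevel a (measurable_coord_col i).
  apply: (@approx_lim (fun n x => flat 1 (n%:R * x i 0 - n%:R * a))).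
  - move=> n; apply: approx_smooth; first exact: smooth_flat.
    by move=> x; exact: flat1_unit.
  - exact: u1.
  - move=> x; under eq_fun do rewrite -mulrBr.
    by have := @cvg_flat1 R (x i 0 - a); rewrite subr_gt0 indic_superlevel.
(* The coordinates are measurable for the sigma-algebra [F], so the identity from [F] to the Borel
   sets is measurable, which is the inclusion sought. *)
have idF : measurable_fun setT (id : g_sigma_algebraType F -> borel R d).
  apply: measurable_fun_colP => i.
  apply: (measurability _ (RGenOInfty.measurableE R)) => _ [_ [a ->] <-].
  rewrite setTI; apply: sub_sigma_algebra.
  rewrite (_ : _ @^-1` _ = [set x : 'cV[R]_d | a < x i 0])//.
  by apply/seteqP; split => x /=; rewrite in_itv/= andbT.
have := idF measurableT A mA; rewrite setTI preimage_id.
rewrite [X in X -> _](_ : _ = <<s F >> A)// => FA.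
by apply: (FA F); split.
Qed.

Let approx_mean (h : nat -> 'cV[R]_d -> R) n : (forall k, approx (h k)) ->
  approx (fun x => n.+1%:R^-1 * \sum_(k < n.+1) h k x).
Proof.
move=> ah; have n0 : 0 < n.+1%:R :> R by [].
have avg (f : nat -> 'cV[R]_d -> R) : (forall k, unit_valued (f k)) ->
    unit_valued (fun x => n.+1%:R^-1 * \sum_(k < n.+1) f k x).
  move=> uf x; rewrite ler_pdivlMl// mulr0 ler_pdivrMl// mulr1; apply/andP; split.
    by apply: sumr_ge0 => k _; have /andP[] := uf k x.
  apply: (@le_trans _ _ (\sum_(k < n.+1) (1 : R))); last by rewrite sumr_const card_ord.
  by apply: ler_sum => k _; have /andP[] := uf k x.
have u : unit_fun (fun x => n.+1%:R^-1 * \sum_(k < n.+1) h k x).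
  split; last by apply: avg => k; have [[]] := ah k.
  apply: measurable_funM => //; apply: measurable_sum => k.
  by have [[]] := ah k.
split => // e e0.
have /choice[g Hg] k : exists g, [/\ smooth g, unit_valued g & dist g (h k) <= e].
  by have [_] := ah k; exact.
have sg : smooth (fun x => n.+1%:R^-1 * \sum_(k < n.+1) g k x).
  by apply: smoothZ; apply: smooth_sum => k; have [] := Hg k.
have ug : unit_valued (fun x => n.+1%:R^-1 * \sum_(k < n.+1) g k x).
  by apply: avg => k; have [] := Hg k.
exists (fun x => n.+1%:R^-1 * \sum_(k < n.+1) g k x); split => //.
have iD (k : 'I_n.+1) : nu.-integrable setT (EFin \o (fun x => `|g k x - h k x| * w x)).
  apply: integrable_dist; last by have [] := ah k.
  by have [sgk ugk _] := Hg k; exact: smooth_unit_fun.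
have [iS ES] := Rintegral_sum (index_enum 'I_n.+1) iD.
apply: (@le_trans _ _ (\int[nu]_x (n.+1%:R^-1 * \sum_(k < n.+1) (`|g k x - h k x| * w x)))).
  apply: le_Rintegral => //.
  - by apply: integrable_dist => //; exact: smooth_unit_fun.
  - exact: integrable_rscale.
  - move=> x _; rewrite -mulr_suml mulrA ler_wpM2r// -mulrBr -sumrB normrM.
    by rewrite gtr0_norm ?invr_gt0// ler_wpM2l ?invr_ge0// ler_norm_sum.
rewrite RintegralZl// ES ler_pdivrMl//.
rewrite mulr_natl -[X in _ <= _ *+ X](card_ord n.+1) -sumr_const.
by apply: ler_sum => k _; have [] := Hg k.
Qed.

Let approx_unit f : unit_fun f -> approx f.
Proof.
move=> uf; have [mf f01] := uf.
pose A n k : set (borel R d) := [set x | k%:R / n.+1%:R < f x].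
have mA n k : measurable (A n k) by exact: measurable_superlevel.
apply: (@approx_lim (fun n x => n.+1%:R^-1 * \sum_(k < n.+1) \1_(A n k) x)) => //.
- by move=> n; apply: (@approx_mean (fun k => \1_(A n k))) => k; exact: borel_approx.
- move=> x; apply/cvgrPdist_le => e e0; near=> n.
  have /andP[H1 H2] := unit_layers n (f01 x).
  have -> : \sum_(k < n.+1) \1_(A n k) x =
      \sum_(k < n.+1) (k%:R / n.+1%:R < f x)%R%:R :> R.
    by apply: eq_bigr => k _; exact: indic_superlevel.
  rewrite distrC ger0_norm ?subr_ge0// lerBlDl (le_trans H2)// lerD2l.
  have e1 : e^-1 <= n%:R by near: n; exact: nbhs_infty_ger.
  by rewrite -[e]invrK lef_pV2 ?posrE ?invr_gt0// (le_trans e1)// ler_nat.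
Unshelve. all: end_near. Qed.

Let cutoff n : 'cV[R]_d -> R := bump n%:R n%:R.

(** Each factor has the argument [n * (n + a)] with [a] fixed, eventually above [n], so it is
    squeezed between [flat 1 n] and 1. *)
Let cvg_cutoff x : cutoff n x @[n --> \oo] --> (1 : R).
Proof.
have H (a : R) : flat 1 (n%:R * a - - (n%:R * n%:R)) @[n --> \oo] --> (1 : R).
  have := @cvg_flat1 R 1; rewrite ltr01 mulr1n => C.
  have C' : (fun n : nat => flat 1 (n%:R * 1 : R)) @ \oo --> (1 : R) by exact: C.
  have C1 : (fun _ : nat => 1 : R) @ \oo --> (1 : R) by exact: cvg_cst.
  apply: (squeeze_cvgr _ C' C1).
  near=> n; apply/andP; split; last by have /andP[] := flat1_unit (n%:R * a - - (n%:R * n%:R)).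
  apply: flat1_homo; rewrite opprK -mulrDr ler_wpM2l//.
  have : 1 - a <= n%:R by near: n; exact: nbhs_infty_ger.
  by lra.
have Hi i : flat 1 (- n%:R * x i 0 - - (n%:R * n%:R)) * flat 1 (n%:R * x i 0 - - (n%:R * n%:R))
    @[n --> \oo] --> (1 * 1 : R).
  by apply: cvgM; [under eq_fun do rewrite mulNr -mulrN; exact: H|exact: H].
rewrite /cutoff /bump; elim: (index_enum _) => [|i s IH].
  by under eq_fun do rewrite big_nil; exact: cvg_cst.
under eq_fun do rewrite big_cons.
by have := cvgM (Hi i) IH; rewrite !mulr1; exact.
Unshelve. all: end_near. Qed.

(** The weight allows one approximation to control several integrals at once, and a finite measure
    instead of a probability allows sums of laws. Compact support comes last, by a cutoff and
    dominated convergence. *)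
Lemma test_function_density g (e : R) : measurable_fun setT (g : borel R d -> R) ->
  (forall x, 0 <= g x <= 1) -> 0 < e ->
  exists f, [/\ test_function f, forall x, 0 <= f x <= 1 &
    \int[nu]_x (`|f x - g x| * w x) <= e].
Proof.
move=> mg g01 e0; have e20 : 0 < e / 2 by rewrite divr_gt0.
have ug : unit_fun g by [].
have [_ /(_ _ e20)[f [sf f01 fg]]] := approx_unit ug.
have scut n : smooth (cutoff n) by exact: smooth_bump.
have uM n : unit_valued (fun x => f x * cutoff n x).
  by move=> x; have /andP[? ?] := f01 x; have /andP[? ?] := bump_unit n%:R n%:R x;
    rewrite /cutoff; apply/andP; split; nra.
have uf := smooth_unit_fun sf f01.
have uh n := smooth_unit_fun (smoothM sf (scut n)) (uM n).
have /cvgrPdist_le/(_ _ e20)[n _ /(_ n (leqnn n))] :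
    dist (fun x => f x * cutoff n x) f @[n --> \oo] --> (0 : R).
  apply: dist_cvg => // x; rewrite -[X in _ --> X]mulr1; apply: cvgM.
    exact: cvg_cst.
  exact: cvg_cutoff.
rewrite sub0r normrN ger0_norm; last first.
  by apply: Rintegral_ge0 => x _; rewrite mulr_ge0.
move=> H; exists (fun x => f x * cutoff n x); split => //.
- apply/test_functionP; split; first exact: smoothM.
  by exists n%:R; split => // x nx; rewrite /cutoff bump_supp ?mulr0.
- exact: uM.
- by rewrite (splitr e) (le_trans (dist_triangle (uh n) uf ug))// lerD.
Qed.

End smooth_density.

(** * Stop-loss domination and the entropy inequality *)

Section linear_domination.
Context {R : realType} {d : nat} (mu : probability (borel R d) R).
Variables (v : 'cV[R]_d -> 'cV[R]_d) (c : R).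
Hypothesis c0 : 0 < c.
Hypothesis iv : forall i, mu.-integrable setT (fun x => (v x i 0)%:E).
Implicit Types (g : borel R d -> R) (u : 'cV[R]_d).

Lemma enorm_leP (Y : 'cV[R]_d) (M : R) : 0 <= M ->
  enorm Y <= M <-> (forall u, enorm u = 1 -> dotp u Y <= M).
Proof.
move=> M0; split=> [YM u u1|H].
  by rewrite (le_trans (dotp_le u Y))// u1 mul1r.
have [->|Y0] := eqVneq Y 0; first by rewrite enorm0.
have [u [u1 Yu]] := unit_direction Y0.
suff -> : enorm Y = dotp u Y by exact: H.
by rewrite [in RHS]Yu dotpZr -enorm_sqr u1 expr1n mulr1.
Qed.

Lemma integrable_dotp u : mu.-integrable setT (EFin \o (fun x => dotp u (v x))).
Proof. by have [] := dotp_vmean u iv. Qed.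

Lemma integrable_unit_coord g : measurable_fun setT g -> (forall x, 0 <= g x <= 1) ->
  forall i, mu.-integrable setT (fun x => ((g x *: v x) i 0)%:E).
Proof.
move=> mg g01 i; under eq_fun do rewrite mxE.
apply: (integrable_prod mg (M := 1) _ (iv i)) => x.
by have /andP[g0 g1] := g01 x; rewrite ger0_norm.
Qed.

Lemma dotp_vmean_scale g u : measurable_fun setT g -> (forall x, 0 <= g x <= 1) ->
  dotp u (vmean mu (fun x => g x *: v x)) = \int[mu]_x (g x * dotp u (v x)).
Proof.
move=> mg g01; rewrite (dotp_vmean u (integrable_unit_coord mg g01)).2.
by apply: eq_Rintegral => x _; rewrite dotpZr.
Qed.

Lemma lift_zonoid_sub_gaussianP :
  lift_zonoid mu v `<=` lift_zonoid (gaussian c d) id <->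
  (forall g, measurable_fun setT g -> (forall x, 0 <= g x <= 1) ->
    enorm (vmean mu (fun x => g x *: v x)) <= c * isop (mean mu g)).
Proof.
split=> [H g mg g01|H _ [g [mg g01] <-]].
  have /gaussian_zonoidP : lift_zonoid (gaussian c d) id
    (mean mu g, vmean mu (fun x => g x *: v x)) by apply: H; exists g.
  by move=> /(_ c0)[].
apply/gaussian_zonoidP => //; split; last exact: H.
by have [] := mean_unit_interval mu mg g01.
Qed.

(** For a fixed direction [u] and a fixed [z], the inequality compares two affine functionals of
    [g], both continuous for the norm weighted by [1 + |<u,v>|]; density of test functions therefore
    suffices. *)
Lemma test_function_domination :
  (forall f, test_function f -> (forall x, 0 <= f x <= 1) ->
    enorm (vmean mu (fun x => f x *: v x)) <= c * isop (mean mu f)) <->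
  (forall g, measurable_fun setT g -> (forall x, 0 <= g x <= 1) ->
    enorm (vmean mu (fun x => g x *: v x)) <= c * isop (mean mu g)).
Proof.
split=> [H g mg g01|H f tf f01]; last first.
  by apply: H => //; exact: test_function_measurable.
have [ig p01] := mean_unit_interval mu mg g01.
have ci0 (p : R) : 0 <= c * isop p by rewrite mulr_ge0 ?isop_ge0// ltW.
apply/enorm_leP => // u u1; rewrite dotp_vmean_scale//.
apply/le_isopP => // z; apply/ler_addgt0Pr => e e0.
(* The term 1 controls the change of the mean of [g], the term [|W|] that of the mean of [g * W]. *)
pose W x := dotp u (v x); pose w x := 1 + `|W x|.
have iW : mu.-integrable setT (EFin \o W) by exact: integrable_dotp.
have w0 x : 0 <= w x by rewrite addr_ge0.
have iw : mu.-integrable setT (EFin \o w).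
  by apply: integrable_radd; [exact: integrable_cst_fin|exact: integrable_norm].
(* Replacing [g] by [f] costs one weighted distance on the left-hand side and [c * |z|] of them on
   the right-hand side. *)
have k0 : 0 < c * `|z| + 1 by rewrite ltr_wpDl// mulr_ge0// ltW.
have ek : 0 < e / (c * `|z| + 1) by rewrite divr_gt0.
have [f [tf f01 fg]] := test_function_density w0 iw mg g01 ek.
have mf := test_function_measurable tf.
have [if_ q01] := mean_unit_interval mu mf f01.
have := H f tf f01; move=> /(enorm_leP _ (ci0 _)).1/(_ u u1).
rewrite dotp_vmean_scale// => /(le_isopP _ c0 q01).1/(_ z) Hf.
have bnd (h : borel R d -> R) : (forall x, 0 <= h x <= 1) -> forall x, `|h x| <= 1.
  by move=> h01 x; have /andP[h0 h1] := h01 x; rewrite ger0_norm.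
have ifW : mu.-integrable setT (EFin \o (fun x => f x * W x)).
  exact: integrable_prod mf (bnd _ f01) iW.
have igW : mu.-integrable setT (EFin \o (fun x => g x * W x)).
  exact: integrable_prod mg (bnd _ g01) iW.
have iD : mu.-integrable setT (EFin \o (fun x => `|f x - g x| * w x)).
  apply: (@integrable_prod _ _ _ mu _ _ 1) => //.
    by apply: measurableT_comp => //; exact: measurable_funB.
  by move=> x; rewrite normr_id; exact: unit_interval_dist.
have D1 : \int[mu]_x (g x * W x) - \int[mu]_x (f x * W x) <= \int[mu]_x (`|f x - g x| * w x).
  rewrite -RintegralB//; apply: le_Rintegral => //; first exact: integrable_rsub.
  move=> x _; rewrite -mulrBl (le_trans (ler_norm _))// normrM distrC ler_wpM2l//.
  by rewrite lerDr.
have D2 : `|\int[mu]_x f x - \int[mu]_x g x| <= \int[mu]_x (`|f x - g x| * w x).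
  rewrite -RintegralB//; apply: le_trans (le_normr_Rintegral _ _) _ => //.
    exact: integrable_rsub.
  apply: le_Rintegral => //.
    by apply: integrable_norm; exact: integrable_rsub.
  by move=> x _; rewrite ler_peMr// lerDl.
have zD : z * (\int[mu]_x f x - \int[mu]_x g x) <= `|z| * (e / (c * `|z| + 1)).
  by rewrite (le_trans (ler_norm _))// normrM ler_wpM2l// (le_trans D2).
have E : e = c * (`|z| * (e / (c * `|z| + 1))) + e / (c * `|z| + 1).
  by field; rewrite gt_eqF.
have cz := ler_wpM2l (ltW c0) zD.
rewrite -/(mean mu g) -/(mean mu f) in D2 zD cz Hf *.
rewrite /mean in D1 D2 zD cz Hf *.
set a := \int[mu]_x f x in D2 zD cz Hf.
set b := \int[mu]_x g x in D2 zD cz *.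
set q := e / _ in fg E zD cz.
rewrite E; move: (le_trans D1 fg) Hf cz.
set A := \int[mu]_x (g x * _); set B := \int[mu]_x (f x * _) => P1 P2 P3.
by clear -P1 P2 P3; lra.
Qed.

End linear_domination.

(** * Exponential moments and Gibbs duality *)

Section exponential_moments.
Context {R : realType}.
Notation leb := (@lebesgue_measure R).

Lemma cvgy_linear_expRN (k : R) : expR (- b) * (k + b) @[b --> +oo] --> (0 : R).
Proof.
apply/cvgrPdist_le => e e0; near=> b.
have b0 : 0 < b by near: b; exact: nbhs_pinfty_gt.
have kb : `|k| <= b by near: b; apply: nbhs_pinfty_ge; exact: num_real.
have eb : 4 / e <= b by near: b; apply: nbhs_pinfty_ge; exact: num_real.
rewrite sub0r normrN normrM (ger0_norm (expR_ge0 _)) expRN ler_pdivrMl ?expR_gt0//.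
apply: (@le_trans _ _ (2 * b)).
  by rewrite (le_trans (ler_normD _ _))// (ger0_norm (ltW b0)); lra.
have H := expR_ge1Dxn 1 (ltW b0).
have : 4 <= e * b by rewrite mulrC -ler_pdivrMr.
have E : b ^+ 2 / 2`!%:R = b * b / 2 :> R by rewrite expr2.
rewrite E in H => eb'.
have : e * (1 + b * b / 2) <= e * expR b by rewrite ler_pM2l.
rewrite [expR b * e]mulrC; nra.
Unshelve. all: end_near. Qed.

(** Writes the exponential as a positive mixture of stop-loss functions, so a comparison of
    stop-losses becomes one of exponential moments. *)
Lemma integral_exp_stop_loss (x : R) :
  (\int[leb]_a (expR a * Num.max (x - a) 0)%:E = (expR x)%:E)%E.
Proof.
transitivity (\int[leb]_(a in `]-oo, (- - x)%R]) (expR a * (x - a))%:E)%E.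
  rewrite opprK [RHS]integral_mkcond; apply: eq_integral => a _.
  rewrite patchE mem_setE in_itv/= /Order.max/= subr_lt0 ltNge.
  by case: (a <= x) => //=; rewrite mulr0.
have cG : continuous (fun a : R => expR a * (x - a)).
  move=> a; apply: continuousM; first exact: continuous_expR.
  by apply: continuousB; [exact: cst_continuous|move=> ?; exact: cvg_id].
rewrite (ge0_integration_by_substitutionNy (G := fun a => expR a * (x - a))); last 2 first.
- exact: continuous_subspaceT.
- by move=> a; rewrite in_itv/= opprK => ax; rewrite mulr_ge0 ?expR_ge0// subr_ge0 ltW.
(* An antiderivative found by parts; it vanishes at infinity and equals [- expR x] at [b = - x]. *)
pose F b := - (expR (- b) * (x + 1 + b)).
have D (b : R) : is_derive b 1 F (expR (- b) * (x + b)).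
  apply: is_derive_eq; rewrite /GRing.scale /=; ring.
rewrite (@ge0_continuous_FTC2y R _ F (- x) 0).
- by rewrite /F opprK (_ : x + 1 + - x = 1) ?mulr1; [rewrite -EFinB sub0r opprK|ring].
- by move=> b xb; rewrite /= mulr_ge0 ?expR_ge0// opprK -lerBlDl sub0r.
- by apply: continuous_subspaceT => b; apply: continuous_comp; [exact: opp_continuous|exact: cG].
- by rewrite -oppr0; apply: cvgN; exact: cvgy_linear_expRN.
- by move=> b _; have [] := D b.
- by apply: cvg_at_right_filter; apply: is_derive_continuous; exact: D.
- by move=> b _; rewrite derive1E /= opprK; have [_] := D b.
Qed.

Lemma integral_expR_stop_loss d (T : measurableType d) (P : probability T R) (W : T -> R) :
  measurable_fun setT W ->
  (\int[P]_x (expR (W x))%:E =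
   \int[leb]_a ((expR a)%:E * \int[P]_x (Num.max (W x - a) 0)%:E))%E.
Proof.
move=> mW.
have mF : measurable_fun setT (fun p : T * measurableTypeR R =>
    (expR p.2 * Num.max (W p.1 - p.2) 0)%:E).
  apply/measurable_EFinP; apply: measurable_funM.
    by apply: measurableT_comp => //; exact: measurable_expR.
  apply: measurable_maxr => //; apply: measurable_funB => //.
  exact: measurableT_comp.
under eq_integral do rewrite -integral_exp_stop_loss.
rewrite (fubini_tonelli (m1 := P) (m2 := leb) (fun p : T * measurableTypeR R =>
  (expR p.2 * Num.max (W p.1 - p.2) 0)%:E) mF); last first.
  by move=> p; rewrite lee_fin mulr_ge0 ?expR_ge0// le_max lexx orbT.
apply: eq_integral => a _; under eq_integral do rewrite /= EFinM.
rewrite ge0_integralZl//.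
- by apply/measurable_EFinP; apply: measurable_maxr => //; exact: measurable_funB.
- by move=> x _; rewrite lee_fin le_max lexx orbT.
Qed.

Lemma integral_normal_expR (c : R) :
  (\int[normal_prob 0 1]_x (expR (c * x))%:E = (expR (c ^+ 2 / 2))%:E)%E.
Proof.
rewrite ge0_integral_normal_prob; last 2 first.
- apply/measurable_EFinP; apply: measurableT_comp; first exact: measurable_expR.
  exact: measurable_funM.
- by move=> x; rewrite lee_fin expR_ge0.
(* Completing the square: the exponential tilt moves the standard normal density to mean [c]. *)
transitivity (\int[leb]_x ((expR (c ^+ 2 / 2))%:E * (normal_pdf c 1 x)%:E))%E.
  apply: eq_integral => x _; rewrite -!EFinM !normal_pdf_phi// !divr1 subr0 !phiE.
  rewrite mulrCA [RHS]EFinM; congr (_%:E); rewrite [RHS]mulrCA -!expRD.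
  by congr (_ * expR _); field.
rewrite ge0_integralZl//.
- by rewrite integral_normal_pdf mule1.
- by apply/measurable_EFinP; exact: measurable_normal_pdf.
- by move=> x _; rewrite lee_fin normal_pdf_ge0.
Qed.

Lemma scaled_stop_loss (c a : R) : 0 < c ->
  (\int[normal_prob 0 1]_x (Num.max (c * x - a) 0)%:E = (c * normal_stop_loss (a / c))%:E)%E.
Proof.
move=> c0; rewrite EFinM -stop_loss -ge0_integralZl//.
- apply: eq_integral => x _; rewrite -EFinM; congr (_%:E).
  by rewrite maxr_pMr ?ltW// mulr0 mulrBr mulrCA divff ?mulr1// gt_eqF.
- by apply/measurable_EFinP; apply: measurable_maxr => //; exact: measurable_funB.
- by move=> x _; rewrite lee_fin le_max lexx orbT.
- by rewrite lee_fin ltW.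
Qed.

(** The same mixture formula is used for [W] and for [c] times a standard normal; only the
    integrands in [a] are compared, and the Gaussian total is already known. *)
Lemma subgaussian_of_stop_loss d (T : measurableType d) (P : probability T R)
    (W : T -> R) (c : R) : 0 < c -> measurable_fun setT W ->
  (forall a, \int[P]_x (Num.max (W x - a) 0)%:E <= (c * normal_stop_loss (a / c))%:E)%E ->
  (\int[P]_x (expR (W x))%:E <= (expR (c ^+ 2 / 2))%:E)%E.
Proof.
move=> c0 mW H; have mc : measurable_fun setT (fun x : measurableTypeR R => c * x).
  exact: measurable_funM.
have max0 (b : R) : (0 <= (Num.max b 0)%:E)%E by rewrite lee_fin le_max lexx orbT.
have mfun d' (T' : measurableType d') (P' : probability T' R) (W' : T' -> R) :
    measurable_fun setT W' -> measurable_fun setT (fun a : measurableTypeR R =>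
      ((expR a)%:E * \int[P']_x (Num.max (W' x - a) 0)%:E)%E).
  move=> mW'; apply: emeasurable_funM.
    by apply/measurable_EFinP; exact: measurable_expR.
  apply: (measurable_fun_fubini_tonelli_G (m1 := P') (fun p : T' * measurableTypeR R =>
    (Num.max (W' p.1 - p.2) 0)%:E)) => //.
  apply/measurable_EFinP; apply: measurable_maxr => //; apply: measurable_funB => //.
  exact: measurableT_comp.
rewrite -integral_normal_expR (integral_expR_stop_loss P mW).
rewrite (integral_expR_stop_loss (normal_prob 0 1) mc).
apply: ge0_le_integral => //.
- by move=> a _; rewrite mule_ge0 ?lee_fin ?expR_ge0//; apply: integral_ge0.
- exact: mfun.
- exact: mfun.
- move=> a _; rewrite lee_wpmul2l ?lee_fin ?expR_ge0//.
  by rewrite scaled_stop_loss.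
Qed.

(** Young's inequality for the conjugate pair [a ln a - a] and [exp b]: it is [exp t >= 1 + t] at
    [t = b - ln a]. *)
Lemma young_entropy (a b : R) : 0 <= a -> a * b <= a * ln a - a + expR b.
Proof.
rewrite le_eqVlt => /predU1P[<-|a0]; first by rewrite !mul0r subr0 add0r expR_ge0.
have := expR_ge1Dx (b - ln a); rewrite expRB lnK ?posrE// ler_pdivlMr//.
by move=> H; lra.
Qed.

Lemma norm_mul_ln_le (t M : R) : 0 <= t <= M -> `|t * ln t| <= 1 + M ^+ 2.
Proof.
move=> /andP[]; rewrite le_eqVlt => /predU1P[<- _|t0 tM].
  by rewrite mul0r normr0 addr_ge0// sqr_ge0.
rewrite ler_norml; apply/andP; split.
  have := young_entropy 0 (ltW t0); rewrite expR0 mulr0.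
  by have := sqr_ge0 M; lra.
have := ln_sublinear t0; nra.
Qed.

(* Gibbs' variational principle: [H] plays the role of a log-density. *)
Lemma entropy_duality d (T : measurableType d) (P : probability T R) (f H : T -> R) (M L : R) :
  measurable_fun setT f -> (forall x, 0 <= f x <= M) -> 0 < \int[P]_x f x ->
  P.-integrable setT (EFin \o H) ->
  (\int[P]_x (expR (H x))%:E <= (expR L)%:E)%E ->
  \int[P]_x (f x * H x) <=
    (\int[P]_x (f x * ln (f x)) - \int[P]_x f x * ln (\int[P]_x f x)) + \int[P]_x f x * L.
Proof.
move=> mf fM; set F := \int[P]_x f x => F0 iH eH.
have mH : measurable_fun setT H by apply/measurable_EFinP; case/integrableP: iH.
have nf x : `|f x| <= M by have /andP[g0 g1] := fM x; rewrite ger0_norm.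
have if_ : P.-integrable setT (EFin \o f) by exact: (@integrable_bounded _ _ _ P f M).
have ifH : P.-integrable setT (EFin \o (fun x => f x * H x)) by exact: integrable_prod nf iH.
have iln : P.-integrable setT (EFin \o (fun x => f x * ln (f x))).
  apply: (@integrable_bounded _ _ _ P _ (1 + M ^+ 2)) => [|x]; last exact: norm_mul_ln_le.
  by apply: measurable_funM => //; apply: measurableT_comp => //; exact: measurable_ln.
have meH : measurable_fun setT (fun x => expR (H x)).
  by apply: measurableT_comp => //; exact: measurable_expR.
have ieH : P.-integrable setT (EFin \o (fun x => expR (H x))).
  apply/integrableP; split; first exact/measurable_EFinP.
  under eq_integral do rewrite /= ger0_norm ?expR_ge0//.
  by rewrite (le_lt_trans eH)// ltry.
have eHr : \int[P]_x expR (H x) <= expR L.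
  by rewrite -lee_fin /Rintegral fineK ?integrable_fin_num.
(* This rescaling gives [s * f] the mass [expR L], so that in the integrated Young inequality the
   exponential term cancels against [- s * F]. *)
pose s := expR L / F; have s0 : 0 < s by rewrite divr_gt0 ?expR_gt0.
have sF : s * F = expR L by rewrite /s divfK ?gt_eqF.
have lns : ln s = L - ln F by rewrite /s ln_div ?posrE ?expR_gt0// expRK.
have pt x : s * (f x * H x) <=
    s * (f x * ln (f x)) + s * (ln s - 1) * f x + expR (H x).
  have /andP[fx0 _] := fM x.
  have := young_entropy (H x) (mulr_ge0 fx0 (ltW s0)).
  have -> : f x * s * ln (f x * s) = s * (f x * ln (f x)) + s * ln s * f x.
    move: fx0; rewrite le_eqVlt => /predU1P[<-|fx0]; first by rewrite !(mul0r, mulr0, addr0).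
    by rewrite lnM ?posrE//; ring.
  by lra.
have := @le_Rintegral _ _ _ P setT (fun x => s * (f x * H x)) (fun x =>
    s * (f x * ln (f x)) + s * (ln s - 1) * f x + expR (H x)) measurableT
  (integrable_rscale s ifH)
  (integrable_radd (integrable_radd (integrable_rscale s iln)
    (integrable_rscale (s * (ln s - 1)) if_)) ieH) (fun x _ => pt x).
rewrite RintegralD//; last first.
  by apply: integrable_radd; exact: integrable_rscale.
rewrite RintegralD//; [|exact: integrable_rscale|exact: integrable_rscale].
rewrite !RintegralZl// -/F.
set A := \int[P]_x (f x * H x); set B := \int[P]_x (f x * ln _).
set C := \int[P]_x expR (H x) in eHr *; move=> K.
rewrite -(ler_pM2l s0).
have -> : s * (B - F * ln F + F * L) = s * B + s * (ln s - 1) * F + s * F.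
  by rewrite lns; ring.
by rewrite sF (le_trans K)// lerD2l.
Qed.

End exponential_moments.

Section entropy_bound.
Context {R : realType} {d : nat} (mu : probability (borel R d) R).
Variables (v : 'cV[R]_d -> 'cV[R]_d) (c : R).
Hypothesis c0 : 0 < c.
Hypothesis iv : forall i, mu.-integrable setT (fun x => (v x i 0)%:E).
Hypothesis dom : forall g : borel R d -> R,
  measurable_fun setT g -> (forall x, 0 <= g x <= 1) ->
  enorm (vmean mu (fun x => g x *: v x)) <= c * isop (mean mu g).

Let W u x := dotp u (v x).

Let iW u : mu.-integrable setT (EFin \o W u).
Proof. exact: integrable_dotp. Qed.

Let mW u : measurable_fun setT (W u : borel R d -> R).
Proof. by apply/measurable_EFinP; case/integrableP: (iW u). Qed.

Lemma stop_loss_domination u (a : R) : enorm u = 1 ->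
  \int[mu]_x (Num.max (W u x - a) 0) <= c * normal_stop_loss (a / c).
Proof.
(* The indicator of this set turns the pointwise inequality behind [bathtub] into an equality. *)
move=> u1; pose A : set (borel R d) := [set x | a < W u x].
have mA : measurable A.
  rewrite -[X in measurable X]setTI.
  exact: (measurable_fun_ltr (measurable_cst a) (mW u)).
have m1 : measurable_fun setT (\1_A : borel R d -> R) by exact: measurable_indic.
have u01 (x : borel R d) : 0 <= (\1_A x : R) <= 1 by rewrite indicE; case: (_ \in _); rewrite lexx ler01.
have [i1 p01] := mean_unit_interval mu m1 u01.
have ci0 : 0 <= c * isop (mean mu (\1_A)) by rewrite mulr_ge0 ?isop_ge0// ltW.
have := dom m1 u01; move=> /(enorm_leP _ ci0).1/(_ u u1).
rewrite (dotp_vmean_scale iv)// => /(le_isopP _ c0 p01).1/(_ (a / c)).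
have i1W : mu.-integrable setT (EFin \o (fun x => \1_A x * W u x)).
  apply: (integrable_prod m1 (M := 1) _ (iW u)) => x.
  by have /andP[g0 g1] := u01 x; rewrite ger0_norm.
rewrite mulrDr mulrA [c * (a / c)]mulrC divfK ?gt_eqF// -lerBlDr.
apply: le_trans; rewrite /mean -RintegralZl// -RintegralB//; last exact: integrable_rscale.
rewrite le_eqVlt; apply/orP; left; apply/eqP; apply: eq_Rintegral => x _.
rewrite indicE; have [aW|Wa] := ltP a (W u x).
  by rewrite mem_set// mul1r mulr1 (max_idPl _)// subr_ge0 ltW.
rewrite memNset/=; last by apply/negP; rewrite -leNgt.
by rewrite mul0r mulr0 subrr (max_idPr _)// subr_le0.
Qed.

Lemma subgaussian_domination u (k : R) : enorm u = 1 -> 0 <= k ->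
  (\int[mu]_x (expR (k * W u x))%:E <= (expR (k ^+ 2 * c ^+ 2 / 2))%:E)%E.
Proof.
move=> u1; rewrite le_eqVlt => /predU1P[<-|k0].
  under eq_integral do rewrite mul0r expR0.
  by rewrite expr0n/= !mul0r expR0 integral_cst// [X in (_ * X)%E]probability_setT mule1.
rewrite -exprMn; apply: subgaussian_of_stop_loss; first by rewrite mulr_gt0.
  exact: measurable_funM.
move=> a; have kN0 : k != 0 by rewrite gt_eqF.
have E x : Num.max (k * W u x - a) 0 = k * Num.max (W u x - a / k) 0.
  by rewrite maxr_pMr ?ltW// mulr0 mulrBr mulrCA divff// mulr1.
have := stop_loss_domination (a / k) u1; rewrite -(ler_pM2l k0).
have iM : mu.-integrable setT (EFin \o (fun x => Num.max (W u x - a / k) 0)).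
  exact: integrable_pos.
have iM' : mu.-integrable setT (EFin \o (fun x => Num.max (k * W u x - a) 0)).
  by under [X in _ \o X]eq_fun do rewrite E; exact: integrable_rscale.
rewrite -RintegralZl//; under eq_Rintegral do rewrite -E.
rewrite -lee_fin /Rintegral fineK ?integrable_fin_num// => H; apply: le_trans H _.
by rewrite lee_fin mulrA invfM mulrCA mulrA [a * k^-1]mulrC -mulrA.
Qed.

Lemma entropy_domination f : test_function f -> (forall x, 0 <= f x) ->
  enorm (vmean mu (fun x => f x *: v x)) ^+ 2 <= 2 * c ^+ 2 * Ent mu f * mean mu f.
Proof.
move=> tf f0; have [M0 [M00 HM0]] := test_function_bounded tf.
pose M := M0 + 1; have M1 : 0 < M by rewrite ltr_wpDl.
have fM x : f x <= M by rewrite (le_trans (ler_norm _))// (le_trans (HM0 x))// lerDl.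
have mf := test_function_measurable tf.
have if_ : mu.-integrable setT (EFin \o f).
  by apply: (@integrable_bounded _ _ _ mu f M) => // x; rewrite ger0_norm.
have ifv i : mu.-integrable setT (fun x => ((f x *: v x) i 0)%:E).
  under eq_fun do rewrite mxE.
  by apply: (integrable_prod mf (M := M) _ (iv i)) => x; rewrite ger0_norm.
set Y := vmean _ _; set F := mean mu f; set X := enorm Y.
have F0 : 0 <= F by apply: Rintegral_ge0.
have fM' x : 0 <= f x <= M by rewrite f0 fM.
(* If [f] has mean zero there is no normalized density; the linear bound applied to [f / M] forces
   the vector to vanish, as [isop 0 = 0]. *)
have [F_eq0|FN0] := eqVneq F 0.
  have mg : measurable_fun setT (fun x : borel R d => M^-1 * f x) by exact: measurable_funM.
  have g01 x : 0 <= M^-1 * f x <= 1.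
    by rewrite mulr_ge0 ?invr_ge0 ?(ltW M1)//= ler_pdivrMl// mulr1.
  have mE : mean mu (fun x => M^-1 * f x) = 0.
    by rewrite /mean RintegralZl// -/(mean mu f) -/F F_eq0 mulr0.
  have := dom mg g01; rewrite mE (proj1 isop01) mulr0.
  have -> : vmean mu (fun x => (M^-1 * f x) *: v x) = M^-1 *: Y.
    apply/colP => i; rewrite !mxE /mean -RintegralZl//; last exact: ifv.
    by apply: eq_Rintegral => x _; rewrite !mxE mulrA.
  rewrite enormZ pmulr_rle0 ?normr_gt0 ?invr_neq0 ?gt_eqF// => X0.
  have -> : X = 0 by apply/eqP; rewrite eq_le X0 enorm_ge0.
  by rewrite ?F_eq0 mulr0 expr0n.
have {}F0 : 0 < F by rewrite lt0r FN0.
(* There is no direction to choose; what remains is that entropy is nonnegative, which is the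
   duality with [H = 0] and [L = 0]. *)
have [Y0|Y0] := eqVneq Y 0.
  have := @entropy_duality _ _ _ mu f (cst 0) M 0 mf fM' F0 (integrable_cst_fin mu 0).
  under eq_integral do rewrite expR0.
  rewrite expR0 integral_cst// [X in (_ * X)%E]probability_setT mule1 => /(_ (lexx _)).
  under eq_Rintegral do rewrite mulr0.
  rewrite Rintegral_cst// mul0r mulr0 addr0 -/(Ent mu f) => E0.
  by rewrite /X Y0 enorm0 expr0n/= mulr_ge0 ?(ltW F0)// mulr_ge0// mulr_ge0// sqr_ge0.
have [u [u1 Yu]] := unit_direction Y0.
have XE : X = \int[mu]_x (f x * W u x).
  have -> : X = dotp u Y by rewrite [in RHS]Yu dotpZr -enorm_sqr u1 expr1n mulr1.
  rewrite (dotp_vmean u ifv).2; apply: eq_Rintegral => x _; exact: dotpZr.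
have X0 : 0 <= X by exact: enorm_ge0.
(* The maximizer of [k * X - k^2 * c^2 * F / 2], the lower bound for the entropy obtained from the
   direction [u]. *)
pose k := X / (c ^+ 2 * F).
have c2F : 0 < c ^+ 2 * F by rewrite mulr_gt0// exprn_gt0.
have k0 : 0 <= k by rewrite divr_ge0// ltW.
have := entropy_duality mf fM' F0 (integrable_rscale k (iW u)) (subgaussian_domination u1 k0).
have nf x : `|f x| <= M by rewrite ger0_norm.
under eq_Rintegral do rewrite mulrCA.
rewrite RintegralZl//; last exact: (integrable_prod mf nf (iW u)).
rewrite -XE -/(mean mu f) -/F -/(Ent mu f) => H.
have kE : k * (c ^+ 2 * F) = X by rewrite /k divfK ?gt_eqF.
have H2 : X ^+ 2 / (c ^+ 2 * F) <= Ent mu f + X ^+ 2 / (c ^+ 2 * F) / 2.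
  have -> : X ^+ 2 / (c ^+ 2 * F) = k * X by rewrite /k expr2 mulrAC.
  rewrite (le_trans H)// lerD2l -kE le_eqVlt; apply/orP; left; apply/eqP; by field.
have : X ^+ 2 / (c ^+ 2 * F) <= 2 * Ent mu f by lra.
by rewrite ler_pdivrMr// => /le_trans; apply; rewrite le_eqVlt; apply/orP; left; apply/eqP; ring.
Qed.

End entropy_bound.

(** * Flows of Lipschitz fields *)

Section real_antiderivatives.
Context {R : realType}.
Notation leb := (@lebesgue_measure R).

Lemma near_norm_lt (t B : R) : `|t| < B -> \forall s \near t, `|s| < B.
Proof.
move=> tB; exists (B - `|t|) => /=; first by rewrite subr_gt0.
move=> s /=; rewrite ltrBrDl distrC; apply: le_lt_trans.
by rewrite -{1}(subrK t s) addrC ler_normD.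
Qed.

(** The integral over a ray needs integrability, so [f] is first truncated to [[-n, n]]. The
    primitives normalized at 0 agree where both truncations are inactive, and are glued with an
    index that depends on [t]. *)
Lemma exists_antiderivative (f : R -> R) : continuous f ->
  exists F : R -> R, F 0 = 0 /\ forall t : R, is_derive t 1 F (f t).
Proof.
move=> cf.
pose fN (n : nat) : R -> R := f \_ `[(- n%:R), n%:R].
have iN n : leb.-integrable setT (EFin \o fN n).
  have : leb.-integrable `[(- n%:R), n%:R] (EFin \o f).
    apply: continuous_compact_integrable; first exact: segment_compact.
    exact: continuous_subspaceT.
  by rewrite /fN -restrict_EFin => H; exact: (integrable_mkcond _ _).1 H.
pose G n t := \int[leb]_(z in `]-oo, t]) fN n z.
pose F n t := G n t - G n 0.
have DF n (t : R) : `|t| < n%:R -> is_derive t 1 (F n) (f t).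
  move=> tn; rewrite -[f t]subr0; apply: is_deriveB.
  have tin : t \in `[(- n%:R), n%:R] by rewrite in_itv/= -ler_norml ltW.
  have -> : f t = fN n t by rewrite /fN patchE mem_set.
  apply: is_derive_integral_rays => //.
  have : {for t, continuous f} by exact: cf.
  have ft : fN n t = f t by rewrite /fN patchE mem_set.
  move=> cft; rewrite /prop_for /continuous_at ft.
  apply: cvg_trans cft; apply: near_eq_cvg; near=> z.
  rewrite /fN patchE mem_set//= in_itv/= -ler_norml ltW//.
  by near: z; exact: near_norm_lt.
have FE n m t : `|t| < n%:R -> (n <= m)%N -> F n t = F m t.
  move=> tn nm.
  have DD (s : R) : `|s| < n%:R -> is_derive s 1 (fun s => F n s - F m s) 0.
    move=> sn; rewrite -[X in is_derive _ _ _ X](subrr (f s)); apply: is_deriveB; apply: DF => //.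
    by rewrite (lt_le_trans sn)// ler_nat.
  have F0 k : F k 0 = 0 by rewrite /F subrr.
  apply/eqP; rewrite -subr_eq0; apply/eqP.
  have [t0|t0] := leP 0 t.
    have [s st|c _] := @is_derive_MVT _ (fun s => F n s - F m s) (fun=> 0) 0 t t0.
      apply: DD; case/andP: st => s0 st.
      by rewrite ger0_norm// (le_lt_trans st)// (le_lt_trans _ tn)// ler_norm.
    by rewrite !F0 subrr subr0 mul0r.
  have [s st|c _] := @is_derive_MVT _ (fun s => F n s - F m s) (fun=> 0) t 0 (ltW t0).
    apply: DD; case/andP: st => st s0.
    rewrite ler0_norm// (le_lt_trans _ tn)// ler0_norm ?lerN2//; exact: ltW.
  by rewrite !F0 subrr sub0r mul0r => /eqP; rewrite oppr_eq0 => /eqP.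
pose N (t : R) := Num.bound `|t|.
have NP t : `|t| < (N t)%:R by apply: archi_boundP.
exists (fun t => F (N t) t); split; first by rewrite /F subrr.
(* An index that works on a whole neighbourhood of [t], since the index of the glued function varies
   with its argument. *)
move=> t; pose m := N (`|t| + 1).
have tm : `|t| + 1 < m%:R by rewrite (le_lt_trans _ (NP _))// ler_norm.
have tm' : `|t| < m%:R by rewrite (lt_trans _ tm)// ltrDl.
apply: near_eq_is_derive (DF m t tm'); near=> s.
have sm : `|s| < m%:R.
  by near: s; exact: near_norm_lt.
have [le|le] := leqP (N s) m; first by rewrite (FE _ _ _ (NP s) le).
by rewrite (FE _ _ _ sm (ltnW le)).
Unshelve. all: end_near. Qed.

Lemma is_derive_opp_arg (u : R -> R) (u' t : R) : is_derive (- t) 1 u u' ->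
  is_derive t 1 (fun s => u (- s)) (- u').
Proof.
move=> D; rewrite -mulrN1.
by apply: (@is_derive1_comp _ u (@GRing.opp R)).
Qed.

Lemma exp_growth_bound (u u' : R -> R) (A k : R) : 0 <= A -> 0 < k -> u 0 = 0 ->
  (forall t : R, is_derive t 1 u (u' t)) ->
  (forall t, `|u' t| <= A * expR (k * `|t|)) ->
  forall t, `|u t| <= A / k * expR (k * `|t|).
Proof.
move=> A0 k0 u0 Du bu t.
wlog t0 : u u' u0 Du bu t / 0 <= t => [H|].
  have [t0|t0] := leP 0 t; first exact: (H u u').
  have := H (fun s => u (- s)) (fun s => - u' (- s)) _ _ _ (- t) _.
  rewrite /= opprK normrN; apply.
  - by rewrite oppr0.
  - by move=> s; exact: is_derive_opp_arg.
  - by move=> s; rewrite normrN -[`|s|]normrN; exact: bu.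
  - by rewrite oppr_ge0 ltW.
have De (s : R) : is_derive s 1 (fun s => A / k * expR (k * s)) (A * expR (k * s)).
  apply: is_derive_eq; rewrite /GRing.scale /=; field; exact: lt0r_neq0.
have Ak : 0 <= A / k by rewrite divr_ge0// ltW.
rewrite (ger0_norm t0) ler_norml; apply/andP; split.
  have := @is_derive_ndecr _ (fun s => A / k * expR (k * s) + u s)
    (fun s => A * expR (k * s) + u' s) 0 t t0 (fun s _ => is_deriveD (De s) (Du s)).
  rewrite u0 addr0 mulr0 expR0 mulr1 => H; rewrite -subr_ge0 opprK addrC.
  apply: le_trans Ak (H _) => s /andP[s0 _].
  have := bu s; rewrite (ger0_norm s0) ler_norml => /andP[? _]; lra.
have := @is_derive_ndecr _ (fun s => A / k * expR (k * s) - u s)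
  (fun s => A * expR (k * s) - u' s) 0 t t0 (fun s _ => is_deriveB (De s) (Du s)).
rewrite u0 subr0 mulr0 expR0 mulr1 => H; rewrite -subr_ge0.
apply: le_trans Ak (H _) => s /andP[s0 _].
by have := bu s; rewrite (ger0_norm s0) ler_norml => /andP[_ ?]; lra.
Qed.

(** For nonnegative times [q] divided by the exponential is nonincreasing; negative times follow by
    time reversal. *)
Lemma gronwall (q q' : R -> R) (k : R) :
  (forall t : R, is_derive t 1 q (q' t)) -> (forall t, `|q' t| <= k * q t) ->
  forall t, q t <= q 0 * expR (k * `|t|).
Proof.
move=> Dq bq t.
wlog t0 : q q' Dq bq t / 0 <= t => [H|].
  have [t0|t0] := leP 0 t; first exact: (H q q').
  have := H (fun s => q (- s)) (fun s => - q' (- s)) _ _ (- t) _.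
  rewrite /= opprK oppr0 normrN; apply.
  - by move=> s; exact: is_derive_opp_arg.
  - by move=> s; rewrite normrN.
  - by rewrite oppr_ge0 ltW.
rewrite (ger0_norm t0) -ler_pdivrMr ?expR_gt0// -expRN.
have D (s : R) : is_derive s 1 (fun s => q s * expR (- (k * s)))
    ((q' s - k * q s) * expR (- (k * s))).
  have Ds := Dq s.
  by apply: is_derive_eq; rewrite /GRing.scale /=; ring.
have := is_derive_nincr t0 (fun s _ => D s).
rewrite mulr0 oppr0 expR0 mulr1; apply => s _.
rewrite mulr_le0_ge0 ?expR_ge0// subr_le0.
by rewrite (le_trans _ (bq s))// ler_norm.
Qed.

Lemma half_cauchy (a : nat -> R) (C : R) :
  (forall n, `|a n.+1 - a n| <= C * 2^-1 ^+ n) ->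
  exists l, forall n, `|a n - l| <= 2 * C * 2^-1 ^+ n.
Proof.
move=> H; have C0 : 0 <= C by have := H 0%N; rewrite expr0 mulr1; exact: le_trans.
(* The radius [2 * C * 2^-n] is the tail of the geometric series, so these intervals are nested; the
   limit is the supremum of their lower ends. *)
pose lo n := a n - 2 * C * 2^-1 ^+ n; pose hi n := a n + 2 * C * 2^-1 ^+ n.
have p n : 0 <= C * 2^-1 ^+ n :> R by rewrite mulr_ge0// exprn_ge0.
have lo_nd n m : (n <= m)%N -> lo n <= lo m.
  elim: m => [|m IH]; first by rewrite leqn0 => /eqP ->.
  rewrite leq_eqVlt => /predU1P[->//|nm]; apply: le_trans (IH nm) _.
  have := H m; rewrite ler_norml /lo exprS => /andP[? ?].
  by have := p m; lra.
have hi_ni n m : (n <= m)%N -> hi m <= hi n.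
  elim: m => [|m IH]; first by rewrite leqn0 => /eqP ->.
  rewrite leq_eqVlt => /predU1P[->//|nm]; apply: le_trans _ (IH nm).
  have := H m; rewrite ler_norml /hi exprS => /andP[? ?].
  by have := p m; lra.
have lohi n : lo n <= hi n.
  by rewrite /lo /hi; have := p n; lra.
have ub m : ubound (range lo) (hi m).
  move=> _ [n _ <-]; have [nm|mn] := leqP n m.
    exact: le_trans (lo_nd _ _ nm) (lohi m).
  exact: le_trans (lohi n) (hi_ni _ _ (ltnW mn)).
exists (sup (range lo)) => n; rewrite ler_norml.
have h1 : lo n <= sup (range lo) by apply: ub_le_sup; [exists (hi 0%N)|exists n].
have h2 : sup (range lo) <= hi n by apply: ge_sup; [exists (lo 0%N), 0%N|exact: ub].
by move: h1 h2; rewrite /lo /hi; lra.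
Qed.

Lemma half_small (C e : R) : 0 < e -> exists n, C * 2^-1 ^+ n <= e.
Proof.
move=> e0; have : C * 2^-1 ^+ n @[n --> \oo] --> (C * 0 : R).
  apply: cvgMr; apply: cvg_expr.
  by rewrite ger0_norm ?invr_ge0// invf_lt1// ltr1n.
rewrite mulr0 => /cvgrPdist_le/(_ _ e0)[n _ /(_ n (leqnn n))].
by rewrite sub0r normrN => H; exists n; rewrite (le_trans (ler_norm _)).
Qed.

End real_antiderivatives.

Section lipschitz_flows.
Context {R : realType} {d : nat}.
Variables (V : 'cV[R]_d -> 'cV[R]_d) (L : R).
Hypothesis L0 : 0 < L.
Hypothesis VL : forall x y, `|V x - V y| <= L * `|x - y|.
Implicit Types (x y : 'cV[R]_d) (X Y : R -> 'cV[R]_d).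

Lemma is_derive_cVP X (t : R) (l : 'cV[R]_d) :
  is_derive t 1 X l <-> forall i, is_derive t 1 (fun s => X s i 0) (l i 0).
Proof.
split=> [/is_derive_epsP H i|H]; apply/is_derive_epsP => e e0.
  have [r r0 Hr] := H e e0; exists r => // s sr.
  apply: le_trans (Hr s sr); apply: le_trans (norm_coord_le _ i).
  by rewrite !mxE.
have /choice[r Hr] i : exists r : R, 0 < r /\ forall s : R, `|s| < r ->
    `|X (t + s *: 1) i 0 - X t i 0 - s *: l i 0| <= e * `|s|.
  by have /is_derive_epsP/(_ e e0)[r r0 Hr] := H i; exists r.
exists (\big[Order.min/(1 : R)]_i r i).
  by apply/bigmin_gtP; split => // i _; have [] := Hr i.
move=> s sr; apply: norm_cV_le; first by rewrite mulr_ge0// ltW.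
move=> i; rewrite !mxE; have [_] := Hr i; apply.
by rewrite (lt_le_trans sr)//; exact: bigmin_le_cond.
Qed.

Definition solution X := forall t : R, is_derive t 1 X (V (X t)).

Lemma path_continuous X l (t : R) : is_derive t 1 X l -> {for t, continuous X}.
Proof.
by move=> [dX _]; apply/differentiable_continuous/derivable1_diffP.
Qed.

Lemma lipschitz_field_continuous : continuous V.
Proof. exact: lipschitz_fun_continuous (ltW L0) VL. Qed.

Let antiderivative (f : R -> R) : R -> R :=
  xget (fun=> 0) [set F : R -> R | F 0 = 0 /\ forall t : R, is_derive t 1 F (f t)].

Let antiderivativeP f : continuous f -> antiderivative f 0 = 0 /\
  forall t : R, is_derive t 1 (antiderivative f) (f t).
Proof. by move=> cf; exact: (xgetPex _ (exists_antiderivative cf)). Qed.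

Let picard_step x X : R -> 'cV[R]_d :=
  fun t => \col_i (x i 0 + antiderivative (fun s => V (X s) i 0) t).

Let picard_stepP x X : continuous X -> picard_step x X 0 = x /\
  forall t : R, is_derive t 1 (picard_step x X) (V (X t)).
Proof.
move=> cX; have c i : continuous (fun s => V (X s) i 0).
  move=> s; apply: (cvg_comp (fun s => V (X s)) (fun y : 'cV[R]_d => y i 0)); last exact: coord_continuous.
  by apply: (cvg_comp X V); [exact: cX|exact: lipschitz_field_continuous].
split; first by apply/colP => i; rewrite mxE (antiderivativeP (c i)).1 addr0.
move=> t; apply/is_derive_cVP => i.
under eq_fun do rewrite mxE.
have D := (antiderivativeP (c i)).2 t.
by rewrite -[V (X t) i 0]add0r; exact: is_deriveD (is_derive_cst _ _ _) D.
Qed.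

Let cX_of X Y : (forall t : R, is_derive t 1 X (Y t)) -> continuous X.
Proof. by move=> H t; exact: path_continuous (H t). Qed.

(** With the weight [exp(-2 L |t|)], due to Bielecki, the Picard map contracts by [L / (2 L) = 1/2]
    on the whole line, which gives global solutions without gluing local ones. *)
Let growth X Y X' Y' (A : R) : 0 <= A -> X 0 = Y 0 ->
  (forall t : R, is_derive t 1 X (X' t)) -> (forall t : R, is_derive t 1 Y (Y' t)) ->
  (forall t, `|X' t - Y' t| <= A * expR (2 * L * `|t|)) ->
  forall t, `|X t - Y t| <= A / (2 * L) * expR (2 * L * `|t|).
Proof.
move=> A0 XY DX DY H t; have L20 : 0 < 2 * L by rewrite mulr_gt0.
apply: norm_cV_le => [|i].
  by rewrite mulr_ge0 ?expR_ge0// divr_ge0// ltW.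
rewrite !mxE.
apply: (@exp_growth_bound _ (fun t => X t i 0 - Y t i 0) (fun t => X' t i 0 - Y' t i 0)) => //.
- by rewrite XY subrr.
- by move=> s; apply: is_deriveB; [exact: (is_derive_cVP _ _ _).1|exact: (is_derive_cVP _ _ _).1].
- by move=> s; apply: le_trans (H s); apply: le_trans (norm_coord_le _ i); rewrite !mxE.
Qed.

Lemma solution_exists x : exists X, X 0 = x /\ solution X.
Proof.
have L20 : 0 < 2 * L by rewrite mulr_gt0.
pose P n := iter n (picard_step x) (fun=> x).
have cP n : continuous (P n).
  elim: n => [|n IH]; first by move=> t; exact: cvg_cst.
  exact: cX_of (picard_stepP x IH).2.
have P0 n : P n 0 = x by case: n => // n; exact: (picard_stepP x (cP n)).1.
have DP n (t : R) : is_derive t 1 (P n.+1) (V (P n t)) by exact: (picard_stepP x (cP n)).2.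
pose M := `|V x| / (2 * L).
have M0 : 0 <= M by rewrite divr_ge0// ltW.
have step n t : `|P n.+1 t - P n t| <= M * 2^-1 ^+ n * expR (2 * L * `|t|).
  elim: n t => [|n IH] t.
    rewrite expr0 mulr1; apply: (@growth (P 1%N) (P 0%N) (fun=> V x) (fun=> 0)) => //.
    - by move=> s; rewrite subr0 ler_peMr// (le_trans _ (expR_ge1Dx _))// lerDl mulr_ge0// ltW.
  have -> : M * 2^-1 ^+ n.+1 = (L * (M * 2^-1 ^+ n)) / (2 * L).
    by rewrite exprS; field; rewrite gt_eqF.
  apply: (@growth (P n.+2) (P n.+1) (fun t => V (P n.+1 t)) (fun t => V (P n t))) => //.
  - by rewrite mulr_ge0 ?(ltW L0)// mulr_ge0// exprn_ge0.
  - by rewrite !P0.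
  - by move=> s; apply: le_trans (VL _ _) _; rewrite -mulrA ler_pM2l.
have /choice[X0 HX0] t : exists l : 'cV[R]_d, forall n,
    `|P n t - l| <= 2 * (M * expR (2 * L * `|t|)) * 2^-1 ^+ n.
  have /choice[l Hl] i : exists l, forall n,
      `|P n t i 0 - l| <= 2 * (M * expR (2 * L * `|t|)) * 2^-1 ^+ n.
    apply: half_cauchy => n; rewrite mulrAC.
    by apply: le_trans (step n t); apply: le_trans (norm_coord_le _ i); rewrite !mxE.
  exists (\col_i l i) => n; apply: norm_cV_le => [|i]; last by rewrite !mxE.
  by rewrite mulr_ge0 ?exprn_ge0// mulr_ge0// mulr_ge0// expR_ge0.
(* The convergence is uniform on bounded time intervals, so the limit is continuous and the Picard
   map can be applied to it. *)
have cX0 : continuous X0.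
  move=> t; apply/cvgrPdist_le => e e0.
  have e30 : 0 < e / 3 by rewrite divr_gt0.
  have [n Hn] := half_small (2 * (M * expR (2 * L * (`|t| + 1)))) e30.
  have un s : `|s| <= `|t| + 1 -> `|P n s - X0 s| <= e / 3.
    move=> st; apply: le_trans (HX0 s n) _; apply: le_trans Hn.
    rewrite ler_wpM2r ?exprn_ge0// ler_wpM2l// ler_wpM2l// ler_expR.
    by rewrite ler_pM2l.
  near=> s.
  have H1 : `|P n t - P n s| <= e / 3.
    by near: s; apply: cvgr_dist_le => //; exact: cP.
  have st : `|s| <= `|t| + 1.
    by apply: ltW; near: s; apply: near_norm_lt; rewrite ltrDl.
  have -> : e = e / 3 + e / 3 + e / 3 by field.
  have -> : X0 t - X0 s = (X0 t - P n t) + (P n t - P n s) + (P n s - X0 s).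
    by rewrite !subrKA.
  rewrite (le_trans (ler_normD _ _))// lerD//; last exact: un.
  rewrite (le_trans (ler_normD _ _))// lerD// distrC.
  by apply: un; rewrite lerDl.
have [Y0 DY] := picard_stepP x cX0.
suff E : X0 = picard_step x X0.
  by exists X0; split; [rewrite E|move=> t; rewrite {1}E].
apply/funext => t; apply/eqP; rewrite -subr_eq0 -normr_le0.
apply/ler_addgt0Pr => e e0; rewrite add0r.
have e20 : 0 < e / 2 by rewrite divr_gt0.
have [n Hn] := half_small (2 * (M * expR (2 * L * `|t|))) e20.
have H1 : `|P n.+1 t - X0 t| <= e / 2.
  apply: le_trans (HX0 t n.+1) (le_trans _ Hn).
  rewrite ler_wpM2l ?exprS ?ler_piMl ?exprn_ge0//; last by rewrite invf_le1// ler1n.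
  by rewrite mulr_ge0// mulr_ge0// expR_ge0.
have H2 : `|P n.+1 t - picard_step x X0 t| <= e / 2.
  apply: le_trans _ Hn.
  have -> : 2 * (M * expR (2 * L * `|t|)) * 2^-1 ^+ n =
      (L * (2 * M * 2^-1 ^+ n)) / (2 * L) * expR (2 * L * `|t|) * 2.
    by field; rewrite gt_eqF.
  apply: (@le_trans _ _ ((L * (2 * M * 2^-1 ^+ n)) / (2 * L) * expR (2 * L * `|t|))); last first.
    rewrite ler_peMr ?ler1n// mulr_ge0 ?expR_ge0// divr_ge0 ?(ltW L20)// mulr_ge0 ?(ltW L0)//.
    by rewrite mulr_ge0 ?exprn_ge0// mulr_ge0.
  apply: (@growth (P n.+1) _ (fun t => V (P n t)) (fun t => V (X0 t))) => //.
  - by rewrite mulr_ge0 ?(ltW L0)// mulr_ge0 ?exprn_ge0// mulr_ge0.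
  - by rewrite Y0 P0.
  - move=> s; apply: le_trans (VL _ _) _; rewrite -[leRHS]mulrA ler_pM2l//.
    apply: le_trans (HX0 s n) _; rewrite le_eqVlt; apply/orP; left; apply/eqP; ring.
rewrite (splitr e) (_ : X0 t - _ = - (P n.+1 t - X0 t) + (P n.+1 t - picard_step x X0 t)).
  by rewrite (le_trans (ler_normD _ _))// normrN lerD.
by rewrite opprB addrA subrK.
Unshelve. all: end_near. Qed.

(** The constant left by Gronwall for the sum of squares, used because the sup norm is not
    differentiable. The rate collects [d] coordinates, comparing norms costs a factor below [d + 1],
    and this factor stays positive when [d = 0]. *)
Definition flow_lipschitz (t : R) : R := (d%:R + 1) * expR (d%:R * L * `|t|).

Lemma solution_lipschitz X Y (t : R) : solution X -> solution Y ->
  `|X t - Y t| <= flow_lipschitz t * `|X 0 - Y 0|.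
Proof.
move=> sX sY; pose Z s := X s - Y s.
pose q s := \sum_i Z s i 0 ^+ 2.
pose q' s := \sum_i (2 * Z s i 0 * (V (X s) - V (Y s)) i 0).
have DZ (s : R) i : is_derive s 1 (fun s => Z s i 0) ((V (X s) - V (Y s)) i 0).
  by apply: (is_derive_cVP _ _ _).1; apply: is_deriveB; [exact: sX|exact: sY].
have Dq (s : R) : is_derive s 1 q (q' s).
  have -> : q = \sum_i (fun s => Z s i 0 ^+ 2).
    by apply/funext => r; rewrite fct_sumE.
  apply: is_derive_sum => i.
  have Di := DZ s i; apply: is_derive_eq.
  by rewrite /GRing.scale /=; ring.
have Zq s i : Z s i 0 ^+ 2 <= q s.
  by rewrite /q (bigD1 i)//= lerDl; apply: sumr_ge0 => j _; rewrite sqr_ge0.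
have q0 s : 0 <= q s by apply: sumr_ge0 => i _; rewrite sqr_ge0.
have nZq s : `|Z s| ^+ 2 <= q s.
  rewrite -[leRHS]sqr_sqrtr ?q0// ler_sqr ?nnegrE ?sqrtr_ge0//.
  apply: norm_cV_le; first exact: sqrtr_ge0.
  by move=> i; rewrite -ler_sqr ?nnegrE ?sqrtr_ge0// sqr_sqrtr// real_normK ?num_real.
have bq s : `|q' s| <= 2 * (d%:R * L) * q s.
  apply: le_trans (ler_norm_sum _ _ _) _.
  apply: (@le_trans _ _ (\sum_(i < d) (2 * L * q s))); last first.
    rewrite sumr_const card_ord -mulr_natl le_eqVlt; apply/orP; left; apply/eqP; ring.
  apply: ler_sum => i _; rewrite normrM normrM (ger0_norm (ler0n _ 2)) -!mulrA ler_pM2l//.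
  apply: (@le_trans _ _ (`|Z s| * (L * `|Z s|))).
    apply: ler_pM => //; first exact: norm_coord_le.
    by apply: le_trans (norm_coord_le _ i) (VL _ _).
  by rewrite mulrCA -expr2 ler_pM2l.
have := gronwall Dq bq t.
have qd : q 0 <= d%:R * `|X 0 - Y 0| ^+ 2.
  apply: (@le_trans _ _ (\sum_(i < d) `|X 0 - Y 0| ^+ 2)).
    apply: ler_sum => i _; rewrite -real_normK ?num_real// ler_sqr ?nnegrE//.
    exact: norm_coord_le.
  by rewrite sumr_const card_ord mulr_natl.
move=> H; rewrite -ler_sqr ?nnegrE//; last first.
  by rewrite mulr_ge0// mulr_ge0 ?expR_ge0// addr_ge0.
apply: le_trans (nZq t) (le_trans H _).
rewrite /flow_lipschitz !exprMn -expRM_natl.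
apply: (@le_trans _ _ (d%:R * `|X 0 - Y 0| ^+ 2 * expR (2 * (d%:R * L) * `|t|))).
  by rewrite ler_wpM2r ?expR_ge0.
rewrite mulrAC [2 * (d%:R * L * _)]mulrA ler_wpM2r ?exprn_ge0// ler_wpM2r ?expR_ge0//.
have := ler0n R d; nra.
Qed.

Lemma solution_unique X Y : solution X -> solution Y -> X 0 = Y 0 -> X = Y.
Proof.
move=> sX sY XY; apply/funext => t; apply/eqP; rewrite -subr_eq0 -normr_le0.
by apply: le_trans (solution_lipschitz t sX sY) _; rewrite XY subrr normr0 mulr0.
Qed.

Lemma solution_shift X (s : R) : solution X -> solution (fun t => X (s + t)).
Proof.
move=> sX t; apply/is_derive_epsP => e e0.
have /is_derive_epsP/(_ e e0)[r r0 Hr] := sX (s + t).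
by exists r => // h hr; have := Hr h hr; rewrite addrA.
Qed.

End lipschitz_flows.

(** * Mollification by lattice sums *)

Section lattice_box.
Variables (d N : nat).

(** The integer points with coordinates between [-N] and [N], indexed by a finite type to obtain
    plain finite sums. *)
Definition lattice_box (f : {ffun 'I_d -> 'I_(N.*2.+1)}) : 'cV[int]_d :=
  \col_i ((f i)%:Z - N%:Z).

Lemma lattice_box_inj : injective lattice_box.
Proof.
move=> f g /colP fg; apply/ffunP => i; apply: val_inj.
have := fg i; rewrite !mxE => /addIr [] //.
Qed.

Lemma lattice_box_onto (k : 'cV[int]_d) : (forall i, `|k i 0| <= N%:Z) ->
  exists f, lattice_box f = k.
Proof.
move=> kN; have /choice[f Hf] i : exists a : 'I_(N.*2.+1), a%:Z = k i 0 + N%:Z.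
  have := kN i; rewrite ler_norml => /andP[k1 k2].
  have H : (`|(k i 0%R + N%:Z)%R|%N < N.*2.+1)%N.
    by move: (k i 0) k1 k2 => z; lia.
  by exists (Ordinal H) => /=; move: (k i 0) k1 k2 {H} => z; lia.
by exists (finfun f); apply/colP => i; rewrite !mxE ffunE Hf addrK.
Qed.

(** A sum over all of the lattice is invariant under translations by reindexing, which a sum over a
    box is not; the support condition transfers the invariance. *)
Lemma sum_lattice_box (R : realType) (F : 'cV[int]_d -> R) :
  (forall k, F k != 0 -> forall i, `|k i 0| <= N%:Z) ->
  \sum_f F (lattice_box f) = \sum_(k \in [set: 'cV[int]_d]) F k.
Proof.
move=> FN; rewrite (@fsbigE _ _ _ _ _ (map lattice_box (enum {ffun 'I_d -> 'I_(N.*2.+1)})))//.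
- rewrite big_map big_enum_cond; apply: eq_bigl => f.
  by rewrite in_setT.
- by rewrite map_inj_uniq ?enum_uniq//; exact: lattice_box_inj.
- move=> k _ kn; apply/eqP; apply: contraNT kn => /FN /lattice_box_onto[f <-].
  by rewrite map_f// mem_enum.
Qed.

Lemma sum_lattice_box_shift (R : realType) (F : 'cV[int]_d -> R) j :
  (forall k, F k != 0 -> forall i, `|k i 0| <= N%:Z) ->
  (forall k, F (k + j) != 0 -> forall i, `|k i 0| <= N%:Z) ->
  \sum_f F (lattice_box f + j) = \sum_f F (lattice_box f).
Proof.
move=> F1 F2; rewrite (sum_lattice_box F1) (@sum_lattice_box _ (fun k => F (k + j)))//.
apply/esym/(@reindex_fsbigT _ _ _ _ _ (fun k => k + j)).
by exists (fun k => k - j) => k; rewrite ?addrK ?subrK.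
Qed.

End lattice_box.

Section lattice_sums.
Context {R : realType} {d : nat}.
Variables (h : R) (N : nat).
Hypothesis h0 : 0 < h.
Implicit Types (F G : 'cV[R]_d -> R) (x y : 'cV[R]_d) (j k : 'cV[int]_d).

Definition lattice k : 'cV[R]_d := h *: map_mx intr k.

Lemma latticeD j k : lattice (j + k) = lattice j + lattice k.
Proof. by rewrite /lattice map_mxD scalerDr. Qed.

Lemma lattice_round x : exists j, `|x - lattice j| <= h.
Proof.
exists (\col_i Num.floor (x i 0 / h)); apply: norm_cV_le; first exact: ltW.
move=> i; rewrite !mxE; have /andP[] := mem_rg1_floor (x i 0 / h).
rewrite ler_pdivlMr// ltr_pdivrMr// mulrDl mul1r [_ * h]mulrC => H1 H2.
by rewrite ger0_norm ?subr_ge0// lerBlDl ltW.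
Qed.

Lemma lattice_box_bound k : `|lattice k| <= h * N%:R -> forall i, `|k i 0| <= N%:Z.
Proof.
move=> kN i; have := le_trans (norm_coord_le _ i) kN.
rewrite !mxE normrM (gtr0_norm h0) ler_pM2l// -intr_norm.
by rewrite -[N%:R]/(N%:Z%:~R) ler_int.
Qed.

Definition lattice_sum F : R := h ^+ d * \sum_f F (lattice (@lattice_box d N f)).

Lemma lattice_sumB F G :
  lattice_sum F - lattice_sum G = lattice_sum (fun y => F y - G y).
Proof. by rewrite /lattice_sum sumrB mulrBr. Qed.

Lemma lattice_sumZ (a : R) F : lattice_sum (fun y => a * F y) = a * lattice_sum F.
Proof. by rewrite /lattice_sum -mulr_sumr mulrCA. Qed.

Lemma ler_norm_lattice_sum F G : (forall y, `|F y| <= G y) ->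
  `|lattice_sum F| <= lattice_sum G.
Proof.
move=> FG; rewrite normrM ger0_norm ?exprn_ge0 ?(ltW h0)//.
rewrite ler_wpM2l ?exprn_ge0 ?(ltW h0)// (le_trans (ler_norm_sum _ _ _))//.
by apply: ler_sum => f _.
Qed.

Lemma lattice_sum_norm_le F (M : R) : (forall y, `|F y| <= M) ->
  `|lattice_sum F| <= (h * N.*2.+1%:R) ^+ d * M.
Proof.
move=> FM; apply: (le_trans (ler_norm_lattice_sum FM)).
by rewrite /lattice_sum sumr_const card_ffun !card_ord -[M *+ _]mulr_natl natrX mulrA exprMn.
Qed.

Lemma lattice_sum_shift F j : (forall y, F y != 0 -> `|y| <= h * N%:R) ->
  (forall y, F (y + lattice j) != 0 -> `|y| <= h * N%:R) ->
  lattice_sum (fun y => F (y + lattice j)) = lattice_sum F.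
Proof.
move=> F1 F2; congr (_ * _).
under eq_bigr do rewrite -latticeD.
apply: (@sum_lattice_box_shift _ _ _ (fun k => F (lattice k))) => k.
  by move/F1; exact: lattice_box_bound.
by rewrite latticeD => /F2; exact: lattice_box_bound.
Qed.

Lemma lattice_sum_lower F (p : nat) (a : R) : (p <= N)%N -> (forall y, 0 <= F y) ->
  (forall y, `|y| <= h * p%:R -> a <= F y) -> 0 <= a ->
  (h * p%:R) ^+ d * a <= lattice_sum F.
Proof.
move=> pN F0 Fa a0; rewrite exprMn -mulrA ler_wpM2l ?exprn_ge0 ?(ltW h0)//.
(* Only the [p^d] points with coordinates from 0 to [p - 1] are counted; [N] is the offset of the
   box indices. *)
have lt (b : 'I_p) : (b + N < N.*2.+1)%N by have := ltn_ord b; lia.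
pose e (g : {ffun 'I_d -> 'I_p}) : {ffun 'I_d -> 'I_(N.*2.+1)} := [ffun i => Ordinal (lt (g i))].
have e_inj : injective e.
  move=> g g' /ffunP E; apply/ffunP => i; apply: val_inj.
  have := E i; rewrite !ffunE => /(congr1 val) /= /eqP.
  by rewrite eqn_add2r => /eqP.
rewrite (bigID (mem (e @: [set: {ffun 'I_d -> 'I_p}]%SET)))/= ler_wpDr ?sumr_ge0//.
rewrite big_imset/=; last by move=> ? ? _ _; exact: e_inj.
apply: (@le_trans _ _ (\sum_(g in [set: {ffun 'I_d -> 'I_p}]%SET) a)).
  by rewrite sumr_const cardsT card_ffun !card_ord -[a *+ _]mulr_natl natrX.
apply: ler_sum => g _; apply: Fa; apply: norm_cV_le.
  by rewrite mulr_ge0 ?(ltW h0).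
move=> i; rewrite !mxE !ffunE/= PoszD addrK normrM (gtr0_norm h0) ler_pM2l//.
by rewrite ger0_norm ?ler0n// ler_nat ltnW.
Qed.

End lattice_sums.

Section test_function_tools.
Context {R : realType} {d : nat}.
Implicit Types (f g : 'cV[R]_d -> R) (x y v : 'cV[R]_d).
Local Notation e_ i := (delta_mx i 0 : 'cV[R]_d).

Lemma is_derive_big_sum (I : Type) (s : seq I) (F : I -> 'cV[R]_d -> R) (l : I -> R) x v :
  (forall i, is_derive x v (F i) (l i)) ->
  is_derive x v (fun x => \sum_(i <- s) F i x) (\sum_(i <- s) l i).
Proof.
move=> D; elim: s => [|i s IH].
  by rewrite big_nil; under eq_fun do rewrite big_nil; exact: is_derive_cst.
by rewrite big_cons; under eq_fun do rewrite big_cons; exact: is_deriveD.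
Qed.

Lemma is_derive_shift f x y v (l : R) : is_derive (x - y) v f l ->
  is_derive x v (fun x => f (x - y)) l.
Proof.
move=> /is_derive_epsP H; apply/is_derive_epsP => e /H[r r0 Hr].
by exists r => // s /Hr; rewrite (_ : x + s *: v - y = x - y + s *: v)// addrAC.
Qed.

Lemma smooth_shift f y : smooth f -> smooth (fun x => f (x - y)).
Proof.
move=> sf; apply: (@smooth_coind _ _ (fun g => exists f, smooth f /\ g = fun x => f (x - y))); last by exists f.
- move=> _ [{sf}f [sf ->]] x.
  apply: (@continuous_comp _ _ _ (fun x => x - y) f); last exact: (@smooth_continuous _ _ f sf).
  move=> s /nbhs_ballP[e e0 es]; apply/nbhs_ballP; exists e => // z xz; apply: es.
  by move: xz; rewrite -!ball_normE /= (_ : x - y - (z - y) = x - z)// opprB addrA subrK.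
- move=> _ [{sf}f [sf ->]] i x.
  have [//] := @is_derive_shift f x y (e_ i) _ (smooth_is_derive _ _ sf).
- move=> _ [{sf}f [sf ->]] i; exists (partial i f); split; first exact: smooth_partial.
  by apply: partial_is_derive => x; apply: is_derive_shift; exact: smooth_is_derive.
Qed.

Lemma dotp_norm_le x y : `|dotp x y| <= d%:R * (`|x| * `|y|).
Proof.
apply: le_trans (ler_norm_sum _ _ _) _.
apply: (@le_trans _ _ (\sum_(i < d) `|x| * `|y|)).
  by apply: ler_sum => i _; rewrite normrM ler_pM// norm_coord_le.
by rewrite sumr_const card_ord -[leLHS]mulr_natl.
Qed.

Lemma test_function_second_order f : test_function f -> exists C, 0 <= C /\
  forall x v, `|f (x + v) - f x - dotp (gradient f x) v| <= C * `|v| ^+ 2.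
Proof.
move=> tf; have /choice[C HC] i := test_function_lipschitz (test_function_partial i tf).
have C0 i : 0 <= C i by have [] := HC i.
pose C1 := \sum_i C i; have C10 : 0 <= C1 by exact: sumr_ge0.
exists (C1 * d%:R ^+ 2); split; first by rewrite mulr_ge0// exprn_ge0.
move=> x v; pose r := \sum_i `|v i 0|; have r0 : 0 <= r by exact: sumr_ge0.
have H i z : `|z - x| <= r -> `|partial i f z - partial i f x| <= C1 * r.
  move=> zx; have [_ /(_ z x) H] := HC i; apply: le_trans H _.
  rewrite ler_pM//; rewrite /C1 (bigD1 i)//= lerDl; exact: sumr_ge0.
have := @partial_increment _ _ f (fun i => partial i f x) (C1 * r) r x _ _ H x v.
rewrite subrr normr0 add0r -/r => H1.
have -> : dotp (gradient f x) v = \sum_i v i 0 * partial i f x.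
  by apply: eq_bigr => i _; rewrite mxE mulrC.
apply: le_trans (H1 _ _ (lexx _)) _ => [i z||].
- by apply: smooth_derivable; case: tf.
- by rewrite mulr_ge0.
have -> : C1 * d%:R ^+ 2 * `|v| ^+ 2 = C1 * (d%:R * `|v|) ^+ 2 by ring.
rewrite -mulrA ler_wpM2l// -[r * r]expr2 ler_sqr ?nnegrE ?mulr_ge0//.
exact: sum_norm_coord_le.
Qed.

Lemma bump_exists (r : R) : 0 < r -> exists f (a : R), [/\ test_function f,
  forall x, 0 <= f x, forall x, r < `|x| -> f x = 0, 0 < a &
  forall x, `|x| <= r / 2 -> a <= f x].
Proof.
move=> r0; pose b : R := flat 1 (r / 2).
have b0 : 0 < b by rewrite /b /flat divr_gt0//= hornerC mul1r expR_gt0.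
exists (bump 1 r), (\prod_(i < d) (b * b)); split => //.
- apply/test_functionP; split; first exact: smooth_bump.
  by exists r; split; [exact: ltW|exact: (bump_supp ler01 (ltW r0))].
- by move=> x; have /andP[] := bump_unit 1 r x.
- exact: (bump_supp ler01 (ltW r0)).
- by apply: prodr_gt0 => i _; rewrite mulr_gt0.
- move=> x xr; apply: ler_prod => i _; rewrite mulr_ge0 ?(ltW b0)//=.
  have := le_trans (norm_coord_le _ i) xr; rewrite ler_norml => /andP[? ?].
  by rewrite ler_pM ?(ltW b0)//; apply: flat1_homo; lra.
Qed.

End test_function_tools.

Section smoothing.
Context {R : realType} {d : nat}.
Variables (g : 'cV[R]_d -> R) (L R0 : R).
Hypotheses (L0 : 0 <= L) (gL : forall x y, `|g x - g y| <= L * `|x - y|).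
Hypotheses (R00 : 0 <= R0) (g0 : forall x, R0 < `|x| -> g x = 0).
Implicit Types (x y v : 'cV[R]_d).

(* Riemann sums over a fine lattice replace the convolution integral: they are
   finite sums of smooth functions, and they are translation invariant up to an
   error of the order of the mesh. *)
Lemma lattice_convolution (h : R) (N : nat) (rho : 'cV[R]_d -> R) (r : R) :
  0 <= r -> test_function rho -> (forall x, r < `|x| -> rho x = 0) ->
  let G x := lattice_sum h N (fun y => g y * rho (x - y)) in
  [/\ test_function G, (forall x, R0 + r < `|x| -> G x = 0) &
   forall x v, dotp (gradient G x) v =
     lattice_sum h N (fun y => g y * dotp (gradient rho (x - y)) v)].
Proof.
move=> r0 trho rho0 G.
have [srho _] := trho.
have G0 x : R0 + r < `|x| -> G x = 0.
  move=> Rx; rewrite /G /lattice_sum big1 ?mulr0// => f _.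
  set y := lattice _ _; have [yR|yR] := leP `|y| R0; last by rewrite g0// mul0r.
  rewrite rho0 ?mulr0//; have := lerB_dist x y; lra.
split => //.
  apply/test_functionP; split; last by exists (R0 + r); split; [exact: addr_ge0|].
  apply: smoothZ; apply: smooth_sum => f; apply: smoothZ; exact: smooth_shift.
move=> x v.
have D i : partial i G x = lattice_sum h N (fun y => g y * partial i rho (x - y)).
  have [_] : is_derive x (delta_mx i 0) G (lattice_sum h N (fun y => g y * partial i rho (x - y))); last by [].
  apply: is_deriveZ.
  apply: is_derive_big_sum => f; apply: is_deriveZ; apply: is_derive_shift.
  exact: smooth_is_derive.
rewrite /dotp; under eq_bigr do rewrite mxE D /lattice_sum -mulrA mulr_suml.
rewrite -mulr_sumr; congr (_ * _); rewrite exchange_big; apply: eq_bigr => f _ /=.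
by rewrite mulr_sumr; apply: eq_bigr => i _; rewrite mxE mulrA.
Qed.

(** By Taylor expansion of the mollifier, [<grad G, v>] is nearly the difference quotient of [G] at
    step [s]. Translation invariance moves the shift from the mollifier to [g], so this is an
    average of difference quotients of [g] in the single direction [v]. The scale [r] comes first,
    then [s] small for the Taylor error, then a mesh small relative to [s]. One [G] and one [s] must
    serve all [x], [v], [a] and [eta]. *)
Lemma smoothing (r A B e : R) : 0 < r <= 1 -> 0 <= A -> 0 <= B -> 0 < e ->
  exists G s, [/\ test_function G, 0 < s <= r,
    forall x, `|G x - g x| <= L * r + e,
    forall x, R0 + 1 < `|x| -> G x = 0 &
    forall x v a eta, `|x| <= R0 + 1 -> `|v| <= B -> `|a| <= A -> 0 <= eta <= A ->
      (forall y, `|y - x| <= r -> `|g (y + s *: v) - g y - s * a| <= eta * s) ->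
      `|dotp (gradient G x) v - a| <= eta + e].
Proof.
move=> /andP[r0 r1] A0 B0 e0.
have [rho [b [trho rho_ge0 rho0 b0 rhob]]] := @bump_exists R d r r0.
have [C0 [C00 HC0]] := test_function_bounded trho.
have [C1 [C10 HC1]] := test_function_lipschitz trho.
have [C2 [C20 HC2]] := test_function_second_order trho.
have cg := lipschitz_fun_continuous L0 gL.
have [M [M0 HM]] := continuous_supp_bounded cg g0.
(* Makes the box contain the supports involved and their shifts; 5 leaves room for the radii and the
   rounding errors, each at most 1. *)
pose Q := (Num.bound (2 * (R0 + 5) / r)).+1.
have QP : R0 + 5 <= r * Q%:R / 2.
  rewrite ler_pdivlMr// mulrC [r * _]mulrC -ler_pdivrMr//.
  have : 2 * (R0 + 5) / r < (Num.bound (2 * (R0 + 5) / r))%:R.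
    by apply: archi_boundP; rewrite divr_ge0 ?(ltW r0)// mulr_ge0// addr_ge0.
  by move/ltW/le_trans; apply; rewrite ler_nat.
pose D := (3 * (r * Q%:R / 2)) ^+ d; pose k0 := (r / 2) ^+ d * b.
have k00 : 0 < k0 by rewrite mulr_gt0// exprn_gt0// divr_gt0.
have D0 : 0 <= D by rewrite exprn_ge0// mulr_ge0// divr_ge0// mulr_ge0// ltW.
pose P := D * (M * (C2 * B ^+ 2)).
have P0 : 0 <= P by rewrite !mulr_ge0// exprn_ge0.
pose T := D * C1; have T0 : 0 <= T by rewrite mulr_ge0.
pose Q1 := D * (M * C1 + L * C0).
have Q10 : 0 <= Q1 by rewrite mulr_ge0// addr_ge0// mulr_ge0.
(* The Taylor error [P * s^2] is to be at most half of [e * k0 * s], where [k0] bounds the discrete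
   mass of the mollifier from below. *)
pose s := Num.min r (e * k0 / (2 * (P + 1))).
have P1 : 0 < P + 1 by rewrite ltr_wpDl.
have s0 : 0 < s by rewrite lt_min r0 divr_gt0// mulr_gt0.
have sr : s <= r by rewrite ge_min lexx.
have sP : P * s <= e * k0 / 2.
  have : s <= e * k0 / (2 * (P + 1)) by rewrite ge_min lexx orbT.
  rewrite ler_pdivlMr ?mulr_gt0// ler_pdivlMr// => H; apply: le_trans H.
  have -> : s * (2 * (P + 1)) = P * s * 2 + 2 * s by ring.
  by rewrite lerDl mulr_ge0// ltW.
(* Collects the errors proportional to the mesh. They are divided by [s] in the end, hence the
   factor [s] in the target [H]. *)
pose W := Q1 + (2 * A + 2 * e + L + M) * T + 1.
have W0 : 0 < W.
  rewrite ltr_wpDl// addr_ge0// mulr_ge0// !addr_ge0// mulr_ge0//; exact: ltW.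
pose H := e * k0 * s / (2 * W).
have H0 : 0 < H by rewrite /H; apply: divr_gt0; do ?[exact: mulr_gt0 | apply: mulr_gt0].
pose p := (Num.bound (r / (2 * H))).+1.
(* A mesh commensurable with [r], so that [h * p = r / 2] and the inner cube of the mollifier holds
   the points required by [lattice_sum_lower]. *)
pose h := r / (2 * p%:R); have p0 : 0 < p%:R :> R by rewrite ltr0n.
have h0 : 0 < h by rewrite divr_gt0// mulr_gt0.
have hH : W * h <= e * k0 * s / 2.
  have : h <= H.
    rewrite /h ler_pdivrMr ?mulr_gt0// (_ : H * (2 * p%:R) = p%:R * (2 * H)); last by ring.
    have H2 : 0 < 2 * H by apply: mulr_gt0.
    rewrite -(ler_pdivrMr _ _ H2).
    have : r / (2 * H) < (Num.bound (r / (2 * H)))%:R.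
      by apply: archi_boundP; rewrite divr_ge0 ?(ltW r0)// mulr_ge0// ltW.
    by move/ltW/le_trans; apply; rewrite ler_nat.
  have W2 : 0 < 2 * W by apply: mulr_gt0.
  rewrite /H (ler_pdivlMr _ _ W2) => hH; rewrite ler_pdivlMr//.
  by rewrite (_ : W * h * 2 = h * (2 * W))//; ring.
have hr : h <= r / 2.
  rewrite /h ler_pM2l// lef_pV2 ?posrE ?mulr_gt0//.
  by rewrite ler_peMr// ler1n.
pose N := (p * Q)%N.
have hN : h * N%:R = r * Q%:R / 2.
  by rewrite /h /N natrM; field; rewrite gt_eqF.
have N1 : (0 < N)%N by rewrite muln_gt0.
have DE F (m : R) : 0 <= m -> (forall y, `|F y| <= m) -> `|lattice_sum h N F| <= D * m.
  move=> m0 Fm; apply: le_trans (@lattice_sum_norm_le _ _ h N h0 F m Fm) _.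
  rewrite ler_wpM2r// /D lerXn2r ?nnegrE ?mulr_ge0 ?(ltW h0) ?(ltW r0)//.
  rewrite -hN mulrCA ler_pM2l// -natrM ler_nat.
  by rewrite -[3%N]/(1 + 2)%N mulnDl mul1n mul2n -add1n leq_add2r.
have hN5 y : `|y| <= R0 + 5 -> `|y| <= h * N%:R.
  by move=> yR; rewrite hN (le_trans yR).
have rhoN0 y : rho y != 0 -> `|y| <= r.
  by move=> H1; rewrite leNgt; apply/negP => /rho0 /eqP; apply/negP.
have gN0 y : g y != 0 -> `|y| <= R0.
  by move=> H1; rewrite leNgt; apply/negP => /g0 /eqP; apply/negP.
pose S : ('cV[R]_d -> R) -> R := lattice_sum h N.
pose k x := S (fun y => rho (x - y)); pose K := k 0.
have K0 : k0 <= K.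
  rewrite /k0 /K /k; apply: (@le_trans _ _ ((h * p%:R) ^+ d * b)).
    by rewrite (_ : h * p%:R = r / 2)// /h; field; rewrite gt_eqF.
  apply: lattice_sum_lower => //.
  - by rewrite /N leq_pmulr.
  - move=> y yp; apply: rhob; rewrite sub0r normrN (le_trans yp)// /h.
    by rewrite le_eqVlt; apply/orP; left; apply/eqP; field; rewrite gt_eqF.
  - exact: ltW.
have Kp : 0 < K by exact: lt_le_trans K0.
(* The discrete mass of the translated mollifier is constant on the lattice, so it varies by at most
   the mesh error elsewhere. *)
have kK x : `|x| <= R0 + 1 -> `|k x - K| <= T * h.
  move=> xR; have [j xj] := lattice_round h0 x; set z := lattice h j in xj.
  have zR : `|z| <= R0 + 2.
    have -> : z = x - (x - z) by rewrite opprB addrC subrK.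
    by rewrite (le_trans (ler_normB _ _))//; lra.
  have <- : S (fun y => rho (z - y)) = K.
    rewrite /K /k /S -(@lattice_sum_shift _ _ h N h0 (fun y => rho (z - y)) j).
    - by congr lattice_sum; apply/funext => y; rewrite -/z opprD addrCA subrr addr0 sub0r.
    - move=> y /rhoN0 zy; apply: hN5; have := lerB_dist y z; rewrite distrC; lra.
    - move=> y; rewrite -/z opprD addrCA subrr addr0 => /rhoN0; rewrite normrN => yr.
      by apply/hN5/(le_trans yr)/(le_trans r1); rewrite -[X in X <= _]add0r lerD// ler1n.
  rewrite /k /S lattice_sumB /T -mulrA; apply: DE => [|y]; first by rewrite mulr_ge0// ltW.
  apply: le_trans (HC1 _ _) _; rewrite ler_wpM2l// (_ : x - y - (z - y) = x - z)//.
  by rewrite opprB addrA subrK.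
pose G x := S (fun y => g y * rho (x - y)).
have [tG G0 dG] := @lattice_convolution h N rho r (ltW r0) trho rho0.
rewrite -/S -/G in tG G0 dG.
have G1 x : R0 + 1 < `|x| -> G x = 0.
  by move=> xR; apply: G0; apply: le_lt_trans xR; rewrite lerD2l.
have TWh : (2 * A + 2 * e + L + M) * T * h <= e * k0 * s / 2 /\ Q1 * h + 2 * A * T * h <= e * k0 * s / 2.
  split; apply: le_trans hH; rewrite /W.
  - by rewrite ler_pM2r//; lra.
  - rewrite -mulrDl ler_pM2r//.
    have : 0 <= (2 * e + L + M) * T by rewrite mulr_ge0// !addr_ge0// mulr_ge0// ltW.
    lra.
have Gg x : `|x| <= R0 + 1 -> `|G x - K * g x| <= (L * r + e) * K.
  move=> xR; have H1 : `|G x - g x * k x| <= L * r * k x.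
    rewrite /k -!lattice_sumZ /G /S lattice_sumB; apply: ler_norm_lattice_sum => // y.
    rewrite -mulrBl normrM (ger0_norm (rho_ge0 _)).
    have [->|/rhoN0 xy] := eqVneq (rho (x - y)) 0; first by rewrite !mulr0.
    by rewrite ler_wpM2r// (le_trans (gL _ _))// ler_wpM2l// distrC.
  have H2 := kK _ xR.
  have H3 : `|g x * k x - K * g x| <= M * (T * h).
    by rewrite [K * _]mulrC -mulrBr normrM ler_pM.
  have H4 : L * r * k x <= L * r * K + L * (T * h).
    have : L * r * (k x - K) <= L * (T * h).
      rewrite -mulrA ler_wpM2l//; apply: le_trans (_ : r * (T * h) <= _).
        by rewrite ler_wpM2l ?(ltW r0)// (le_trans (ler_norm _)).
      by rewrite ler_piMl// mulr_ge0// ltW.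
    lra.
  have -> : G x - K * g x = (G x - g x * k x) + (g x * k x - K * g x) by rewrite addrA subrK.
  rewrite (le_trans (ler_normD _ _))//; apply: le_trans (lerD (le_trans H1 H4) H3) _.
  have TK : (L + M) * T * h <= e * K.
    apply: le_trans (_ : e * k0 * s / 2 <= _).
      apply: le_trans TWh.1; rewrite ler_pM2r// ler_wpM2r//; lra.
    have s1 : s <= 1 by exact: le_trans r1.
    have ek : 0 < e * k0 by rewrite mulr_gt0.
    apply: le_trans (_ : e * k0 <= _); last by rewrite ler_pM2l.
    by rewrite -mulrA ler_piMr// ?(ltW ek)// ler_pdivrMr// mul1r; lra.
  by move: TK; lra.
exists (fun x => K^-1 * G x), s; split.
- have [sG [M1 [M10 HM1]]] := (test_functionP _).1 tG.
  apply/test_functionP; split; first exact: smoothZ.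
  by exists M1; split => // x /HM1 ->; rewrite mulr0.
- by rewrite s0.
- move=> x; have [xR|xR] := leP `|x| (R0 + 1).
    have -> : K^-1 * G x - g x = (G x - K * g x) / K by field; rewrite gt_eqF.
    by rewrite normrM normfV (gtr0_norm Kp) ler_pdivrMr// Gg.
  rewrite G1// g0 ?mulr0 ?subr0 ?normr0; last by rewrite (lt_trans _ xR)// ltrDl.
  by rewrite addr_ge0// ?mulr_ge0// ltW.
- by move=> x xR; rewrite G1// mulr0.
move=> x v a eta xR vB aA /andP[eta0 etaA] gsv.
have -> : dotp (gradient (fun x => K^-1 * G x) x) v = K^-1 * dotp (gradient G x) v.
  rewrite /dotp mulr_sumr; apply: eq_bigr => i _; rewrite !mxE mulrA; congr (_ * _).
  have [_] : is_derive x (delta_mx i 0) (fun x => K^-1 * G x) (K^-1 * partial i G x); last by [].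
  by apply: is_deriveZ; apply: smooth_is_derive; have [] := tG.
set X := dotp _ v.
have nsv : `|s *: v| <= s * B by rewrite normrZ (gtr0_norm s0) ler_wpM2l// ltW.
have E1 : `|G (x + s *: v) - G x - s * X| <= P * s ^+ 2.
  have -> : s * X = S (fun y => g y * dotp (gradient rho (x - y)) (s *: v)).
    rewrite /X dG -lattice_sumZ; congr lattice_sum; apply/funext => y.
    by rewrite dotpZr mulrCA.
  have -> : P * s ^+ 2 = D * (M * (C2 * (s * B) ^+ 2)) by rewrite /P; ring.
  rewrite /G /S !lattice_sumB; apply: DE => [|y].
    by apply: mulr_ge0 => //; apply: mulr_ge0 => //; exact: sqr_ge0.
  rewrite -!mulrBr normrM ler_pM// (_ : x + s *: v - y = x - y + s *: v); last by rewrite addrAC.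
  apply: le_trans (HC2 _ _) _; rewrite ler_wpM2l//.
  by rewrite ler_sqr ?nnegrE ?(mulr_ge0 (ltW s0)).
(* Only lattice translations are exact; [s *: v] is rounded to [z] to move the shift onto [g], and
   the rounding is then undone there using that [g] is Lipschitz. *)
have [j zj] := lattice_round h0 (s *: v); set z := lattice h j in zj.
pose G1' := S (fun y => g y * rho (x + z - y)).
have E2 : `|G (x + s *: v) - G1'| <= D * (M * (C1 * h)).
  rewrite /G /G1' /S lattice_sumB; apply: DE => [|y].
    by rewrite !mulr_ge0// ltW.
  rewrite -mulrBr normrM ler_pM// (le_trans (HC1 _ _))// ler_wpM2l//.
  by rewrite (_ : _ - (x + z - y) = s *: v - z)// opprB addrA subrK opprD addrACA subrr add0r.
have E3 : G1' = S (fun y => g (y + z) * rho (x - y)).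
  rewrite /G1' /S -(@lattice_sum_shift _ _ h N h0 (fun y => g y * rho (x + z - y)) j).
  - congr lattice_sum; apply/funext => y; rewrite -/z; congr (_ * rho _).
    by rewrite opprD addrACA subrr addr0.
  - by move=> y; rewrite mulf_eq0 negb_or => /andP[/gN0 yR _]; apply: hN5; lra.
  - move=> y; rewrite -/z mulf_eq0 negb_or => /andP[_].
    rewrite (_ : x + z - (y + z) = x - y); last by rewrite opprD addrACA subrr addr0.
    move=> /rhoN0 xy; apply: hN5; have := lerB_dist y x; rewrite distrC; lra.
pose G3 := S (fun y => g (y + s *: v) * rho (x - y)).
have E4 : `|G1' - G3| <= D * (L * h * C0).
  rewrite E3 /G3 /S lattice_sumB; apply: DE => [|y].
    by rewrite !mulr_ge0// ltW.
  rewrite -mulrBl normrM ler_pM// (le_trans (gL _ _))// ler_wpM2l//.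
  by rewrite opprD addrACA subrr add0r distrC.
have E5 : `|G3 - G x - s * a * k x| <= eta * s * k x.
  rewrite /k -!lattice_sumZ /G3 /G /S !lattice_sumB; apply: ler_norm_lattice_sum => // y.
  rewrite -!mulrBl normrM (ger0_norm (rho_ge0 _)).
  have [->|/rhoN0 xy] := eqVneq (rho (x - y)) 0; first by rewrite !mulr0.
  by rewrite ler_wpM2r// gsv// distrC.
have E6 := kK x xR.
have Th0 : 0 <= T * h by rewrite mulr_ge0// ltW.
have s1 : s <= 1 by exact: le_trans r1.
have E7 : `|s * a * (k x - K)| <= A * (T * h).
  rewrite normrM ler_pM// normrM (gtr0_norm s0) -[leRHS]mul1r.
  by rewrite ler_pM// ltW.
have E8 : eta * s * k x <= eta * s * K + A * (T * h).
  have : eta * s * (k x - K) <= A * (T * h).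
    apply: le_trans (ler_norm _) _; rewrite normrM ler_pM//.
    rewrite ger0_norm ?mulr_ge0 ?(ltW s0)// -[leRHS]mulr1.
    by rewrite ler_pM// ltW.
  lra.
have E9 : P * s ^+ 2 <= e * k0 / 2 * s by rewrite expr2 mulrA ler_pM2r.
have E10 : e * k0 * s <= e * K * s by rewrite ler_pM2r// ler_pM2l.
have -> : K^-1 * X - a = (s * X - s * a * K) / (s * K).
  by field; rewrite !gt_eqF.
rewrite normrM normfV (gtr0_norm (mulr_gt0 s0 Kp)) (ler_pdivrMr _ _ (mulr_gt0 s0 Kp)).
(* In order: the Taylor error, rounding on the mollifier, rounding on [g], the averaged hypothesis,
   and the variation of the mass. *)
have -> : s * X - s * a * K = - (G (x + s *: v) - G x - s * X) + (G (x + s *: v) - G1')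
   + (G1' - G3) + (G3 - G x - s * a * k x) + s * a * (k x - K) by ring.
have tri (u1 u2 u3 u4 u5 : R) : `|- u1 + u2 + u3 + u4 + u5| <= `|u1| + `|u2| + `|u3| + `|u4| + `|u5|.
  by do 4 (rewrite (le_trans (ler_normD _ _))// lerD2r); rewrite normrN.
apply: le_trans (tri _ _ _ _ _) _.
have Q1E : Q1 * h = D * (M * (C1 * h)) + D * (L * h * C0) by rewrite /Q1; ring.
have := TWh.2; rewrite Q1E; lra.
Qed.

End smoothing.

Section divergence_along_field.
Context {R : realType} {d : nat}.
Variable mu : probability (borel R d) R.
Variables (V : 'cV[R]_d -> 'cV[R]_d) (w : 'cV[R]_d -> R).
Hypothesis iw : mu.-integrable setT (EFin \o w).
Hypothesis divV : forall f, test_function f ->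
  mu.-integrable setT (fun x => (dotp (gradient f x) (V x))%:E) /\
  mean mu (fun x => dotp (gradient f x) (V x)) = mean mu (fun x => f x * w x).
Hypothesis Vb : forall M : R, exists B, 0 <= B /\ forall x, `|x| <= M -> `|V x| <= B.

(* Mollification extends the integration by parts to functions that are only
   differentiable along [V]: averages of [g] have a gradient whose product with
   [V x] is, up to a small error, an average of difference quotients in the
   single direction [V x], and these are uniformly bounded. *)
Lemma divergence_lipschitz g (L R0 : R) (l : 'cV[R]_d -> R) :
  0 <= L -> (forall x y, `|g x - g y| <= L * `|x - y|) ->
  0 <= R0 -> (forall x, R0 < `|x| -> g x = 0) ->
  measurable_fun setT (l : borel R d -> R) ->
  (forall x (e : R), 0 < e -> exists2 r : R, 0 < r &
    forall y (s : R), `|y - x| <= r -> 0 < s <= r ->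
      `|g (y + s *: V x) - g y - s * l x| <= e * s) ->
  mean mu l = mean mu (fun x => g x * w x).
Proof.
move=> L0 gL R00 g0 ml sd.
have [B [B0 HB]] := Vb (R0 + 1).
(* A difference quotient of [g] in a direction of norm at most [B] is bounded by [L * B]; the 1
   absorbs the error allowed in [sd]. *)
pose A := L * B + 1; have LB0 : 0 <= L * B by rewrite mulr_ge0.
have A0 : 0 <= A by rewrite addr_ge0.
have lA x : `|x| <= R0 + 1 -> `|l x| <= A.
  move=> xR; have [r r0 /(_ x r)] := sd x 1 ltr01.
  rewrite subrr normr0 (ltW r0) r0 lexx => /(_ isT isT) H.
  rewrite -(ler_pM2l r0) -[X in X * _ <= _](gtr0_norm r0) -normrM.
  have -> : r * l x = (g (x + r *: V x) - g x) - (g (x + r *: V x) - g x - r * l x).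
    by rewrite opprB addrC subrK.
  rewrite (le_trans (ler_normB _ _))//.
  have H2 : `|g (x + r *: V x) - g x| <= L * (r * B).
    rewrite (le_trans (gL _ _))// ler_wpM2l// addrAC subrr add0r normrZ gtr0_norm//.
    by rewrite ler_pM2l// HB.
  by rewrite /A mulrDr mulrCA lerD// mulr1 -[leRHS]mul1r.
have l0 x : R0 + 1 < `|x| -> l x = 0.
  move=> xR; apply/eqP; rewrite -normr_le0; apply/ler_addgt0Pr => e e0; rewrite add0r.
  have [r r0 H] := sd x e e0; pose s := Num.min r (1 / (`|V x| + 1)).
  have V1 : 0 < `|V x| + 1 by rewrite ltr_wpDl.
  have s0 : 0 < s by rewrite lt_min r0 divr_gt0.
  have := H x s; rewrite subrr normr0 (ltW r0) s0 ge_min lexx => /(_ isT isT).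
  have gx0 : g x = 0 by rewrite g0// (lt_trans _ xR)// ltrDl.
  have sV : `|s *: V x| <= 1.
    rewrite normrZ gtr0_norm//; apply: (@le_trans _ _ (1 / (`|V x| + 1) * `|V x|)).
      by rewrite ler_wpM2r// ge_min lexx orbT.
    by rewrite mulrAC ler_pdivrMr// !mul1r lerDl.
  rewrite gx0 subr0 g0 ?sub0r ?normrN ?normrM ?(gtr0_norm s0) 1?mulrC ?ler_pM2r//.
  have := lerB_dist x (- (s *: V x)); rewrite normrN opprK; lra.
have /choice[G HG] n : exists G, exists s, [/\ test_function G, 0 < s <= n.+1%:R^-1,
    forall x, `|G x - g x| <= L * n.+1%:R^-1 + n.+1%:R^-1,
    forall x, R0 + 1 < `|x| -> G x = 0 &
    forall x v a eta, `|x| <= R0 + 1 -> `|v| <= B -> `|a| <= A -> 0 <= eta <= A ->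
      (forall y, `|y - x| <= n.+1%:R^-1 ->
        `|g (y + s *: v) - g y - s * a| <= eta * s) ->
      `|dotp (gradient G x) v - a| <= eta + n.+1%:R^-1].
  have n1 : 0 < n.+1%:R^-1 :> R by rewrite invr_gt0 ltr0Sn.
  by apply: (smoothing L0 gL R00 g0) => //; rewrite n1 invf_le1// ler1n.
have small e : 0 < e -> \forall n \near \oo, n.+1%:R^-1 <= e :> R.
  move=> e0; have /cvgrPdist_le/(_ _ e0) := @cvg_harmonic R; apply: filterS => n.
  by rewrite sub0r normrN ger0_norm ?invr_ge0.
pose H n x := dotp (gradient (G n) x) (V x).
have G0 n x : R0 + 1 < `|x| -> H n x = 0.
  move=> xR; have [s [_ _ _ Gn0 _]] := HG n.
  by rewrite /H /dotp big1// => i _; rewrite mxE (partial_eq0_outside _ Gn0)// mul0r.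
have HA n x : `|H n x| <= A.
  have [xR|xR] := leP `|x| (R0 + 1); last by rewrite G0// normr0.
  have [s [_ /andP[s0 _] _ _ Gn]] := HG n.
  (* With the slope 0 and the tolerance [L * B], the hypothesis is just that [g] is Lipschitz; this
     yields the uniform bound for dominated convergence. *)
  have := Gn x (V x) 0 (L * B) xR (HB x xR); rewrite normr0 subr0 LB0 /A lerDl ler01.
  move=> /(_ A0 isT) H1; apply: le_trans (H1 _) _ => [y _|].
    rewrite mulr0 subr0 (le_trans (gL _ _))// addrAC subrr add0r normrZ gtr0_norm//.
    by rewrite -mulrA ler_wpM2l// mulrC ler_pM2r// HB.
  by rewrite lerD2l invf_le1// ler1n.
have Hl x : H n x @[n --> \oo] --> l x.
  have [xR|xR] := leP `|x| (R0 + 1); last first.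
    by rewrite l0//; under eq_fun do rewrite G0//; exact: cvg_cst.
  apply/cvgrPdist_le => e e0.
  (* The estimate on [G n] admits only tolerances up to [A]. *)
  pose eta := Num.min (e / 2) A.
  have e20 : 0 < e / 2 by rewrite divr_gt0.
  have eta0 : 0 < eta by rewrite lt_min e20 ltr_wpDl.
  have [r r0 Hr] := sd x eta eta0.
  near=> n; rewrite distrC.
  have nr : n.+1%:R^-1 <= r by near: n; exact: small.
  have ne : n.+1%:R^-1 <= e / 2 by near: n; exact: small.
  have [s [_ /andP[s0 sn] _ _ Gn]] := HG n.
  have H1 : `|H n x - l x| <= eta + n.+1%:R^-1.
    apply: Gn => //; [exact: HB|exact: lA|by rewrite (ltW eta0) ge_min lexx orbT|].
    by move=> y yx; apply: Hr; [exact: le_trans nr|rewrite s0 (le_trans sn)].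
  rewrite (le_trans H1)// [leRHS]splitr lerD// ge_min lexx //.
have cg := lipschitz_fun_continuous L0 gL.
have [M [M0 HM]] := continuous_supp_bounded cg g0.
have iH n : mu.-integrable setT (EFin \o H n).
  by have [s [tG _ _ _ _]] := HG n; have [] := divV tG.
have mw : measurable_fun setT (w : borel R d -> R) by apply/measurable_EFinP; case/integrableP: iw.
have c1 : mean mu (H n) @[n --> \oo] --> mean mu l.
  rewrite /mean; apply: (@Rdominated_cvg _ _ _ mu H l (cst A)) => //.
  - by move=> n; apply/measurable_EFinP; case/integrableP: (iH n).
  - exact: integrable_cst_fin.
have c2 : mean mu (fun x => G n x * w x) @[n --> \oo] --> mean mu (fun x => g x * w x).
  rewrite /mean; apply: (@Rdominated_cvg _ _ _ mu (fun n x => G n x * w x) (fun x => g x * w x)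
    (fun x => (M + (L + 1)) * `|w x|)).
  - move=> n; apply: measurable_funM => //; apply: test_function_measurable.
    by have [s []] := HG n.
  - by apply: measurable_funM => //; exact: continuous_borel_measurable.
  - move=> x; apply: cvgMl; apply/cvgrPdist_le => e e0; near=> n.
    have [s [_ _ Gg _ _]] := HG n; rewrite distrC (le_trans (Gg x))//.
    rewrite -[X in _ + X]mul1r -mulrDl mulrC -ler_pdivlMr ?ltr_wpDl//.
    by near: n; apply: small; rewrite divr_gt0// ltr_wpDl.
  - by apply: integrable_rscale; exact: integrable_norm.
  - move=> n x; rewrite normrM ler_wpM2r//.
    have -> : G n x = g x + (G n x - g x) by rewrite addrC subrK.
    rewrite (le_trans (ler_normD _ _))// lerD//.
    have [s [_ _ Gg _ _]] := HG n; rewrite (le_trans (Gg x))// -[X in _ + X]mul1r -mulrDl.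
    by rewrite ler_piMr ?addr_ge0// invf_le1// ler1n.
apply: (@cvg_unique _ (@Rhausdorff R) _ _ _ _ c1).
rewrite (_ : (fun n => mean mu (H n)) = fun n => mean mu (fun x => G n x * w x))//.
by apply/funext => n; have [s [tG _ _ _ _]] := HG n; have [] := divV tG.
Unshelve. all: end_near. Qed.

End divergence_along_field.

(** * Transport of test functions along the flow *)

Section flow_analysis.
Context {R : realType} {d : nat}.
Variables (V : 'cV[R]_d -> 'cV[R]_d) (L : R).
Hypothesis L0 : 0 < L.
Hypothesis VL : forall x y, `|V x - V y| <= L * `|x - y|.
Variable Psi : R -> 'cV[R]_d -> 'cV[R]_d.
Hypothesis Psi0 : forall x, Psi 0 x = x.
Hypothesis PsiV : forall x, solution V (fun t => Psi t x).
Implicit Types (x y : 'cV[R]_d) (s t : R) (f : 'cV[R]_d -> R).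

Let Lip t : R := @flow_lipschitz R d L t.

Let Lip_gt0 t : 0 < Lip t.
Proof. by rewrite mulr_gt0 ?expR_gt0// ltr_wpDl. Qed.

Let Lip_le s t : `|s| <= `|t| -> Lip s <= Lip t.
Proof.
move=> st; rewrite /Lip /flow_lipschitz ler_wpM2l ?addr_ge0// ler_expR ler_wpM2l//.
by rewrite mulr_ge0// ltW.
Qed.

Lemma flow_dist t x y : `|Psi t x - Psi t y| <= Lip t * `|x - y|.
Proof.
have := solution_lipschitz L0 VL t (PsiV x) (PsiV y).
by rewrite !Psi0.
Qed.

Lemma flow_comp s t x : Psi s (Psi t x) = Psi (t + s) x.
Proof.
have := solution_unique L0 VL (PsiV (Psi t x)) (solution_shift t (PsiV x)).
by rewrite Psi0 addr0 => /(_ erefl) /(congr1 (fun X => X s)).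
Qed.

Lemma flow_near x t (e : R) : 0 < e -> exists2 r : R, 0 < r &
  forall y s, `|y - x| <= r -> `|s - t| <= r -> `|Psi s y - Psi t x| <= e.
Proof.
move=> e0; have e20 : 0 < e / 2 by rewrite divr_gt0.
have /cvgrPdist_le/(_ _ e20)[r1 /= r10 Hr1] := path_continuous (PsiV x t).
have C0 := Lip_gt0 (`|t| + 1).
exists (Num.min (r1 / 2) (Num.min 1 (e / 2 / Lip (`|t| + 1)))).
  by rewrite !lt_min; apply/and3P; split; rewrite ?divr_gt0.
move=> y s; rewrite !le_min => /and3P[_ _ yx] /and3P[sr1 s1 _].
have -> : Psi s y - Psi t x = (Psi s y - Psi s x) + (Psi s x - Psi t x) by rewrite addrA subrK.
rewrite (le_trans (ler_normD _ _))// [leRHS]splitr lerD//.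
  apply: le_trans (flow_dist _ _ _) _.
  apply: (@le_trans _ _ (Lip (`|t| + 1) * `|y - x|)).
    rewrite ler_wpM2r// Lip_le// [leRHS]ger0_norm ?addr_ge0//.
    have -> : s = t + (s - t) by rewrite addrC subrK.
    by rewrite (le_trans (ler_normD _ _))// lerD2l.
  by rewrite mulrC -ler_pdivlMr.
rewrite distrC; apply: Hr1; rewrite /= distrC (le_lt_trans sr1)//.
by rewrite ltr_pdivrMr// ltr_pMr// ltr1n.
Qed.

(** The backward flow is Lipschitz and sends balls into balls, so a test function composed with the
    flow still has bounded support. *)
Lemma flow_far t (M : R) : exists R0, 0 <= R0 /\ forall x, R0 < `|x| -> M < `|Psi t x|.
Proof.
exists (`|Psi (- t) 0| + Lip (- t) * `|M|); split.
  by rewrite addr_ge0// mulr_ge0// ltW.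
move=> x; apply: contraTT; rewrite -!leNgt => xM.
have -> : x = Psi (- t) (Psi t x) by rewrite flow_comp subrr Psi0.
have -> : Psi (- t) (Psi t x) = Psi (- t) 0 + (Psi (- t) (Psi t x) - Psi (- t) 0).
  by rewrite addrC subrK.
rewrite (le_trans (ler_normD _ _))// lerD2l (le_trans (flow_dist _ _ _))//.
by rewrite subr0 ler_wpM2l ?(ltW (Lip_gt0 _))// (le_trans xM)// ler_norm.
Qed.

(** The start [y] varies while the velocity is frozen at [x]: along a short trajectory near [x] the
    field hardly changes. *)
Lemma flow_step x (e : R) : 0 < e -> exists2 r : R, 0 < r &
  forall y s, `|y - x| <= r -> 0 < s <= r -> `|Psi s y - y - s *: V x| <= e * s.
Proof.
move=> e0; have eL : 0 < e / L by rewrite divr_gt0.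
have [r r0 Hr] := flow_near x 0 eL; exists r => // y s yx /andP[s0 sr].
apply: norm_cV_le; first by rewrite mulr_ge0// ltW.
move=> i; rewrite !mxE.
have D z : 0 <= z <= s -> is_derive z 1 (fun z => Psi z y i 0 - z * V x i 0)
    (V (Psi z y) i 0 - V x i 0).
  move=> _; apply: is_deriveB; first exact: (is_derive_cVP _ _ _).1 (PsiV y z) i.
  apply: is_derive_eq; rewrite /GRing.scale /=; ring.
have [z /andP[z0 zs] H] := is_derive_MVT (ltW s0) D.
have -> : Psi s y i 0 - y i 0 - s * V x i 0 = (V (Psi z y) i 0 - V x i 0) * s.
  by move: H; rewrite Psi0 mul0r !subr0 => <-; ring.
rewrite normrM (gtr0_norm s0) ler_pM2r//.
have -> : V (Psi z y) i 0 - V x i 0 = (V (Psi z y) - V x) i 0 by rewrite !mxE.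
rewrite (le_trans (norm_coord_le _ i))// (le_trans (VL _ _))// mulrC -ler_pdivlMr//.
by have := Hr y z yx; rewrite Psi0 subr0 (ger0_norm z0); apply; exact: le_trans sr.
Qed.

Definition along f x : R := dotp (gradient f x) (V x).

Lemma along_continuous f : smooth f -> continuous (along f).
Proof.
move=> sf; rewrite /along /dotp.
elim: (index_enum 'I_d) => [|i I IH] x.
  rewrite (_ : (fun _ => _) = cst 0); first exact: cst_continuous.
  by apply/funext => y; rewrite big_nil.
rewrite (_ : (fun _ => _) = fun y => gradient f y i 0 * V y i 0 +
    \sum_(j <- I) gradient f y j 0 * V y j 0); last by apply/funext => y; rewrite big_cons.
have cf : {for x, continuous (fun y => gradient f y i 0)}.
  rewrite (_ : (fun _ => _) = partial i f); last by apply/funext => y; rewrite mxE.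
  exact: (@smooth_continuous _ _ _ (smooth_partial i sf) x).
have cV : {for x, continuous (fun y => V y i 0)}.
  apply: (@continuous_comp _ _ _ V (fun y : 'cV[R]_d => y i 0)).
    exact: (lipschitz_field_continuous L0 VL).
  exact: coord_continuous.
exact: continuousD (continuousM cf cV) (IH x).
Qed.

Lemma along_bounded f : test_function f -> exists B, 0 <= B /\ forall x, `|along f x| <= B.
Proof.
move=> /test_functionP[sf [M [M0 HM]]].
apply: (@continuous_supp_bounded _ _ _ M); first exact: along_continuous.
move=> x xM; rewrite /along /dotp big1// => i _.
by rewrite mxE (partial_eq0_outside _ HM)// mul0r.
Qed.

Lemma is_derive_along f t x : smooth f ->
  is_derive t 1 (fun s => f (Psi s x)) (along f (Psi t x)).
Proof.
move=> sf; apply/is_derive_epsP => e e0; set p := Psi t x.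
pose e1 := e / 2 / (`|V p| + 1); pose e2 := e / 2 / (d%:R * `|gradient f p| + 1).
have V1 : 0 < `|V p| + 1 by rewrite ltr_wpDl.
have G1 : 0 < d%:R * `|gradient f p| + 1 by rewrite ltr_wpDl// mulr_ge0.
have e10 : 0 < e1 by rewrite !divr_gt0.
have e20 : 0 < e2 by rewrite !divr_gt0.
have [r1 r10 H1] := @smooth_strict_differentiable _ _ f p e1 sf e10.
have /is_derive_epsP D := PsiV x t.
have [r2 r20 H2] := D e2 e20; have [r3 r30 H3] := D 1 ltr01.
exists (Num.min r2 (Num.min r3 (r1 / (`|V p| + 1)))).
  by rewrite !lt_min r20 r30 divr_gt0.
move=> s; rewrite !lt_min => /and3P[sr2 sr3 sr1].
have := H2 s sr2; have := H3 s sr3; rewrite -/p mul1r.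
have -> : t + s *: 1 = t + s by rewrite /GRing.scale /= mulr1.
set h := Psi (t + s) x - p => h1 h2.
have -> : Psi (t + s) x = p + h by rewrite /h [RHS]addrC subrK.
clearbody h.
have hV : `|h| <= (`|V p| + 1) * `|s|.
  have -> : h = s *: V p + (h - s *: V p) by rewrite addrC subrK.
  by rewrite (le_trans (ler_normD _ _))// mulrDl mul1r normrZ mulrC lerD2l.
have hr1 : `|h| <= r1.
  by rewrite (le_trans hV)// mulrC -ler_pdivlMr// ltW.
have := H1 p h; rewrite subrr normr0 (ltW r10) => /(_ isT hr1) H.
have -> : f (p + h) - f p - s *: along f p =
    (f (p + h) - f p - dotp (gradient f p) h) + dotp (gradient f p) (h - s *: V p).
  by rewrite dotpBr dotpZr /along addrA subrK.
have -> : e * `|s| = e / 2 * `|s| + e / 2 * `|s| by field.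
rewrite (le_trans (ler_normD _ _))// lerD//.
  rewrite (le_trans H)//; apply: le_trans (_ : e1 * ((`|V p| + 1) * `|s|) <= _).
    by rewrite ler_pM2l.
  by rewrite mulrA /e1 divfK// gt_eqF.
rewrite (le_trans (dotp_norm_le _ _))// mulrA.
apply: le_trans (_ : (d%:R * `|gradient f p| + 1) * (e2 * `|s|) <= _).
  by rewrite ler_pM// ?mulr_ge0// lerDl.
by rewrite mulrA [_ * e2]mulrC /e2 divfK// gt_eqF.
Qed.

(** The point [y + s V(x)] is replaced by [Psi_s y] at a cost of order [e * s], as [f o Psi_t] is
    Lipschitz; by the group law the rest is a time increment of [f] along the trajectory of [y]. *)
Lemma flow_strict_derivative f t x (e : R) : test_function f -> 0 < e ->
  exists2 r : R, 0 < r & forall y s, `|y - x| <= r -> 0 < s <= r ->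
    `|f (Psi t (y + s *: V x)) - f (Psi t y) - s * along f (Psi t x)| <= e * s.
Proof.
move=> tf e0; have sf : smooth f by case: tf.
have [C [C0 HC]] := test_function_lipschitz tf.
pose C1 := C * Lip t + 1; have C10 : 0 < C1.
  by rewrite ltr_wpDl// mulr_ge0// ltW.
have e20 : 0 < e / 2 by rewrite divr_gt0.
have e10 : 0 < e / 2 / C1 by rewrite divr_gt0.
have [r1 r10 H1] := flow_step x e10.
have /cvgrPdist_le/(_ _ e20)/nbhs_ballP[r2 /= r20 H2] := along_continuous sf (x := Psi t x).
have r220 : 0 < r2 / 2 by rewrite divr_gt0.
have [r3 r30 H3] := flow_near x t r220.
exists (Num.min r1 r3) => [|y s]; first by rewrite lt_min r10.
rewrite !le_min => /andP[y1 y3] /and3P[s0 s1 s3].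
have -> : f (Psi t (y + s *: V x)) - f (Psi t y) - s * along f (Psi t x) =
    (f (Psi t (y + s *: V x)) - f (Psi t (Psi s y))) +
    (f (Psi (s + t) y) - f (Psi t y) - s * along f (Psi t x)).
  by rewrite flow_comp; ring.
rewrite (le_trans (ler_normD _ _))// (_ : e * s = e / 2 * s + e / 2 * s); last by field.
rewrite lerD//.
  rewrite (le_trans (HC _ _))// (le_trans (ler_wpM2l C0 (flow_dist _ _ _)))//.
  rewrite distrC (_ : Psi s y - _ = Psi s y - y - s *: V x); last by rewrite opprD addrA.
  have := H1 y s y1; rewrite s0 s1 => /(_ isT) H.
  rewrite mulrA; apply: le_trans (_ : C1 * (e / 2 / C1 * s) <= _).
    rewrite ler_pM ?mulr_ge0 ?(ltW (Lip_gt0 _))//.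
    by rewrite lerDl.
  by rewrite mulrA mulrCA divff ?gt_eqF// mulr1.
have D z : 0 <= z <= s -> is_derive z 1 (fun z => f (Psi (z + t) y) - z * along f (Psi t x))
    (along f (Psi (z + t) y) - along f (Psi t x)).
  move=> _; apply: is_deriveB.
    exact: (@is_derive_shift_arg _ (fun z => f (Psi z y))) (is_derive_along (z + t) y sf).
  apply: is_derive_eq; rewrite /GRing.scale /=; ring.
have [z /andP[z0 zs] H] := is_derive_MVT (ltW s0) D.
have -> : f (Psi (s + t) y) - f (Psi t y) - s * along f (Psi t x) =
    (along f (Psi (z + t) y) - along f (Psi t x)) * s.
  by move: H; rewrite add0r mul0r !subr0 => <-; ring.
rewrite normrM (gtr0_norm s0) ler_pM2r// distrC; apply: H2.
rewrite -ball_normE /= distrC; apply: le_lt_trans (_ : r2 / 2 < r2).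
  by apply: H3 => //; rewrite addrK ger0_norm// (le_trans zs).
by rewrite ltr_pdivrMr// ltr_pMr// ltr1n.
Qed.

Lemma flow_continuous t f : continuous f -> continuous (fun x => f (Psi t x)).
Proof.
move=> cf x; apply: (@continuous_comp _ _ _ (Psi t) f); last exact: cf.
have cP : continuous (Psi t) by exact: lipschitz_fun_continuous (ltW (Lip_gt0 t)) (flow_dist t).
exact: cP.
Qed.

Variable mu : probability (borel R d) R.
Variable w : 'cV[R]_d -> R.
Hypothesis iw : mu.-integrable setT (EFin \o w).
Hypothesis divV : forall f, test_function f ->
  mu.-integrable setT (fun x => (dotp (gradient f x) (V x))%:E) /\
  mean mu (fun x => dotp (gradient f x) (V x)) = mean mu (fun x => f x * w x).

Lemma flow_divergence f t : test_function f ->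
  mean mu (fun x => along f (Psi t x)) = mean mu (fun x => f (Psi t x) * w x).
Proof.
move=> tf; have [sf [M [M0 HM]]] := (test_functionP f).1 tf.
have [C [C0 HC]] := test_function_lipschitz tf.
have [R0 [R00 HR0]] := flow_far t M.
apply: (@divergence_lipschitz _ _ mu V w iw divV _ _ (C * Lip t) R0).
- move=> N; exists (`|V 0| + L * `|N|); split.
    by rewrite addr_ge0// mulr_ge0// ltW.
  move=> x xN; have -> : V x = V 0 + (V x - V 0) by rewrite addrC subrK.
  rewrite (le_trans (ler_normD _ _))// lerD2l (le_trans (VL _ _))// subr0 ler_pM2l//.
  by rewrite (le_trans xN)// ler_norm.
- by rewrite mulr_ge0// ltW.
- by move=> x y; rewrite -mulrA (le_trans (HC _ _))// ler_wpM2l// flow_dist.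
- exact: R00.
- by move=> x /HR0 /HM.
- by apply: continuous_borel_measurable; apply: flow_continuous; exact: along_continuous.
- by move=> x e e0; exact: flow_strict_derivative.
Qed.

Lemma is_derive_flow_mean f t : test_function f ->
  is_derive t 1 (fun t => mean mu (fun x => f (Psi t x))) (mean mu (fun x => along f (Psi t x))).
Proof.
move=> tf; have [sf _] := tf.
have [B [B0 HB]] := along_bounded tf.
have [M [M0 HM]] := test_function_bounded tf.
have tin : `]t - 1, t + 1[%classic t by rewrite /= in_itv/= ltrBlDr ltrDl ltr01.
have ig s : mu.-integrable setT (EFin \o (fun x => f (Psi s x))).
  apply: (@integrable_bounded _ _ _ mu _ M) => //.
  by apply: continuous_borel_measurable; apply: flow_continuous; exact: smooth_continuous.
have D s x : is_derive s 1 (fun s => f (Psi s x)) (along f (Psi s x)).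
  exact: is_derive_along.
have p1 : partial1of2 (fun s (x : borel R d) => f (Psi s x)) = fun s x => along f (Psi s x).
  by apply/funext => s; apply/funext => x; rewrite /partial1of2 derive1E; have [] := D s x.
have der s x : derivable (fun s => f (Psi s x)) s 1 by have [] := D s x.
have iB := @integrable_cst_fin _ _ _ mu B.
apply: DeriveDef.
  apply: (@derivable_under_integral R _ _ mu (fun s (x : borel R d) => f (Psi s x)) setT measurableT
    t (t - 1) (t + 1) tin _ _ (cst B) _ iB) => //.
  by move=> s x _ _; rewrite p1.
rewrite -derive1E.
rewrite (@differentiation_under_integral R _ _ mu (fun s (x : borel R d) => f (Psi s x)) setT measurableT
    t (t - 1) (t + 1) tin _ _ (cst B) _ iB) => //; first by rewrite p1.
by move=> s x _ _; rewrite p1.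
Qed.

End flow_analysis.

(** * Shifting a probability on the Gaussian quantile scale *)

Section gaussian_shift.
Context {R : realType}.
Implicit Types (p q r z e : R).

Definition gshift r p : R := Phi (Phi_inv p + r%:E)%E.

Variant unit_Phi_spec : R -> Type :=
  | UnitPhi0 : unit_Phi_spec 0
  | UnitPhi1 : unit_Phi_spec 1
  | UnitPhi z : unit_Phi_spec (Phi z%:E).

Lemma unit_PhiP p : 0 <= p <= 1 -> unit_Phi_spec p.
Proof.
move=> /andP[p0 p1]; have [->|pN0] := eqVneq p 0; first exact: UnitPhi0.
have [->|pN1] := eqVneq p 1; first exact: UnitPhi1.
rewrite -(@Phi_inv_realK _ p); first exact: UnitPhi.
by rewrite lt_neqAle eq_sym pN0 p0 lt_neqAle pN1.
Qed.

Lemma gshift0 r : gshift r 0 = 0.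
Proof. by rewrite /gshift /Phi_inv lexx. Qed.

Lemma gshift1 r : gshift r 1 = 1.
Proof. by rewrite /gshift /Phi_inv ler10 lexx. Qed.

Lemma gshift_Phi r z : gshift r (Phi z%:E) = Phi (z + r)%:E.
Proof.
by rewrite /gshift /Phi_inv leNgt Phi_gt0 leNgt Phi_lt1 /= PhiK.
Qed.

Lemma gshift_unit r p : 0 <= p <= 1 -> 0 <= gshift r p <= 1.
Proof.
case/unit_PhiP => [||z]; first by rewrite gshift0 lexx ler01.
  by rewrite gshift1 lexx ler01.
by rewrite gshift_Phi !ltW ?Phi_gt0 ?Phi_lt1.
Qed.

Lemma gshiftN r p : 0 <= p <= 1 -> gshift (- r) p = 1 - gshift r (1 - p).
Proof.
case/unit_PhiP => [||z]; first by rewrite subr0 gshift0 gshift1 subrr.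
  by rewrite subrr gshift0 gshift1 subr0.
by rewrite -PhiN !gshift_Phi -PhiN opprD opprK.
Qed.

(** Monotonicity and right continuity in a single statement, in the form that absorbs an
    approximation error in the initial mass. *)
Lemma gshift_upper_semicontinuous r p e : 0 <= p <= 1 -> 0 < e ->
  exists2 del, 0 < del &
    forall q, 0 <= q <= 1 -> q <= p + del -> gshift r q <= gshift r p + e.
Proof.
move=> p01 e0.
(* Since [gshift] is monotone, one quantile [b] slightly beyond [p] suffices. No real [b] lies
   beyond [p = 1], but there the bound is trivial. *)
suff [->|[b [pb Hb]]] : p = 1 \/ exists b, p < Phi b%:E /\ Phi (b + r)%:E <= gshift r p + e.
    exists 1 => // q /(gshift_unit r) /andP[_ q1] _.
    by rewrite gshift1 (le_trans q1)// lerDl ltW.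
  exists (Phi b%:E - p); first by rewrite subr_gt0.
  move=> q q01; rewrite addrC subrK => qb; apply: le_trans Hb.
  case: (unit_PhiP q01) qb => [_||y].
  - by rewrite gshift0 ltW ?Phi_gt0.
  - by rewrite leNgt Phi_lt1.
  - by rewrite gshift_Phi !ler_Phi lerD2r.
case: (unit_PhiP p01) => [||z]; last 2 first.
- by left.
- right; have /cvgrPdist_le/(_ _ e0)[eta /= eta0 H] := @Phi_continuous R (z + r).
  have eta20 : 0 < eta / 2 by rewrite divr_gt0.
  exists (z + eta / 2); rewrite ltr_Phi ltrDl; split => //.
  rewrite gshift_Phi -lerBlDl (le_trans (ler_norm _))// distrC; apply: H => /=.
  rewrite (_ : _ - _ = - (eta / 2)); last by ring.
  rewrite normrN gtr0_norm//.
  by rewrite ltr_pdivrMr// ltr_pMr// ltr1n.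
right; have /cvgrPdist_le/(_ _ e0)[b [_ H]] := @cvgNy_Phi R.
exists (b - 1 - r); split; first exact: Phi_gt0.
rewrite subrK gshift0 add0r; have := H (b - 1); rewrite gtrBl ltr01 => /(_ isT).
by rewrite sub0r normrN ger0_norm// ltW// Phi_gt0.
Qed.

(** The tangent to [gshift r] at [Phi z]: its slope is the ratio [phi (z + r) / phi z]. *)
Let line z r p := Phi (z + r)%:E + expR (- (z * r) - r ^+ 2 / 2) * (p - Phi z%:E).

Let line_ge z r y : 0 <= r -> Phi (y + r)%:E <= line z r (Phi y%:E).
Proof.
move=> r0; set k := expR (- (z * r) - r ^+ 2 / 2).
(* The slope of [gshift r] at [Phi y] decreases with [y], so [D] is minimal at the point of contact
   [z]. *)
pose D y := k * Phi y%:E - Phi (y + r)%:E.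
pose D' y := phi y * (k - expR (- (y * r) - r ^+ 2 / 2)).
have DD (t : R) : is_derive t 1 D (D' t).
  have -> : D' t = k * phi t - phi (t + r).
    rewrite /D' mulrBr mulrC; congr (_ - _); rewrite !phiE -mulrA -expRD.
    by congr (_ * expR _); field.
  apply: is_deriveB; first by have := is_derive_Phi t => ?; apply: is_derive_eq.
  apply: (@is_derive_shift_arg _ (fun t => Phi t%:E)); exact: is_derive_Phi.
have sgn t : (0 <= D' t) = (z * r <= t * r).
  by rewrite /D' pmulr_rge0 ?phi_gt0// subr_ge0 ler_expR lerD2r lerN2.
have main : D z <= D y.
  have [zy|yz] := leP z y.
    apply: (is_derive_ndecr zy (fun t _ => DD t)) => t /andP[zt _].
    by rewrite sgn ler_wpM2r.
  apply: (is_derive_nincr (ltW yz) (fun t _ => DD t)) => t /andP[_ tz].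
  by rewrite /D' mulr_ge0_le0 ?(ltW (phi_gt0 _))// subr_le0 ler_expR lerD2r lerN2 ler_wpM2r.
by move: main; rewrite /D /line -/k; lra.
Qed.

Lemma gshift_tangent z r p : 0 <= r -> 0 <= p <= 1 -> gshift r p <= line z r p.
Proof.
move=> r0 p01.
(* Extends the inequality to 0 and 1, which are not values of [Phi] on the reals, by approaching
   them. *)
have cont (a : R) : (forall e, 0 < e -> exists2 y, `|a - Phi y%:E| <= e & a - e <= Phi (y + r)%:E) ->
    a <= line z r a.
  move=> H; apply/ler_addgt0Pr => e e0.
  pose k := expR (- (z * r) - r ^+ 2 / 2); have k0 : 0 < k by rewrite expR_gt0.
  have e10 : 0 < e / (k + 1) by rewrite divr_gt0// ltr_wpDl// ltW.
  have [y ay yr] := H _ e10; rewrite -lerBlDr.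
  have H1 := line_ge z y r0.
  have H2 : line z r (Phi y%:E) <= line z r a + k * (e / (k + 1)).
    have : k * (Phi y%:E - a) <= k * (e / (k + 1)).
      by rewrite ler_pM2l// (le_trans (ler_norm _))// distrC.
    by rewrite /line -/k; lra.
  have H3 : e / (k + 1) + k * (e / (k + 1)) = e by field; rewrite gt_eqF// ltr_wpDl// ltW.
  lra.
case: (unit_PhiP p01) => [||y]; rewrite ?gshift0 ?gshift1 ?gshift_Phi; last exact: line_ge.
  apply: cont => e e0; have /cvgrPdist_le/(_ _ e0)[b [_ H]] := @cvgNy_Phi R.
  exists (b - 1); first by apply: H; rewrite gtrBl.
  by rewrite (@le_trans _ _ 0)// ?ltW ?Phi_gt0// sub0r oppr_lt0.
apply: cont => e e0; have /cvgrPdist_le/(_ _ e0)[b [_ H]] := @cvgy_Phi R.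
have H1 : `|1 - Phi (b + 1)%:E| <= e by apply: H; rewrite ltrDl.
exists (b + 1) => //; rewrite lerBlDr -lerBlDl (le_trans _ (le_trans (ler_norm _) H1))//.
by rewrite lerD2l lerN2 ler_Phi lerDl.
Qed.

(** Concavity of [isop] for the weights [eta], [eta], [1 - 2 eta] at the points 0, 1 and [p], the
    first two contributing zero. Concavity itself is the dual form, an infimum of affine
    functions. *)
Lemma isop_concave_ends p eta : 0 <= p <= 1 -> 0 <= eta <= 2^-1 ->
  (1 - 2 * eta) * isop p <= isop (eta + (1 - 2 * eta) * p).
Proof.
move=> p01 /andP[eta0 eta1]; case/andP: (p01) => p0 p1.
rewrite -[leRHS]mul1r; apply/le_isopP => // [|z].
  apply/andP; split; first by rewrite addr_ge0// mulr_ge0// subr_ge0; lra.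
  nra.
rewrite mul1r.
have H1 := isop_le_stop_loss z p01.
have H2 := @isop_le_stop_loss R 0 z; have H3 := @isop_le_stop_loss R 1 z.
move: H2 H3; rewrite (proj1 isop01) (proj2 isop01) !lexx ler01 mulr0 mulr1 addr0.
move=> /(_ isT) H2 /(_ isT) H3.
have : (1 - 2 * eta) * isop p <= (1 - 2 * eta) * (normal_stop_loss z + z * p).
  by rewrite ler_wpM2l//; lra.
nra.
Qed.

(* [Phi_inv] turns the differential inequality into a Lipschitz bound; since it
   is singular at [0] and [1], it is applied to an affine contraction of [u]
   towards [1/2]. *)
Lemma isop_growth (u u' : R -> R) C : 0 <= C ->
  (forall t : R, is_derive t 1 u (u' t)) -> (forall t, 0 <= u t <= 1) ->
  (forall t, `|u' t| <= C * isop (u t)) -> u 1 <= gshift C (u 0).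
Proof.
move=> C0 Du u01 bu; apply/ler_addgt0Pr => e e0.
have e20 : 0 < e / 2 by rewrite divr_gt0.
have [del del0 Hdel] := gshift_upper_semicontinuous C (u01 0) e20.
pose eta := Num.min (4^-1) (Num.min del (e / 2)).
have eta0 : 0 < eta by rewrite !lt_min del0 e20 invr_gt0 ltr0n.
have eta4 : eta <= 4^-1 by rewrite ge_min lexx.
have etad : eta <= del by rewrite !ge_min lexx orbT.
have etae : eta <= e / 2 by rewrite !ge_min lexx !orbT.
pose a := 1 - 2 * eta; have a0 : 0 < a by rewrite /a; lra.
pose y t := eta + a * u t.
have yu t : `|y t - u t| <= eta.
  have /andP[? ?] := u01 t; rewrite ler_norml /y /a; apply/andP; split; nra.
have y01 t : 0 < y t < 1.
  have /andP[? ?] := u01 t; rewrite /y /a; apply/andP; split; nra.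
pose th t := Phi_inv_real (y t).
have thK t : Phi (th t)%:E = y t by exact: Phi_inv_realK.
have Dy (t : R) : is_derive t 1 y (a * u' t).
  have Dut := Du t; apply: is_derive_eq; rewrite /GRing.scale /=; ring.
have Dth (t : R) : is_derive t 1 th ((a * u' t) * (phi (th t))^-1).
  have D1 : is_derive (y t) 1 (@Phi_inv_real R) (phi (th t))^-1.
    rewrite -thK; apply: (@is_derive_inverse _ (fun s => Phi s%:E)).
    - by exists 1 => //= s _; exact: PhiK.
    - by exists 1 => //= s _; exact: Phi_continuous.
    - exact: is_derive_Phi.
    - by rewrite gt_eqF ?phi_gt0.
  rewrite mulrC; exact: (@is_derive1_comp _ (@Phi_inv_real R) y).
(* Here [phi (th t)] is [isop (y t)], which dominates [a * isop (u t)] by concavity, so the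
   contracted function satisfies the same differential inequality. *)
have bth t : (a * u' t) * (phi (th t))^-1 <= C.
  rewrite ler_pdivrMr ?phi_gt0//.
  have -> : phi (th t) = isop (y t) by rewrite /isop y01.
  apply: le_trans (_ : a * (C * isop (u t)) <= _).
    by rewrite ler_pM2l// (le_trans (ler_norm _)).
  rewrite mulrCA ler_wpM2l// isop_concave_ends//.
  by rewrite (ltW eta0)/=; lra.
have th1 : th 1 <= th 0 + C.
  have [s _ H] := is_derive_MVT (@ler01 R) (fun t _ => Dth t).
  by move: H; rewrite subr0 mulr1 -lerBlDl => ->; exact: bth.
have H1 : y 1 <= gshift C (y 0).
  by rewrite -!thK gshift_Phi ler_Phi.
(* The contraction moved the initial value by at most [eta], which semicontinuity of the shift
   absorbs. *)
have H2 : gshift C (y 0) <= gshift C (u 0) + e / 2.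
  apply: Hdel; first by have /andP[? ?] := y01 0; rewrite !ltW.
  have := yu 0; rewrite ler_norml => /andP[_]; lra.
have := yu 1; rewrite ler_norml => /andP[]; lra.
Qed.

End gaussian_shift.

Section simultaneous_density.
Context {R : realType} {d : nat}.
Variable mu : probability (borel R d) R.
Variables (Psi : borel R d -> borel R d) (mPsi : measurable_fun setT Psi).

Let mPsi_mixin := isMeasurableFun.Build _ _ _ _ _ mPsi.
Let X : {mfun borel R d >-> borel R d} := HB.pack Psi mPsi_mixin.

Local Notation nu := (msum (fun n : nat =>
  if n is 0%N then (mu : {measure set (borel R d) -> \bar R}) else distribution mu X) 2).

Let nu_finite : fin_num_fun nu.
Proof. by move=> A mA; rewrite -[nu]/(measure_add mu (distribution mu X)) measure_addE fin_numD !fin_num_measure. Qed.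

HB.instance Definition _ := Measure_isFinite.Build _ _ _ nu nu_finite.

(** Density is applied to the sum of [mu] and its image under [Psi], so that one function
    approximates [A] before and after the flow. *)
Lemma test_function_density2 (A : set (borel R d)) (e : R) : measurable A -> 0 < e ->
  exists f, [/\ test_function f, forall x, 0 <= f x <= 1,
    \int[mu]_x `|f x - \1_A x| <= e & \int[mu]_x `|f (Psi x) - \1_A (Psi x)| <= e].
Proof.
move=> mA e0; have mA1 : measurable_fun setT (\1_A : borel R d -> R) by [].
have A01 := indic_unit R A.
have [f [tf f01 fA]] := @test_function_density _ _ nu (cst 1) (fun=> ler01)
  (@integrable_cst_fin _ _ _ nu 1) \1_A e mA1 A01 e0.
pose F x := `|f x - \1_A x|; have F0 x : 0 <= F x by exact: normr_ge0.
have mF : measurable_fun setT (F : borel R d -> R).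
  apply: measurableT_comp => //; apply: measurable_funB => //.
  exact: test_function_measurable.
have F1 x : `|F x| <= 1 by rewrite normr_id unit_interval_dist.
have mFP : measurable_fun setT (fun x => F (Psi x)).
  exact: (measurableT_comp mF mPsi).
have i1 := @integrable_bounded _ _ _ mu F 1 mF F1.
have i2 := @integrable_bounded _ _ _ mu (fun x => F (Psi x)) 1 mFP (fun x => F1 (Psi x)).
have E : \int[nu]_x F x = \int[mu]_x F x + \int[mu]_x F (Psi x).
  transitivity (fine (\int[measure_add mu (distribution mu X)]_x (F x)%:E)%E); first by [].
  rewrite /Rintegral ge0_integral_measure_add//; last 2 first.
  - by move=> x _; rewrite lee_fin.
  - exact/measurable_EFinP.
  rewrite ge0_integral_pushforward//; last 2 first.
  - exact/measurable_EFinP.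
  - by move=> x _; rewrite lee_fin.
  rewrite fineD//; last by exact: (integrable_fin_num _ i2).
  exact: (integrable_fin_num _ i1).
have FA : \int[nu]_x F x <= e.
  by apply: le_trans fA; rewrite le_eqVlt; apply/orP; left; apply/eqP; apply: eq_Rintegral => x _; rewrite mulr1.
have p1 : 0 <= \int[mu]_x F x by apply: Rintegral_ge0.
have p2 : 0 <= \int[mu]_x F (Psi x) by apply: Rintegral_ge0.
by exists f; split => //; apply: le_trans FA; rewrite E ?lerDl ?lerDr.
Qed.

End simultaneous_density.

Section field.
Context {R : realType} {d : nat}.
Variable K : 'cV[R]_d -> 'M[R]_d.
Implicit Types (h x y : 'cV[R]_d).

Lemma dotp_trmx_mul (A : 'M[R]_d) x h :
  dotp x (A^T *m h) = \sum_i h i 0 * dotp x (row i A)^T.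
Proof.
rewrite /dotp; under eq_bigr do rewrite mxE mulr_sumr.
rewrite exchange_big; apply: eq_bigr => i _ /=; rewrite mulr_sumr; apply: eq_bigr => j _.
by rewrite !mxE; ring.
Qed.

Lemma mul_mx_coord (A : 'M[R]_d) x i : (A *m x) i 0 = dotp x (row i A)^T.
Proof. by rewrite mxE; apply: eq_bigr => j _; rewrite !mxE mulrC. Qed.

Lemma lipschitz_field h : lipschitz K -> exists2 L : R, 0 < L &
  forall x y, `|(K x)^T *m h - (K y)^T *m h| <= L * `|x - y|.
Proof.
move=> [k [_ Hk]]; pose k1 := `|k| + 1.
have k10 : 0 < k1 by rewrite ltr_wpDl.
have KL x y : `|K x - K y| <= k1 * `|x - y|.
  apply: (Hk k1 _ (x, y)) => //.
  by rewrite /k1 (le_lt_trans (ler_norm k))// ltrDl.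
pose L := d%:R * (k1 * `|h|).
have L0 : 0 <= L by rewrite !mulr_ge0// ltW.
exists (L + 1); first by rewrite ltr_wpDl.
move=> x y; rewrite -mulmxBl -linearB /=.
apply: (@le_trans _ _ (L * `|x - y|)); last by rewrite ler_wpM2r// lerDl.
apply: norm_cV_le; first by rewrite mulr_ge0.
move=> i; rewrite mxE (le_trans (ler_norm_sum _ _ _))//.
apply: (@le_trans _ _ (\sum_(j < d) (k1 * `|x - y| * `|h|))).
  apply: ler_sum => j _; rewrite normrM ler_pM ?norm_coord_le// mxE.
  apply: le_trans (KL x y); rewrite [leRHS]mx_normrE.
  exact: (le_bigmax _ (fun ij : 'I_d * 'I_d => `|(K x - K y) ij.1 ij.2|) (j, i)).
rewrite sumr_const card_ord -[leLHS]mulr_natl /L le_eqVlt; apply/orP; left; apply/eqP.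
by ring.
Qed.

Lemma flow_is_flow h : lipschitz K -> is_flow K h (flow K h).
Proof.
move=> /(lipschitz_field h)[L L0 VL].
have /choice[Psi HPsi] x := solution_exists L0 VL x.
apply: xgetPex; exists (fun t x => Psi x t) => x.
by have [? ?] := HPsi x; split.
Qed.

(** Both sides solve the same Cauchy problem. It makes (C1), which speaks of time 1 only, a
    statement about all times. *)
Lemma flow_scale h (t : R) : lipschitz K -> flow K (t *: h) 1 = flow K h t.
Proof.
move=> lK; have [L L0 VL] := lipschitz_field (t *: h) lK.
apply/funext => x.
have Fh := flow_is_flow h lK; have Fth := flow_is_flow (t *: h) lK.
have s1 : solution (fun x => (K x)^T *m (t *: h)) (fun s => flow K (t *: h) s x).
  by have [] := Fth x.
have s2 : solution (fun x => (K x)^T *m (t *: h)) (fun s => flow K h (t * s) x).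
  move=> s; rewrite -scalemxAr; have [_ D] := Fh x.
  apply/is_derive_cVP => i; have /is_derive_cVP/(_ i) Di := D (t * s).
  have Dm : is_derive s 1 (fun s : R => t * s) t.
    apply: is_derive_eq; rewrite /GRing.scale /=; ring.
  rewrite mxE mulrC; exact: (@is_derive1_comp _ (fun s => flow K h s x i 0) (fun s => t * s)).
have /(_ _)/(congr1 (fun X => X 1)) /= := solution_unique L0 VL s1 s2.
by rewrite mulr1; apply; rewrite mulr0 (Fth x).1 (Fh x).1.
Qed.

End field.

(** * From the inequality for functions to the flow bounds and back *)

Section flow_domination.
Context {R : realType} {d : nat}.
Variables (mu : probability (borel R d) R) (c : R).
Variables (v : 'cV[R]_d -> 'cV[R]_d) (K : 'cV[R]_d -> 'M[R]_d).
Hypothesis c0 : 0 < c.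
Hypothesis hv : forall i : 'I_d,
  is_divergence mu (fun x => (row i (K x))^T) (fun x => v x i 0).

Lemma divergence_integrable i : mu.-integrable setT (fun x => (v x i 0)%:E).
Proof. by have [] := hv i. Qed.

Lemma vmean_mul_gradient f : test_function f ->
  vmean mu (fun x => K x *m gradient f x) = vmean mu (fun x => f x *: v x).
Proof.
move=> tf; apply/colP => i; rewrite !mxE /mean.
under eq_Rintegral do rewrite mul_mx_coord.
under [RHS]eq_Rintegral do rewrite mxE.
by have [_ /(_ f tf)[_]] := hv i.
Qed.

Lemma field_divergence h f : test_function f ->
  mu.-integrable setT (fun x => (dotp (gradient f x) ((K x)^T *m h))%:E) /\
  mean mu (fun x => dotp (gradient f x) ((K x)^T *m h)) = mean mu (fun x => f x * dotp h (v x)).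
Proof.
move=> tf; have [M [M0 HM]] := test_function_bounded tf.
have mf := test_function_measurable tf.
have i1 i := ((hv i).2 f tf).1; have E1 i := ((hv i).2 f tf).2.
have i2 i : mu.-integrable setT (EFin \o (fun x => f x * v x i 0)).
  exact: (integrable_prod mf HM (divergence_integrable i)).
have [J1 S1] := @Rintegral_sum _ _ _ mu _ (index_enum 'I_d)
  (fun i x => h i 0 * dotp (gradient f x) (row i (K x))^T) (fun i => integrable_rscale (h i 0) (i1 i)).
have [J2 S2] := @Rintegral_sum _ _ _ mu _ (index_enum 'I_d)
  (fun i x => h i 0 * (f x * v x i 0)) (fun i => integrable_rscale (h i 0) (i2 i)).
split.
  by under [X in _.-integrable _ X]eq_fun do rewrite dotp_trmx_mul.
rewrite /mean; under eq_Rintegral do rewrite dotp_trmx_mul.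
rewrite S1; transitivity (\sum_i \int[mu]_x (h i 0 * (f x * v x i 0))).
  apply: eq_bigr => i _; rewrite RintegralZl//; last exact: i1.
  by rewrite RintegralZl; [congr (_ * _); exact: E1| |exact: i2].
rewrite -S2; apply: eq_Rintegral => x _.
by rewrite /dotp mulr_sumr; apply: eq_bigr => i _; rewrite mulrCA.
Qed.

Lemma integrable_dotp_field h : mu.-integrable setT (EFin \o (fun x => dotp h (v x))).
Proof. by have [] := dotp_vmean h divergence_integrable. Qed.

Hypothesis lK : lipschitz K.

Let Psi h := flow K h.

Let V (h x : 'cV[R]_d) : 'cV[R]_d := (K x)^T *m h.

Let Psi_0 h x : Psi h 0 x = x.
Proof. by have [] := flow_is_flow h lK x. Qed.

Let Psi_solution h x : solution (V h) (fun t => Psi h t x).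
Proof. by have [] := flow_is_flow h lK x. Qed.

Let Psi_continuous h t (f : 'cV[R]_d -> R) : continuous f -> continuous (fun x => f (Psi h t x)).
Proof.
have [L L0 VL] := lipschitz_field h lK.
exact: (flow_continuous L0 VL (@Psi_0 h) (@Psi_solution h)).
Qed.

Let Psi_measurable h t : measurable_fun setT (Psi h t : borel R d -> borel R d).
Proof.
apply: measurable_fun_colP => i; apply: (@continuous_borel_measurable _ _ (fun x => Psi h t x i 0)).
by apply: (@Psi_continuous h t (fun x => x i 0)); exact: coord_continuous.
Qed.

Let Psi_preimage h t (A : set (borel R d)) : measurable A ->
  measurable (Psi h t @^-1` A : set (borel R d)).
Proof. by move=> mA; rewrite -[X in measurable X]setTI; exact: Psi_measurable. Qed.

Let u h f t := mean mu (fun x => f (Psi h t x)).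

Let is_derive_u h f (t : R) : test_function f ->
  is_derive t 1 (u h f) (mean mu (fun x => f (Psi h t x) * dotp h (v x))).
Proof.
move=> tf; have [L L0 VL] := lipschitz_field h lK.
rewrite -(flow_divergence L0 VL (@Psi_0 h) (@Psi_solution h) (integrable_dotp_field h)
  (@field_divergence h) t tf).
exact: (is_derive_flow_mean L0 VL (@Psi_0 h) (@Psi_solution h)).
Qed.

Let unit_flow h t f : test_function f -> (forall x, 0 <= f x <= 1) ->
  measurable_fun setT (fun x : borel R d => f (Psi h t x)) /\
  mu.-integrable setT (EFin \o (fun x => f (Psi h t x))) /\ 0 <= u h f t <= 1.
Proof.
move=> tf f01; have mf : measurable_fun setT (fun x : borel R d => f (Psi h t x)).
  apply: continuous_borel_measurable; apply: Psi_continuous.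
  by apply: smooth_continuous; case: tf.
by split => //; exact: (@mean_unit_interval _ _ _ mu _ mf).
Qed.

Let unit_prob (A : set (borel R d)) : measurable A -> 0 <= fine (mu A) <= 1.
Proof.
by move=> mA; rewrite fine_ge0//= -lee_fin fineK ?probability_le1// fin_num_measure.
Qed.

Let mean_indic (A : set (borel R d)) : measurable A -> \int[mu]_x \1_A x = fine (mu A).
Proof. by move=> mA; rewrite /Rintegral integral_indic// setIT. Qed.

Section to_flow.
Hypothesis dom : forall g : borel R d -> R,
  measurable_fun setT g -> (forall x, 0 <= g x <= 1) ->
  enorm (vmean mu (fun x => g x *: v x)) <= c * isop (mean mu g).

Let bound h g : measurable_fun setT (g : borel R d -> R) -> (forall x, 0 <= g x <= 1) ->
  `|mean mu (fun x => g x * dotp h (v x))| <= c * enorm h * isop (mean mu g).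
Proof.
move=> mg g01; rewrite -[X in `|X|](dotp_vmean_scale divergence_integrable h mg g01).
have H y : dotp y (vmean mu (fun x => g x *: v x)) <= c * enorm y * isop (mean mu g).
  rewrite (le_trans (dotp_le _ _))// mulrAC mulrC ler_wpM2r ?enorm_ge0//.
  exact: dom.
by rewrite ler_norml -lerN2 opprK -dotpNl -{1}[enorm h]enormN !H.
Qed.

Lemma flow_upper_bound h (A : set (borel R d)) : measurable A ->
  fine (mu (flow K h 1 @^-1` A)) <= gshift (c * enorm h) (fine (mu A)).
Proof.
move=> mA; set r := c * enorm h.
have r0 : 0 <= r by rewrite mulr_ge0 ?enorm_ge0// ltW.
apply/ler_addgt0Pr => e e0; have e20 : 0 < e / 2 by rewrite divr_gt0.
have [del del0 Hdel] := gshift_upper_semicontinuous r (unit_prob mA) e20.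
(* The tolerance [del] is for the initial mass, inside the shift; [e / 2] is for the final mass. *)
have m0 : 0 < Num.min del (e / 2) by rewrite lt_min del0.
have [f [tf f01 f1 f2]] := test_function_density2 mu (@Psi_measurable h 1) mA m0.
have mPA := @Psi_preimage h 1 A mA.
have close (P : borel R d -> R) (Q : borel R d -> R) : measurable_fun setT P ->
    measurable_fun setT Q -> (forall x, 0 <= P x <= 1) -> (forall x, 0 <= Q x <= 1) ->
    `|\int[mu]_x P x - \int[mu]_x Q x| <= \int[mu]_x `|P x - Q x|.
  move=> mP mQ P01 Q01.
  have [iP _] := @mean_unit_interval _ _ _ mu P mP P01.
  have [iQ _] := @mean_unit_interval _ _ _ mu Q mQ Q01.
  rewrite -RintegralB//; apply: le_normr_Rintegral => //.
  exact: (integrable_rsub iP iQ).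
have A01 := indic_unit R A.
have [mf0 [_ u0]] := unit_flow h 0 tf f01; have [mf1 [_ u1]] := unit_flow h 1 tf f01.
have mf := test_function_measurable tf.
have u0E : u h f 0 = mean mu f.
  by apply: eq_Rintegral => x _; rewrite Psi_0.
have H1 : fine (mu (flow K h 1 @^-1` A)) <= u h f 1 + e / 2.
  have mI : measurable_fun setT (\1_A : borel R d -> R) by exact: measurable_indic.
  have := close _ (fun x => \1_A (Psi h 1 x)) mf1 (measurableT_comp mI (Psi_measurable h 1))
    (fun x => f01 _) (fun x => A01 _).
  move=> /le_trans /(_ f2); rewrite le_min => /andP[_].
  rewrite (_ : \int[mu]_x \1_A (Psi h 1 x) = fine (mu (flow K h 1 @^-1` A))).
    by rewrite distrC ler_norml => /andP[_]; rewrite -/(mean mu _) -/(u h f 1) lerBlDl addrC.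
  rewrite -(mean_indic mPA); apply: eq_Rintegral => x _.
  by [].
have H2 : u h f 0 <= fine (mu A) + del.
  rewrite u0E -(mean_indic mA) addrC -lerBlDr (le_trans (ler_norm _))//.
  rewrite (le_trans (close _ _ mf _ f01 A01))//.
  by rewrite (le_trans f1)// ge_min lexx.
have H3 : u h f 1 <= gshift r (u h f 0).
  apply: (isop_growth r0 (fun t => is_derive_u h t tf)) => t.
    by have [_ []] := unit_flow h t tf f01.
  by have [mft _] := unit_flow h t tf f01; exact: bound.
have H4 := Hdel _ u0 H2.
lra.
Qed.

Lemma flow_bounds h (A : set (borel R d)) : measurable A ->
  let p := fine (mu A) in
  let q := fine (mu (flow K h 1 @^-1` A)) in
  Phi (Phi_inv p - (c * enorm h)%:E)%E <= q /\
  q <= Phi (Phi_inv p + (c * enorm h)%:E)%E.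
Proof.
move=> mA p q; split; last exact: flow_upper_bound.
(* Reflection turns a shift by [- r] into one by [r] of the complementary mass, so the upper bound
   for the complement applies. *)
rewrite -EFinN -/(gshift _ p) gshiftN; last exact: unit_prob.
have mPA := @Psi_preimage h 1 A mA.
have fineC (B : set (borel R d)) : measurable B -> fine (mu (~` B)) = 1 - fine (mu B).
  by move=> mB; rewrite probability_setC// fineB ?fin_num_measure.
have := flow_upper_bound h (measurableC mA).
rewrite preimage_setC !fineC// -/p -/q => H; lra.
Qed.

End to_flow.

Section from_flow.
Hypothesis flow_le : forall h (A : set (borel R d)), measurable A ->
  fine (mu (flow K h 1 @^-1` A)) <= gshift (c * enorm h) (fine (mu A)).

Let layers n (g : borel R d -> R) : R :=
  n.+1%:R^-1 * \sum_(k < n.+1) fine (mu [set x | k%:R / n.+1%:R < g x]).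

Let mean_layers n (g : borel R d -> R) : measurable_fun setT g -> (forall x, 0 <= g x <= 1) ->
  mean mu g <= layers n g <= mean mu g + n.+1%:R^-1.
Proof.
move=> mg g01; have [ig _] := @mean_unit_interval _ _ _ mu g mg g01.
pose A (k : 'I_n.+1) : set (borel R d) := [set x | k%:R / n.+1%:R < g x].
have mA k : measurable (A k) by exact: measurable_superlevel.
have iA k : mu.-integrable setT (EFin \o (\1_(A k) : borel R d -> R)).
  have mI : measurable_fun setT (\1_(A k) : borel R d -> R) by exact: measurable_indic.
  by have [] := @mean_unit_interval _ _ _ mu (\1_(A k)) mI (indic_unit R (A k)).
have [iS ES] := @Rintegral_sum _ _ _ mu _ (index_enum 'I_n.+1) (fun k => \1_(A k)) iA.
have iS' := integrable_rscale n.+1%:R^-1 iS.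
have -> : layers n g = \int[mu]_x (n.+1%:R^-1 * \sum_k \1_(A k) x).
  rewrite RintegralZl// ES /layers; congr (_ * _); apply: eq_bigr => k _.
  by rewrite mean_indic.
have AE x : \sum_(k < n.+1) (\1_(A k) x : R) = \sum_(k < n.+1) (k%:R / n.+1%:R < g x)%R%:R.
  by apply: eq_bigr => k _; exact: indic_superlevel.
apply/andP; split.
  apply: le_Rintegral => // x _; rewrite AE.
  by have /andP[] := unit_layers n (g01 x).
have -> : mean mu g + n.+1%:R^-1 = \int[mu]_x (g x + n.+1%:R^-1).
  rewrite RintegralD//; last exact: (@integrable_cst_fin _ _ _ mu).
  by rewrite Rintegral_cst// [X in fine X]probability_setT mulr1.
apply: le_Rintegral => //.
  by apply: integrable_radd => //; exact: (@integrable_cst_fin _ _ _ mu).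
move=> x _; rewrite AE.
by have /andP[] := unit_layers n (g01 x).
Qed.

(** The shift is not affine and cannot be averaged over level sets; its tangent line can, and its
    positive slope preserves the layer estimates. *)
Let flow_tangent h f (t z r : R) : test_function f -> (forall x, 0 <= f x <= 1) -> 0 < t ->
  r = c * (t * enorm h) ->
  u h f t <= Phi (z + r)%:E + expR (- (z * r) - r ^+ 2 / 2) * (mean mu f - Phi z%:E).
Proof.
move=> tf f01 t0 rE; set k := expR _; have k0 : 0 < k by exact: expR_gt0.
have r0 : 0 <= r by rewrite rE mulr_ge0 ?(ltW c0)// mulr_ge0 ?enorm_ge0// ltW.
have mf := test_function_measurable tf.
have [mft _] := unit_flow h t tf f01.
have main n : u h f t <= Phi (z + r)%:E + k * (mean mu f + n.+1%:R^-1 - Phi z%:E).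
  (* Superlevel sets of [f o Psi_t] are preimages of those of [f], so both means are discretized at
     the same levels, the errors being on the favourable sides. *)
  have /andP[H1 _] := @mean_layers n (fun x => f (Psi h t x)) mft (fun x => f01 _).
  have /andP[_ H2] := @mean_layers n f mf f01.
  apply: (le_trans H1); apply: (@le_trans _ _ (Phi (z + r)%:E + k * (layers n f - Phi z%:E))).
    have -> : Phi (z + r)%:E + k * (layers n f - Phi z%:E) =
        n.+1%:R^-1 * \sum_(j < n.+1) (Phi (z + r)%:E +
          k * (fine (mu [set x : borel R d | j%:R / n.+1%:R < f x]) - Phi z%:E)).
      move: (Phi (z + r)%:E) (Phi z%:E) => P1 P2.
      rewrite big_split/= sumr_const card_ord -mulr_sumr sumrB sumr_const card_ord /layers.
      rewrite -[P1 *+ _]mulr_natl -[P2 *+ _]mulr_natl.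
      have N0 : n.+1%:R != 0 :> R by rewrite pnatr_eq0.
      set S := \sum_(i < n.+1) _; clearbody S.
      by move: (n.+1%:R : R) N0 => N N0; field.
    rewrite ler_wpM2l ?invr_ge0//; apply: ler_sum => j _.
    have mA : measurable [set x : borel R d | j%:R / n.+1%:R < f x] by exact: measurable_superlevel.
    apply: le_trans (gshift_tangent z r0 (unit_prob mA)).
    have := flow_le (t *: h) mA; by rewrite flow_scale// enormZ gtr0_norm// -rE.
  by rewrite lerD2l ler_pM2l// lerD2r.
apply/ler_addgt0Pr => e e0; have ek : 0 < e / k by rewrite divr_gt0.
have [n Hn] : exists n, n.+1%:R^-1 <= e / k.
  have /cvgrPdist_le/(_ _ ek)[n _ /(_ n (leqnn n))] := @cvg_harmonic R.
  by rewrite sub0r normrN ger0_norm ?invr_ge0// => H; exists n.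
have Hk : k * n.+1%:R^-1 <= e by rewrite mulrC -ler_pdivlMr.
apply: le_trans (main n) _; move: Hk.
by move: (n.+1%:R^-1) (Phi _) (Phi _) (mean _ _) => N P1 P2 m; lra.
Qed.

Let is_derive_ge0 (D : R -> R) (l : R) : is_derive (0 : R) 1 D l -> D 0 = 0 ->
  (forall t, 0 < t -> 0 <= D t) -> 0 <= l.
Proof.
move=> /is_derive_epsP DD D0 Dge; apply/ler_addgt0Pr => e e0; have [b b0 Hb] := DD e e0.
have b20 : 0 < b / 2 by rewrite divr_gt0.
have := Hb (b / 2); rewrite gtr0_norm// ltr_pdivrMr// ltr_pMr// ltr1n => /(_ isT).
rewrite D0 subr0 add0r /GRing.scale /= mulr1 ler_norml => /andP[_ H].
have := Dge _ b20 => H2.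
have H3 : 0 <= b / 2 * (l + e) by rewrite mulrDr; lra.
by rewrite pmulr_rge0 in H3.
Qed.

Lemma flow_test_function_domination f : test_function f -> (forall x, 0 <= f x <= 1) ->
  enorm (vmean mu (fun x => f x *: v x)) <= c * isop (mean mu f).
Proof.
move=> tf f01; set Y := vmean _ _; set p := mean mu f.
have mf := test_function_measurable tf.
have [_ p01] := @mean_unit_interval _ _ _ mu f mf f01.
apply/le_isopP => // z; have [->|Y0] := eqVneq Y 0.
  rewrite enorm0; apply: (le_isopP 0 c0 p01).1.
  by rewrite mulr_ge0 ?isop_ge0// ltW.
have e0 : 0 < enorm Y by rewrite enorm_gt0.
(* The flow direction is [Y] itself. The contact point is [- z], as in [isop_stop_loss]; the
   derivative at 0 is then [enorm Y] times the dual inequality for [z]. *)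
pose a := c * enorm Y; pose zz := - z.
pose D t := Phi (zz + a * t)%:E + expR (- (zz * (a * t)) - (a * t) ^+ 2 / 2) * (p - Phi zz%:E) - u Y f t.
have u0 : u Y f 0 = p by apply: eq_Rintegral => x _; rewrite Psi_0.
have du : is_derive (0 : R) 1 (u Y f) (enorm Y ^+ 2).
  have := @is_derive_u Y f 0 tf.
  rewrite (_ : mean mu (fun x => f (Psi Y 0 x) * dotp Y (v x)) = enorm Y ^+ 2)//.
  rewrite enorm_sqr {2}/Y (dotp_vmean_scale divergence_integrable Y mf f01).
  by apply: eq_Rintegral => x _; rewrite Psi_0.
have dP : is_derive (0 : R) 1 (fun t => Phi (zz + a * t)%:E) (phi zz * a).
  have Da : is_derive (0 : R) 1 (fun t => zz + a * t) a.
    apply: is_derive_eq; rewrite /GRing.scale /=; ring.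
  have Dp : is_derive (zz + a * 0) 1 (fun t => Phi t%:E) (phi zz).
    by rewrite mulr0 addr0; exact: is_derive_Phi.
  exact: (@is_derive1_comp _ (fun t => Phi t%:E) (fun t => zz + a * t)).
have de : is_derive (0 : R) 1 (fun t => expR (- (zz * (a * t)) - (a * t) ^+ 2 / 2)) (- (zz * a)).
  apply: is_derive_eq; rewrite !mulr0 expr0n /= mul0r subr0 oppr0 expR0 /GRing.scale /=; ring.
have dD : is_derive (0 : R) 1 D (phi zz * a + (- (zz * a)) * (p - Phi zz%:E) - enorm Y ^+ 2).
  apply: is_deriveB; apply: is_deriveD => //.
  apply: is_derive_eq; rewrite /GRing.scale /=; ring.
have /is_derive_ge0 H := dD.
have {H} : 0 <= phi zz * a + (- (zz * a)) * (p - Phi zz%:E) - enorm Y ^+ 2.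
  apply: H => [|t t0].
    rewrite /D !mulr0 addr0 expr0n /= mul0r subr0 oppr0 expR0 u0; ring.
  rewrite /D subr_ge0; apply: flow_tangent => //.
  by rewrite /a; ring.
rewrite /zz PhiN phiN => H.
rewrite -(ler_pM2l e0) -expr2 /normal_stop_loss.
by move: H; rewrite /a; lra.
Qed.

End from_flow.
End flow_domination.

(** * The theorem *)

Theorem theorem2 (R : realType) (d : nat) (mu : probability (borel R d) R)
    (hmu : exists w, is_log_gradient mu w)
    (c : R) (hc : 0 < c)
    (v : 'cV[R]_d -> 'cV[R]_d) (K : 'cV[R]_d -> 'M[R]_d)
    (hv : forall i : 'I_d,
      is_divergence mu (fun x => (row i (K x))^T) (fun x => v x i 0)) :
  let A1 := lift_zonoid mu v `<=` lift_zonoid (gaussian c d) id in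
  let B1 := forall f : 'cV[R]_d -> R, test_function f ->
    (forall x, 0 <= f x <= 1) ->
    enorm (vmean mu (fun x => K x *m gradient f x)) <= c * isop (mean mu f) in
  let C1 := forall (h : 'cV[R]_d) (A : set (borel R d)), measurable A ->
    let p := fine (mu A) in
    let q := fine (mu (flow K h 1 @^-1` A)) in
    Phi (Phi_inv p - (c * enorm h)%:E)%E <= q /\
    q <= Phi (Phi_inv p + (c * enorm h)%:E)%E in
  [/\ A1 <-> B1,
      lipschitz K -> (A1 <-> C1) /\ (B1 <-> C1) &
      A1 -> forall f : 'cV[R]_d -> R, test_function f -> (forall x, 0 <= f x) ->
        enorm (vmean mu (fun x => K x *m gradient f x)) ^+ 2
          <= 2 * c ^+ 2 * Ent mu f * mean mu f].
Proof.
move=> A1 B1 C1.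
have iv := divergence_integrable hv.
pose dom := forall g : borel R d -> R, measurable_fun setT g ->
  (forall x, 0 <= g x <= 1) ->
  enorm (vmean mu (fun x => g x *: v x)) <= c * isop (mean mu g).
have A1dom : A1 <-> dom by exact: lift_zonoid_sub_gaussianP.
have B1dom : B1 <-> dom.
  apply: (iff_trans _ (test_function_domination hc iv)); split=> H f tf f01.
    by rewrite -(vmean_mul_gradient hv tf); exact: H.
  by rewrite (vmean_mul_gradient hv tf); exact: H.
have C1dom : lipschitz K -> (C1 <-> dom).
  move=> lK; split=> [H|D]; last by move=> h A mA; exact: flow_bounds.
  apply/(test_function_domination hc iv) => f tf f01.
  apply: (flow_test_function_domination hc hv lK) => // h A mA.
  by have [] := H h A mA.
split; first by rewrite A1dom B1dom.
  by move=> lK; rewrite A1dom B1dom; split; apply: iff_sym; exact: C1dom.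
move=> /A1dom D f tf f0; rewrite (vmean_mul_gradient hv tf).
exact: entropy_domination.
Qed.
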